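(* Let $0<a\le1$, let $a+1>\operatorname{Re}(b)$ and let $x>0$ be real. Then $$E_{a,b}(-x)=-\frac{x^{\frac{1-b}{a}}\sin\pi(a-b)}{\pi}\int_{0}^{\infty}\frac{u^{a-b}}{1+2u^{a}\cos\pi a+u^{2a}}e^{-x^{\frac1a}u}\,du+\frac{x^{\frac{1-b}{a}}\sin\pi b}{\pi}\int_{0}^{\infty}\frac{u^{2a-b}}{1+2u^{a}\cos\pi a+u^{2a}}e^{-x^{\frac1a}u}\,du .$$
   Context: The Mittag-Leffler function is $E_{a,b}(z)=\sum_{k=0}^{\infty}\frac{z^{k}}{\Gamma(b+ak)}$ for $\operatorname{Re}(a)>0$ and complex $b$, with $1/\Gamma$ the entire reciprocal Gamma function.
   Formalization: At a=1 both integrals diverge (the denominator is (1-u)^2, a double pole at u=1), so the formula is proved for 0<a<1, with convergence of both integrals; for a=1 it is proved that the right-hand side taken at a'<1 tends to E_{1,b}(-x) as a' tends to 1. *)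

(* Defs.v *)
From HB Require Import structures.
From mathcomp Require Import all_boot all_order all_algebra.
From mathcomp Require Import all_classical all_reals all_analysis.
From mathcomp Require Import complex.

Set Implicit Arguments.
Unset Strict Implicit.
Unset Printing Implicit Defensive.

Import Order.TTheory GRing.Theory Num.Theory.
Import numFieldNormedType.Exports.

Local Open Scope classical_set_scope.
Local Open Scope complex_scope.
Local Open Scope ring_scope.

Definition cexp (R : realType) (z : R[i]) : R[i] :=
  (expR (complex.Re z))%:C
  * Complex (cos (complex.Im z)) (sin (complex.Im z)).

Definition csin (R : realType) (z : R[i]) : R[i] :=
  (cexp ('i%C * z) - cexp (- ('i%C * z))) / (2 * 'i%C).

(* Principal power u ^ c; meaningful only for u > 0. *)
Definition cpow (R : realType) (u : R) (c : R[i]) : R[i] :=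
  cexp (c * (ln u)%:C).

Definition cintegrable (R : realType) (f : R -> R[i]) : Prop :=
  lebesgue_measure.-integrable `]0, +oo[
    (EFin \o (fun u => complex.Re (f u))) /\
  lebesgue_measure.-integrable `]0, +oo[
    (EFin \o (fun u => complex.Im (f u))).

(* Lebesgue integral over ]0, +oo[ of a complex-valued function; meaningful
   only when cintegrable f holds. *)
Definition cintegral (R : realType) (f : R -> R[i]) : R[i] :=
  Complex (\int[lebesgue_measure]_(u in `]0, +oo[) complex.Re (f u))
          (\int[lebesgue_measure]_(u in `]0, +oo[) complex.Im (f u)).

(* Euler's integral; it is the Gamma function only for 0 < Re z. *)
Definition eulerGamma (R : realType) (z : R[i]) : R[i] :=
  cintegral (fun t => cpow t (z - 1) * (expR (- t))%:C).

(* Entire extension of 1 / Gamma by the functional equation: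
   1 / Gamma(z) = z (z + 1) ... (z + n - 1) / Gamma(z + n),
   with n chosen so that 0 < Re (z + n). *)
Definition rGamma (R : realType) (z : R[i]) : R[i] :=
  let n := (Num.truncn (- complex.Re z)).+1 in
  (\prod_(k < n) (z + k%:R)) / eulerGamma (z + n%:R).

(* R[i]^o is R[i] with the topology of its modulus. *)
Definition mittagLeffler (R : realType) (a b z : R[i]) : R[i] :=
  limn (series (fun k : nat => z ^+ k * rGamma (b + a * k%:R) : R[i]^o)).

Definition mlIntegrand (R : realType) (a x : R) (c : R[i]) (u : R) : R[i] :=
  cpow u c
  / (1 + 2 * u `^ a * cos (pi * a) + u `^ (2 * a))%:C
  * (expR (- (x `^ a^-1 * u)))%:C.

Definition mlIntegralRep (R : realType) (a : R) (b : R[i]) (x : R) : R[i] :=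
  - (cpow x ((1 - b) / a%:C) * csin (pi%:C * (a%:C - b)) / pi%:C)
    * cintegral (mlIntegrand a x (a%:C - b))
  + (cpow x ((1 - b) / a%:C) * csin (pi%:C * b) / pi%:C)
    * cintegral (mlIntegrand a x ((2 * a)%:C - b)).

(* Main.v *)
Require Import Defs.
From HB Require Import structures.
From mathcomp Require Import all_boot all_order all_algebra.
From mathcomp Require Import all_classical all_reals all_analysis.
From mathcomp Require Import measurable_realfun.
From mathcomp Require Import complex ring lra.

(** For [F] holomorphic near the cut plane put
    [hankel r F = int F(s) ds / s] over the Hankel contour of radius [r].
    Cauchy's theorem makes it independent of [r] and lets the contour collapse
    onto the negative axis when [F] is small at [0].
    For [F = e^s s^(1-z)] this gives Hankel's formula
    [hankel 1 F = 2 i pi / Gamma(z)]: collapsing the contour, it is the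
    reflection formula when [0 < Re z < 1], and integration by parts gives the
    recurrence in [z].
    Summing the formula over the coefficients [1 / Gamma(b + a k)], with [r] so
    large that [x s^(-a)] is at most [1/2] in modulus, yields
    [E_(a,b)(-x) = hankel r (e^s s^(1-b) / (1 + x s^(-a))) / (2 i pi)].
    For [a < 1] the kernel has no pole on the closed cut plane and is small at
    [0] because [Re b < a + 1]: collapsing the contour and rescaling the cut by
    [x^(1/a)] turns this into the two real integrals.  With [r] fixed, the
    Hankel integral is continuous in [a], which gives the limit [a = 1]. *)

Set Implicit Arguments.
Unset Strict Implicit.
Unset Printing Implicit Defensive.

Import Order.TTheory GRing.Theory Num.Theory.
Import numFieldNormedType.Exports.

Local Open Scope classical_set_scope.
Local Open Scope complex_scope.
Local Open Scope ring_scope.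

Local Notation Re := complex.Re.
Local Notation Im := complex.Im.
Local Notation normc := ComplexField.Normc.normc.

(** * Complex numbers, exponentials and limits *)

(** All of it is done in coordinates [s = u e^(i t)] with [t] a real number, that is, on the Riemann
    surface of the logarithm. The two sides of the cut are then the distinct rays [t = pi] and
    [t = - pi], and a power is the exponential of a multiple of [ln u + i t], smooth across both.
    The form [ds / s] is [du / u] on rays and [i dt] on circles, so a circle contributes at most a
    constant times the supremum of [|F|] on it, whatever its radius. Cauchy's theorem reduces to
    differentiation under the integral sign. The reflection formula rests on it too: turning the ray
    of the Beta integral by [pi / 2] in both directions compares [z] with [z / 2], and repeated
    halving leads to [0], where the value is known. The obstacle at [a = 1] is the pole [s = - x],
    which then lies on the cut. A radius [r >= 2 x] keeps it inside the circle, so the Hankel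
    integral keeps its meaning although the collapsed integrals diverge. *)

Section complex_basics.
Variable R : realType.
Implicit Types (x y z : R[i]) (t : R).

Lemma complex_eq x y : Re x = Re y -> Im x = Im y -> x = y.
Proof. by case: x y => a b [c d] /= -> ->. Qed.

Lemma cReD x y : Re (x + y) = Re x + Re y. Proof. by case: x y => ? ? []. Qed.
Lemma cImD x y : Im (x + y) = Im x + Im y. Proof. by case: x y => ? ? []. Qed.
Lemma cReN x : Re (- x) = - Re x. Proof. by case: x. Qed.
Lemma cImN x : Im (- x) = - Im x. Proof. by case: x. Qed.
Lemma cReM x y : Re (x * y) = Re x * Re y - Im x * Im y.
Proof. by case: x y => ? ? []. Qed.
Lemma cImM x y : Im (x * y) = Re x * Im y + Im x * Re y.
Proof. by case: x y => ? ? []. Qed.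
Lemma cReV x : Re x^-1 = Re x / (Re x ^+ 2 + Im x ^+ 2).
Proof. by case: x. Qed.
Lemma cImV x : Im x^-1 = - (Im x / (Re x ^+ 2 + Im x ^+ 2)).
Proof. by case: x. Qed.
Lemma Re_real t : Re t%:C = t. Proof. by []. Qed.
Lemma Im_real t : Im t%:C = 0. Proof. by []. Qed.
Lemma Re_nat n : Re (n%:R : R[i]) = n%:R.
Proof. by rewrite -(rmorph_nat (real_complex R)). Qed.
Lemma Im_nat n : Im (n%:R : R[i]) = 0.
Proof. by rewrite -(rmorph_nat (real_complex R)). Qed.
Lemma Re1 : Re (1 : R[i]) = 1. Proof. by []. Qed.
Lemma Im1 : Im (1 : R[i]) = 0. Proof. by []. Qed.
Lemma Re0 : Re (0 : R[i]) = 0. Proof. by []. Qed.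
Lemma Im0 : Im (0 : R[i]) = 0. Proof. by []. Qed.
Lemma Re_i : Re ('i : R[i]) = 0. Proof. by []. Qed.
Lemma Im_i : Im ('i : R[i]) = 1. Proof. by []. Qed.

Definition reimE := (cReD, cImD, cReN, cImN, cReM, cImM, Re_real, Im_real, Re_i, Im_i,
  Re1, Im1, Re0, Im0, Re_nat, Im_nat).

Lemma cReMr t x : Re (t%:C * x) = t * Re x.
Proof. by rewrite !reimE mul0r subr0. Qed.
Lemma cImMr t x : Im (t%:C * x) = t * Im x.
Proof. by rewrite !reimE mul0r addr0. Qed.

Lemma ii : 'i * 'i = - 1 :> R[i].
Proof. by rewrite -expr2 sqr_i. Qed.

Lemma i_neq0 : 'i != 0 :> R[i].
Proof. by rewrite eq_complex /= oner_eq0 andbF. Qed.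

Lemma normcM x y : normc (x * y) = normc x * normc y.
Proof. exact: ComplexField.Normc.normcM. Qed.
Lemma normcV x : normc x^-1 = (normc x)^-1.
Proof. exact: ComplexField.Normc.normcV. Qed.
Lemma normcE x : normc x = Num.sqrt (Re x ^+ 2 + Im x ^+ 2).
Proof. by case: x. Qed.
Lemma normc_ge0 x : 0 <= normc x. Proof. by rewrite normcE sqrtr_ge0. Qed.
Lemma normc_real t : normc t%:C = `|t|.
Proof. by rewrite normcE /= expr0n /= addr0 sqrtr_sqr. Qed.
Lemma normcN x : normc (- x) = normc x.
Proof. by rewrite !normcE !reimE !sqrrN. Qed.
Lemma normc_nrm x : `|x| = (normc x)%:C.
Proof. by rewrite normc_def normcE. Qed.
Lemma normcD x y : normc (x + y) <= normc x + normc y.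
Proof. by rewrite -lecR rmorphD /= -!normc_nrm ler_normD. Qed.
Lemma normcB x y : normc (x - y) <= normc x + normc y.
Proof. by rewrite (le_trans (normcD _ _))// normcN. Qed.
Lemma normc_geB x y : normc x - normc y <= normc (x + y).
Proof.
rewrite lerBlDr -[X in normc X <= _](addrK y) -(normcN y); exact: normcD.
Qed.
Lemma normc_Re x : `|Re x| <= normc x.
Proof. by rewrite normcE -sqrtr_sqr ler_sqrt ?lerDl ?sqr_ge0// addr_ge0 ?sqr_ge0. Qed.
Lemma normc_Im x : `|Im x| <= normc x.
Proof. by rewrite normcE -sqrtr_sqr ler_sqrt ?lerDr ?sqr_ge0// addr_ge0 ?sqr_ge0. Qed.
Lemma normc_le x : normc x <= `|Re x| + `|Im x|.
Proof.
rewrite normcE -(@ger0_norm _ (`|Re x| + `|Im x|)) ?addr_ge0// -sqrtr_sqr.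
rewrite ler_sqrt ?sqr_ge0// sqrrD !real_normK ?num_real//.
by rewrite lerD2r lerDl mulrn_wge0// mulr_ge0.
Qed.
Lemma normc_gt0 x : x != 0 -> 0 < normc x.
Proof.
move=> x0; rewrite lt_neqAle normc_ge0 andbT eq_sym.
by apply: contra x0 => /eqP/ComplexField.Normc.eq0_normc ->.
Qed.
Lemma normc0 : normc (0 : R[i]) = 0. Proof. exact: ComplexField.Normc.normc0. Qed.
Lemma normc1 : normc (1 : R[i]) = 1. Proof. exact: ComplexField.Normc.normc1. Qed.
Lemma normcX x n : normc (x ^+ n) = normc x ^+ n.
Proof. by elim: n => [|n IH]; rewrite ?expr0 ?normc1// !exprS normcM IH. Qed.
Lemma normc_i : normc ('i : R[i]) = 1.
Proof. by rewrite normcE /= expr0n expr1n /= add0r sqrtr1. Qed.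

Lemma sqDsq_neq0 x : x != 0 -> Re x ^+ 2 + Im x ^+ 2 != 0.
Proof.
by rewrite eq_complex /= negb_and paddr_eq0 ?sqr_ge0// !sqrf_eq0 negb_and.
Qed.

Lemma Re_cexp z : Re (cexp z) = expR (Re z) * cos (Im z).
Proof. by rewrite /cexp cReMr. Qed.
Lemma Im_cexp z : Im (cexp z) = expR (Re z) * sin (Im z).
Proof. by rewrite /cexp cImMr. Qed.
Lemma cexpD x y : cexp (x + y) = cexp x * cexp y.
Proof.
by apply: complex_eq; rewrite !(Re_cexp, Im_cexp, reimE) expRD ?cosD ?sinD; ring.
Qed.
Lemma cexp0 : cexp 0 = 1 :> R[i].
Proof.
by apply: complex_eq; rewrite ?(Re_cexp, Im_cexp) /= expR0 ?cos0 ?sin0 ?mulr1 ?mulr0.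
Qed.
Lemma normc_cexp z : normc (cexp z) = expR (Re z).
Proof.
rewrite normcE Re_cexp Im_cexp !exprMn -mulrDr cos2Dsin2 mulr1 sqrtr_sqr.
by rewrite ger0_norm// expR_ge0.
Qed.
Lemma cexp_neq0 z : cexp z != 0.
Proof.
apply/eqP => h; have := expR_gt0 (Re z); rewrite -normc_cexp h normc0.
by rewrite ltxx.
Qed.
Lemma cexpN z : cexp (- z) = (cexp z)^-1.
Proof.
by apply: (mulfI (cexp_neq0 z)); rewrite -cexpD subrr cexp0 divff// cexp_neq0.
Qed.
Lemma cexp_real t : cexp t%:C = (expR t)%:C.
Proof. by apply: complex_eq; rewrite ?Re_cexp ?Im_cexp /= ?cos0 ?sin0 ?mulr1 ?mulr0. Qed.
Lemma cexpMn z n : cexp (z *+ n) = cexp z ^+ n.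
Proof. by elim: n => [|n IH]; rewrite ?cexp0// mulrS cexpD IH exprS. Qed.
Lemma cexp_ipi : cexp ('i * (pi)%:C) = -1 :> R[i].
Proof.
by apply: complex_eq; rewrite ?Re_cexp ?Im_cexp !reimE
  ?(mul0r, mul1r, mulr0, subr0, addr0, add0r) expR0 ?cospi ?sinpi ?mul1r// oppr0.
Qed.

Lemma cpowD t x y : cpow t (x + y) = cpow t x * cpow t y.
Proof. by rewrite /cpow mulrDl cexpD. Qed.
Lemma cpow0 t : cpow t 0 = 1 :> R[i].
Proof. by rewrite /cpow mul0r cexp0. Qed.
Lemma cpowr1 t : 0 < t -> cpow t 1 = t%:C.
Proof.
by move=> t0; rewrite /cpow -[1]/(1%:C) -rmorphM cexp_real mul1r lnK ?posrE.
Qed.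
Lemma cpowN t x : cpow t (- x) = (cpow t x)^-1.
Proof. by rewrite /cpow mulNr cexpN. Qed.
Lemma cpow_real t (c : R) : 0 < t -> cpow t c%:C = (t `^ c)%:C.
Proof. by move=> t0; rewrite /cpow -rmorphM cexp_real /powR gt_eqF. Qed.
Lemma normc_cpow t x : 0 < t -> normc (cpow t x) = t `^ (Re x).
Proof. by move=> t0; rewrite /cpow normc_cexp cReM /= mulr0 subr0 /powR gt_eqF. Qed.
Lemma cpowM (t u : R) x : 0 < t -> 0 < u -> cpow (t * u) x = cpow t x * cpow u x.
Proof. by move=> t0 u0; rewrite /cpow lnM ?posrE// rmorphD mulrDr cexpD. Qed.

End complex_basics.

(** * Limits of complex-valued functions along a filter *)

Section ccvg.
Variables (R : realType) (T : Type) (F : set_system T).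
Context {FF : Filter F}.
Implicit Types (f g : T -> R[i]) (l m : R[i]).

(** Convergence is taken componentwise so that the real limit theorems apply directly; [ccvg_cvg]
    converts it to the topology of the modulus. *)
Definition ccvg f l :=
  (Re (f x) @[x --> F] --> Re l) /\ (Im (f x) @[x --> F] --> Im l).

Lemma ccvg_cst l : ccvg (fun=> l) l.
Proof. by split; apply: cvg_cst. Qed.
Lemma ccvgD f g l m : ccvg f l -> ccvg g m -> ccvg (fun x => f x + g x) (l + m).
Proof.
move=> [f1 f2] [g1 g2]; split; rewrite ?cReD ?cImD.
  under eq_fun do rewrite cReD; exact: cvgD.
under eq_fun do rewrite cImD; exact: cvgD.
Qed.
Lemma ccvgN f l : ccvg f l -> ccvg (fun x => - f x) (- l).
Proof.
move=> [f1 f2]; split; rewrite ?cReN ?cImN.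
  under eq_fun do rewrite cReN; exact: cvgN.
under eq_fun do rewrite cImN; exact: cvgN.
Qed.
Lemma ccvgB f g l m : ccvg f l -> ccvg g m -> ccvg (fun x => f x - g x) (l - m).
Proof. by move=> fl gm; apply: ccvgD => //; apply: ccvgN. Qed.
Lemma ccvgM f g l m : ccvg f l -> ccvg g m -> ccvg (fun x => f x * g x) (l * m).
Proof.
move=> [f1 f2] [g1 g2]; split; rewrite ?cReM ?cImM.
  by under eq_fun do rewrite cReM; apply: cvgB; apply: cvgM.
by under eq_fun do rewrite cImM; apply: cvgD; apply: cvgM.
Qed.
Lemma ccvgV f l : l != 0 -> ccvg f l -> ccvg (fun x => (f x)^-1) l^-1.
Proof.
move=> l0 [f1 f2].
have h : (Re (f x) ^+ 2 + Im (f x) ^+ 2)^-1 @[x --> F] -->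
    (Re l ^+ 2 + Im l ^+ 2)^-1.
  apply: cvgV; first exact: sqDsq_neq0.
  by under eq_fun do rewrite !expr2; rewrite !expr2; apply: cvgD; apply: cvgM.
split; rewrite ?cReV ?cImV.
  by under eq_fun do rewrite cReV; apply: cvgM.
by under eq_fun do rewrite cImV; apply: cvgN; apply: cvgM.
Qed.
Lemma ccvg_real (f : T -> R) (l : R) : f x @[x --> F] --> l ->
  ccvg (fun x => (f x)%:C) l%:C.
Proof. by move=> fl; split => //; apply: cvg_cst. Qed.
Lemma ccvg_cexp f l : ccvg f l -> ccvg (fun x => cexp (f x)) (cexp l).
Proof.
move=> [f1 f2].
have e : expR (Re (f x)) @[x --> F] --> expR (Re l).
  by apply: (cvg_comp _ _ f1); exact: continuous_expR.
split; rewrite ?Re_cexp ?Im_cexp.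
  under eq_fun do rewrite Re_cexp.
  by apply: cvgM => //; apply: (cvg_comp _ _ f2); exact: continuous_cos.
under eq_fun do rewrite Im_cexp.
by apply: cvgM => //; apply: (cvg_comp _ _ f2); exact: continuous_sin.
Qed.
Lemma ccvg_squeeze0 f (h : T -> R) : (\forall x \near F, normc (f x) <= h x) ->
  h x @[x --> F] --> 0 -> ccvg f 0.
Proof.
move=> fh h0; split.
  apply: norm_cvg0; apply: squeeze_cvgr h0; last exact: (cvg_cst (0 : R)).
  near=> x; rewrite normr_ge0 /= (le_trans (normc_Re _))//; near: x; exact: fh.
apply: norm_cvg0; apply: squeeze_cvgr h0; last exact: (cvg_cst (0 : R)).
near=> x; rewrite normr_ge0 /= (le_trans (normc_Im _))//; near: x; exact: fh.
Unshelve. all: by end_near. Qed.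
Lemma ccvg_near_eq f g l : (\forall x \near F, f x = g x) -> ccvg g l -> ccvg f l.
Proof.
move=> fg [g1 g2]; split.
  by apply: cvg_trans g1; apply: near_eq_cvg; apply: filterS fg => x ->.
by apply: cvg_trans g2; apply: near_eq_cvg; apply: filterS fg => x ->.
Qed.
Lemma ccvg_cvg f l : ccvg f l ->
  (f x : R[i]^o) @[x --> F] --> (l : R[i]^o).
Proof.
move=> [f1 f2]; apply/cvgrPdist_lt => /= -[e1 e2].
rewrite ltcE /= => /andP[/eqP -> e0].
have e20 : 0 < e1 / 2 by rewrite divr_gt0.
near=> x; rewrite [X in X < _]normc_nrm ltcR (le_lt_trans (normc_le _))//.
rewrite !reimE (splitr e1) ltrD//.
  by near: x; move/cvgrPdist_lt : f1; apply.
by near: x; move/cvgrPdist_lt : f2; apply.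
Unshelve. all: by end_near. Qed.
End ccvg.

Lemma ccvg_unique (R : realType) (T : Type) (F : set_system T) {FF : ProperFilter F}
  (f : T -> R[i]) l m : ccvg F f l -> ccvg F f m -> l = m.
Proof.
move=> [f1 f2] [g1 g2]; apply: complex_eq.
  by rewrite -(cvg_lim _ f1)// -(cvg_lim _ g1).
by rewrite -(cvg_lim _ f2)// -(cvg_lim _ g2).
Qed.

(** * Derivatives of complex-valued functions of a real variable *)

Section isd.
Variable R : realType.
Implicit Types (f g : R -> R[i]) (x : R) (d e : R[i]).

Definition isd f x d :=
  is_derive x 1 (fun t => Re (f t)) (Re d) /\ is_derive x 1 (fun t => Im (f t)) (Im d).

Lemma isd_cst c x : isd (fun=> c) x 0.
Proof. by split; apply: is_derive_cst. Qed.
Lemma isd_eq f x d e : isd f x d -> d = e -> isd f x e.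
Proof. by move=> h <-. Qed.
Lemma isdD f g x d e : isd f x d -> isd g x e -> isd (fun t => f t + g t) x (d + e).
Proof.
move=> [f1 f2] [g1 g2]; split.
  under eq_fun do rewrite cReD; rewrite cReD; exact: is_deriveD.
under eq_fun do rewrite cImD; rewrite cImD; exact: is_deriveD.
Qed.
Lemma isdM f g x d e : isd f x d -> isd g x e ->
  isd (fun t => f t * g t) x (d * g x + f x * e).
Proof.
move=> [f1 f2] [g1 g2]; split.
  under eq_fun do rewrite cReM.
  apply: (is_derive_eq (is_deriveB (is_deriveM f1 g1) (is_deriveM f2 g2))).
  by rewrite !reimE /GRing.scale /=; ring.
under eq_fun do rewrite cImM.
apply: (is_derive_eq (is_deriveD (is_deriveM f1 g2) (is_deriveM f2 g1))).
by rewrite !reimE /GRing.scale /=; ring.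
Qed.
Lemma isdMl c f x d : isd f x d -> isd (fun t => c * f t) x (c * d).
Proof.
by move=> h; apply: (isd_eq (isdM (isd_cst c x) h)); rewrite mul0r add0r.
Qed.
Lemma isdN f x d : isd f x d -> isd (fun t => - f t) x (- d).
Proof.
by move=> h; under [fun t => _]eq_fun do rewrite -mulN1r; rewrite -(mulN1r d); apply: isdMl.
Qed.
Lemma isd_real (h : R -> R) x (d : R) : is_derive x 1 h d ->
  isd (fun t => (h t)%:C) x d%:C.
Proof. by move=> hd; split => //; apply: is_derive_cst. Qed.
Lemma isdV f x d : f x != 0 -> isd f x d ->
  isd (fun t => (f t)^-1) x (- d / f x ^+ 2).
Proof.
move=> f0 [f1 f2].
have n0 := sqDsq_neq0 f0.
have h : is_derive x 1 (fun t => Re (f t) * Re (f t) + Im (f t) * Im (f t)) _ :=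
  is_deriveD (is_deriveM f1 f1) (is_deriveM f2 f2).
have n0' : Re (f x) * Re (f x) + Im (f x) * Im (f x) != 0 by rewrite -!expr2.
have hV : is_derive x 1 (fun t => (Re (f t) ^+ 2 + Im (f t) ^+ 2)^-1)
   (- (Re (f x) ^+ 2 + Im (f x) ^+ 2) ^- 2 * (2 * Re (f x) * Re d + 2 * Im (f x) * Im d)).
  under eq_fun do rewrite !expr2.
  have hV := @is_deriveV _ (fun t => Re (f t) * Re (f t) + Im (f t) * Im (f t)) x _ 1 n0' h.
  apply: (is_derive_eq hV).
  by rewrite /GRing.scale /= -!expr2; ring.
split.
  under eq_fun do rewrite cReV.
  apply: (is_derive_eq (is_deriveM f1 hV)).
  rewrite [f x ^+ 2]expr2 [(f x * f x)^-1]invfM !(reimE, cReV, cImV) /GRing.scale /=.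
  by move: (Re (f x)) (Im (f x)) (Re d) (Im d) n0 => p q r s n0; field.
under eq_fun do rewrite cImV.
apply: (is_derive_eq (is_deriveN (is_deriveM f2 hV))).
rewrite [f x ^+ 2]expr2 [(f x * f x)^-1]invfM !(reimE, cReV, cImV) /GRing.scale /=.
by move: (Re (f x)) (Im (f x)) (Re d) (Im d) n0 => p q r s n0; field.
Qed.
Lemma isd_cexp f x d : isd f x d -> isd (fun t => cexp (f t)) x (d * cexp (f x)).
Proof.
move=> [f1 f2].
have e1 := is_derive1_comp (@is_derive_expR _ (Re (f x))) f1.
have e2 := is_derive1_comp (@is_derive_cos _ (Im (f x))) f2.
have e3 := is_derive1_comp (@is_derive_sin _ (Im (f x))) f2.
split.
  under eq_fun do rewrite Re_cexp.
  apply: (is_derive_eq (is_deriveM e1 e2)).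
  by rewrite !(reimE, Re_cexp, Im_cexp) /GRing.scale /=; ring.
under eq_fun do rewrite Im_cexp.
apply: (is_derive_eq (is_deriveM e1 e3)).
by rewrite !(reimE, Re_cexp, Im_cexp) /GRing.scale /=; ring.
Qed.
Lemma isd_ccvg f x d : isd f x d -> ccvg (nbhs x) f (f x).
Proof.
move=> [f1 f2]; split.
  by apply: differentiable_continuous; apply/derivable1_diffP; case: f1.
by apply: differentiable_continuous; apply/derivable1_diffP; case: f2.
Qed.
End isd.

(** * Complex-valued integrals *)

Section general_measure.
Context d (T : measurableType d) (R : realType) (mu : {measure set T -> \bar R}).
Implicit Types (D : set T) (f g : T -> R).

Lemma integrable_domin D f g : measurable D -> measurable_fun D f ->
  mu.-integrable D (EFin \o g) -> (forall x, D x -> `|f x| <= g x) ->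
  mu.-integrable D (EFin \o f).
Proof.
move=> mD mf ig fg; apply: (@le_integrable _ _ _ mu D mD _ (EFin \o g)) => //.
  exact/measurable_EFinP.
by move=> x Dx /=; rewrite lee_fin (le_trans (fg _ Dx))// ler_norm.
Qed.

Lemma Rintegral_dominated_cvg D (f_ : nat -> T -> R) f g : measurable D ->
  (forall n, measurable_fun D (f_ n)) ->
  (forall x, D x -> f_ n x @[n --> \oo] --> f x) ->
  mu.-integrable D (EFin \o g) ->
  (forall n x, D x -> `|f_ n x| <= g x) ->
  \int[mu]_(x in D) f_ n x @[n --> \oo] --> \int[mu]_(x in D) f x.
Proof.
move=> mD mf_ f_f ig fg.
have mf_' n : measurable_fun D (EFin \o f_ n) by exact/measurable_EFinP.
have f_f' x : D x -> (EFin \o f_ n) x @[n --> \oo] --> (EFin \o f) x.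
  by move=> Dx; apply: cvg_EFin; [exact: nearW|exact: f_f].
have mf := emeasurable_fun_cvg _ _ mf_' f_f'.
have fg' n x : D x -> (`|(EFin \o f_ n) x| <= (EFin \o g) x)%E.
  by move=> Dx; rewrite /= lee_fin fg.
have [i _ h] := dominated_convergence mD mf_' mf (aeW _ f_f') ig
  (aeW _ (fun x n => fg' n x)).
by apply: fine_cvg; rewrite fineK//; exact: integrable_fin_num.
Qed.

End general_measure.

Section real_integrals.
Variable R : realType.
Notation mu := (@lebesgue_measure R).
Implicit Types (D : set R) (f g F : R -> R).

Lemma integrable_continuous_itv f (a b : R) :
  (forall x, a <= x <= b -> {for x, continuous f}) ->
  mu.-integrable `[a, b] (EFin \o f).
Proof.
move=> cf; apply: continuous_compact_integrable; first exact: segment_compact.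
apply: continuous_in_subspaceT => x; rewrite inE /= in_itv /=; exact: cf.
Qed.

Lemma Rintegral_FTC f F (a b : R) : a <= b ->
  (forall x, a <= x <= b -> is_derive x 1 F (f x)) ->
  (forall x, a <= x <= b -> {for x, continuous f}) ->
  \int[mu]_(x in `[a, b]) f x = F b - F a.
Proof.
rewrite le_eqVlt => /predU1P[<- _ _|ab dF cf].
  by rewrite subrr set_itv1 Rintegral_set1.
have cF x : a <= x <= b -> {for x, continuous F}.
  by move=> xab; apply: differentiable_continuous; apply/derivable1_diffP;
    case: (dF x xab).
rewrite /Rintegral (@continuous_FTC2 _ f F)//.
- apply: continuous_in_subspaceT => x; rewrite inE /= in_itv /=; exact: cf.
- split.
  + move=> x; rewrite in_itv /= => /andP[/ltW ax /ltW xb].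
    by have [] := dF x; rewrite ?ax ?xb.
  + by apply: cvg_at_right_filter; apply: cF; rewrite lexx ltW.
  + by apply: cvg_at_left_filter; apply: cF; rewrite lexx ltW.
- move=> x; rewrite in_itv /= => /andP[/ltW ax /ltW xb].
  by rewrite derive1E; have [|_ ->//] := dF x; rewrite ?ax ?xb.
Qed.

Lemma measurable_fun_continuous_ray f (a : R) :
  (forall x, a < x -> {for x, continuous f}) -> measurable_fun `]a, +oo[ f.
Proof.
move=> cf; apply: open_continuous_measurable_fun; first exact: interval_open.
move=> x; rewrite inE /= in_itv /= andbT; exact: cf.
Qed.

Lemma Rintegral_itvcc_cst (a b M : R) : a <= b -> \int[mu]_(x in `[a, b]) M = M * (b - a).
Proof.
move=> ab; rewrite Rintegral_cst//= lebesgue_measure_itv /= lte_fin.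
by move: ab; rewrite le_eqVlt => /predU1P[->|->//]; rewrite ltxx subrr.
Qed.

(** Dominated convergence with majorant [|f|]: each point of the ray eventually belongs to
    [[a n, b n]]. *)
Lemma cvg_Rintegral_exhaust f (r : R) (a b : nat -> R) :
  mu.-integrable `]r, +oo[ (EFin \o f) ->
  (forall n, r < a n) -> a n @[n --> \oo] --> r -> b n @[n --> \oo] --> +oo ->
  \int[mu]_(x in `[a n, b n]) f x @[n --> \oo] --> \int[mu]_(x in `]r, +oo[) f x.
Proof.
move=> fi ra ar bo.
rewrite (_ : (fun n => _) = fun n =>
    \int[mu]_(x in `]r, +oo[) (f \_ `[a n, b n]) x); last first.
  apply/funext => n; rewrite -Rintegral_mkcondr; congr Rintegral.
  rewrite setIC; apply/esym/setIidl => x /=; rewrite !in_itv /= andbT => /andP[ax _].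
  exact: lt_le_trans ax.
apply: (@Rintegral_dominated_cvg _ _ _ mu _ _ _ (fun x => `|f x|)) => //.
- move=> n; apply/(measurable_restrict _ _ _) => //.
  have /measurable_int/measurable_EFinP mf := fi.
  by apply: measurable_funS mf => // x [].
- move=> x /=; rewrite in_itv /= andbT => rx.
  apply: cvg_near_cst.
  near=> n; rewrite patchE mem_set//= in_itv /=; apply/andP; split.
    apply/ltW; near: n; exact: (cvgr_lt r).
  by near: n; move/cvgryPge : bo; apply.
- exact: integrable_norm fi.
- move=> n x _; rewrite patchE; case: ifP => // _; rewrite normr0//.
Unshelve. all: by end_near. Qed.

End real_integrals.

Section complex_integrals.
Context d (T : measurableType d) (R : realType) (mu : {measure set T -> \bar R}).
Implicit Types (D : set T) (f g : T -> R[i]).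

Definition measurableC D f :=
  measurable_fun D (fun x => Re (f x)) /\ measurable_fun D (fun x => Im (f x)).

Definition integrableC D f :=
  mu.-integrable D (EFin \o (fun x => Re (f x))) /\
  mu.-integrable D (EFin \o (fun x => Im (f x))).

Definition intC D f : R[i] :=
  Complex (\int[mu]_(x in D) Re (f x)) (\int[mu]_(x in D) Im (f x)).

Lemma measurableC_integrableC D f : measurable D -> integrableC D f -> measurableC D f.
Proof. by move=> mD [] /measurable_int/measurable_EFinP m1 /measurable_int/measurable_EFinP m2. Qed.

Lemma integrableC_domin D f (g : T -> R) : measurable D -> measurableC D f ->
  mu.-integrable D (EFin \o g) -> (forall x, D x -> normc (f x) <= g x) ->
  integrableC D f.
Proof.
move=> mD [m1 m2] ig fg; split; apply: (@integrable_domin _ _ _ mu _ _ g) => // x Dx.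
  by rewrite (le_trans (normc_Re _))// fg.
by rewrite (le_trans (normc_Im _))// fg.
Qed.

Lemma integrableCD D f g : measurable D -> integrableC D f -> integrableC D g ->
  integrableC D (fun x => f x + g x).
Proof.
move=> mD [f1 f2] [g1 g2]; split.
  under [X in EFin \o X]eq_fun do rewrite cReD; exact: (integrableD mD f1 g1).
under [X in EFin \o X]eq_fun do rewrite cImD; exact: (integrableD mD f2 g2).
Qed.

Lemma intCD D f g : measurable D -> integrableC D f -> integrableC D g ->
  intC D (fun x => f x + g x) = intC D f + intC D g.
Proof.
move=> mD [f1 f2] [g1 g2]; apply: complex_eq; rewrite ?cReD ?cImD /=.
  by under eq_Rintegral do rewrite cReD; rewrite RintegralD.
by under eq_Rintegral do rewrite cImD; rewrite RintegralD.
Qed.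

Lemma integrableCMl D (c : R[i]) f : measurable D -> integrableC D f ->
  integrableC D (fun x => c * f x).
Proof.
move=> mD [f1 f2]; split.
  under [X in EFin \o X]eq_fun do rewrite cReM.
  exact: (integrableB mD (integrableZl mD (Re c) f1) (integrableZl mD (Im c) f2)).
under [X in EFin \o X]eq_fun do rewrite cImM.
exact: (integrableD mD (integrableZl mD (Re c) f2) (integrableZl mD (Im c) f1)).
Qed.

Lemma intCMl D (c : R[i]) f : measurable D -> integrableC D f ->
  intC D (fun x => c * f x) = c * intC D f.
Proof.
move=> mD [f1 f2]; apply: complex_eq; rewrite ?cReM ?cImM /=.
  under eq_Rintegral do rewrite cReM.
  have i1 := integrableZl mD (Re c) f1; have i2 := integrableZl mD (Im c) f2.
  by rewrite RintegralB// !RintegralZl.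
under eq_Rintegral do rewrite cImM.
have i1 := integrableZl mD (Re c) f2; have i2 := integrableZl mD (Im c) f1.
by rewrite RintegralD// !RintegralZl.
Qed.

Lemma integrableCB D f g : measurable D -> integrableC D f -> integrableC D g ->
  integrableC D (fun x => f x - g x).
Proof.
move=> mD fi gi; under [X in integrableC D X]eq_fun do rewrite -(mulN1r (g _)).
exact: (integrableCD mD fi (integrableCMl (-1) mD gi)).
Qed.

Lemma intCB D f g : measurable D -> integrableC D f -> integrableC D g ->
  intC D (fun x => f x - g x) = intC D f - intC D g.
Proof.
move=> mD fi gi; under [X in intC D X]eq_fun do rewrite -(mulN1r (g _)).
by rewrite (intCD mD fi (integrableCMl (-1) mD gi)) intCMl// mulN1r.
Qed.

Lemma eq_intC D f g : (forall x, D x -> f x = g x) -> intC D f = intC D g.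
Proof.
by move=> fg; congr Complex; apply: eq_Rintegral => x; rewrite inE => Dx; rewrite fg.
Qed.

Lemma eq_integrableC D f g : measurable D -> (forall x, D x -> f x = g x) ->
  integrableC D f -> integrableC D g.
Proof.
move=> mD fg [f1 f2].
by split; [move: f1|move: f2]; apply: eq_integrable => // x; rewrite inE /= => Dx; rewrite fg.
Qed.

Lemma integrableCS D E f : measurable E -> measurable D -> D `<=` E ->
  integrableC E f -> integrableC D f.
Proof. by move=> mE mD DE [f1 f2]; split; apply: integrableS DE _. Qed.

(** The factor [2] comes from bounding the real and imaginary parts separately. The bound only
    serves to show that integrals tend to [0]. *)
Lemma normc_intC D f (g : T -> R) : measurable D -> integrableC D f ->
  mu.-integrable D (EFin \o g) -> (forall x, D x -> normc (f x) <= g x) ->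
  normc (intC D f) <= 2 * \int[mu]_(x in D) g x.
Proof.
move=> mD [f1 f2] gi fg; apply: le_trans (normc_le _) _ => /=.
have -> : 2 * \int[mu]_(x in D) g x = \int[mu]_(x in D) g x + \int[mu]_(x in D) g x.
  by rewrite mulrDl !mul1r.
apply: lerD; (apply: le_trans (le_normr_Rintegral mD _) _ => //;
  apply: le_Rintegral => //; first exact: integrable_norm).
  by move=> x Dx; rewrite (le_trans (normc_Re _))// fg.
by move=> x Dx; rewrite (le_trans (normc_Im _))// fg.
Qed.

Lemma ccvg_intC D (f_ : nat -> T -> R[i]) f (g : T -> R) : measurable D ->
  (forall n, measurableC D (f_ n)) ->
  (forall x, D x -> ccvg \oo (fun n => f_ n x) (f x)) ->
  mu.-integrable D (EFin \o g) ->
  (forall n x, D x -> normc (f_ n x) <= g x) ->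
  ccvg \oo (fun n => intC D (f_ n)) (intC D f).
Proof.
move=> mD mf ff ig fg; split.
  apply: (Rintegral_dominated_cvg mD _ _ ig) => /=.
  - by move=> n; case: (mf n).
  - by move=> x /ff[].
  - by move=> n x Dx; rewrite (le_trans (normc_Re _))// fg.
apply: (Rintegral_dominated_cvg mD _ _ ig) => /=.
- by move=> n; case: (mf n).
- by move=> x /ff[].
- by move=> n x Dx; rewrite (le_trans (normc_Im _))// fg.
Qed.

End complex_integrals.

Section complex_lebesgue.
Variable R : realType.
Notation mu := (@lebesgue_measure R).
Notation integrableC := (integrableC mu).
Notation intC := (intC mu).
Implicit Types (D : set R) (f g F : R -> R[i]).

Definition continuousC f x := ccvg (nbhs x) f (f x).

Lemma measurableC_ray f (a : R) : (forall x, a < x -> continuousC f x) ->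
  measurableC `]a, +oo[ f.
Proof. by move=> cf; split; apply: measurable_fun_continuous_ray => x /cf[]. Qed.

Lemma integrableC_itv f (a b : R) : (forall x, a <= x <= b -> continuousC f x) ->
  integrableC `[a, b] f.
Proof. by move=> cf; split; apply: integrable_continuous_itv => x /cf[]. Qed.

Lemma normc_intC_itv f (a b M : R) : a <= b ->
  (forall x, a <= x <= b -> continuousC f x) ->
  (forall x, a <= x <= b -> normc (f x) <= M) ->
  normc (intC `[a, b] f) <= 2 * (M * (b - a)).
Proof.
move=> ab cf fM; rewrite -Rintegral_itvcc_cst//; apply: normc_intC => //.
- exact: integrableC_itv.
- by apply: integrable_continuous_itv => x _; exact: cst_continuous.
Qed.

Lemma intC_FTC f F (a b : R) : a <= b ->
  (forall x, a <= x <= b -> isd F x (f x)) ->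
  (forall x, a <= x <= b -> continuousC f x) ->
  intC `[a, b] f = F b - F a.
Proof.
move=> ab dF cf; apply: complex_eq; rewrite ?reimE /=.
  by apply: (@Rintegral_FTC _ _ (fun x => Re (F x))) => // x xab;
    [case: (dF x xab)|case: (cf x xab)].
by apply: (@Rintegral_FTC _ _ (fun x => Im (F x))) => // x xab;
  [case: (dF x xab)|case: (cf x xab)].
Qed.

Lemma ccvg_intC_exhaust f (r : R) (a b : nat -> R) :
  integrableC `]r, +oo[ f ->
  (forall n, r < a n) -> a n @[n --> \oo] --> r -> b n @[n --> \oo] --> +oo ->
  ccvg \oo (fun n => intC `[a n, b n] f) (intC `]r, +oo[ f).
Proof. by move=> [f1 f2] ra ar bo; split; apply: cvg_Rintegral_exhaust. Qed.

Lemma intC_setU_ray f (r s : R) : r <= s ->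
  integrableC `]r, +oo[ f -> (forall x, r <= x <= s -> continuousC f x) ->
  intC `]r, +oo[ f = intC `[r, s] f + intC `]s, +oo[ f.
Proof.
move=> rs [f1 f2] cf.
have h (h : R -> R) : mu.-integrable `]r, +oo[ (EFin \o h) ->
   (forall x, r <= x <= s -> {for x, continuous h}) ->
   \int[mu]_(x in `]r, +oo[) h x =
   \int[mu]_(x in `[r, s]) h x + \int[mu]_(x in `]s, +oo[) h x.
  move=> ih ch.
  rewrite -(@Rintegral_itvB _ h (BRight r) +oo%O s) ?bnd_simp//.
  rewrite -(@Rintegral_itv_obnd_cbnd _ r (BRight s)).
    by rewrite addrC subrK.
  apply: integrableS ih => //.
  by apply: subset_itvl.
apply: complex_eq; rewrite ?reimE /=; apply: h => // x /cf[]//.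
Qed.

(** The end values of [F] are limits along sequences, because the primitives used involve powers
    that may be singular at the left end. *)
Lemma intC_FTC_ray f F (r : R) (l0 loo : R[i]) (a b : nat -> R) :
  integrableC `]r, +oo[ f ->
  (forall x, r < x -> isd F x (f x)) ->
  (forall x, r < x -> continuousC f x) ->
  (forall n, r < a n) -> a n @[n --> \oo] --> r -> b n @[n --> \oo] --> +oo ->
  ccvg \oo (fun n => F (a n)) l0 -> ccvg \oo (fun n => F (b n)) loo ->
  intC `]r, +oo[ f = loo - l0.
Proof.
move=> fi dF cf ra ar bo Fl0 Floo.
apply: (ccvg_unique (ccvg_intC_exhaust fi ra ar bo)).
apply: ccvg_near_eq (ccvgB Floo Fl0).
near=> n.
have anbn : a n <= b n.
  apply: (@le_trans _ _ (r + 1)); last by near: n; move/cvgryPge : bo; apply.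
  by near: n; apply: (cvgr_le r); rewrite ?ltrDl.
apply: intC_FTC => // x /andP[/(lt_le_trans (ra n)) rx _]; [exact: dF|exact: cf].
Unshelve. all: by end_near. Qed.

End complex_lebesgue.

(** * Cauchy's theorem in polar coordinates *)

Section green.
Variable R : realType.
Notation mu := (@lebesgue_measure R).

Lemma bounded_on_rectangle (D : R -> R -> R) (u0 u1 t0 t1 : R) :
  (forall u t, u0 <= u <= u1 -> t0 <= t <= t1 ->
    {for (u, t), continuous (fun p => D p.1 p.2)}) ->
  exists K, forall u t, u0 <= u <= u1 -> t0 <= t <= t1 -> `|D u t| <= K.
Proof.
move=> cD; pose S := `[u0, u1]%classic `*` `[t0, t1]%classic.
have cS : compact S by apply: compact_setX; exact: segment_compact.
have cDS : {within S, continuous (fun p : R * R => D p.1 p.2)}.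
  apply: continuous_in_subspaceT => -[u t]; rewrite inE => -[/=].
  rewrite !in_itv /=; exact: cD.
have [K [_ hK]] := compact_bounded (continuous_compact cDS cS).
exists (K + 1) => u t uu tt; apply: hK; first by rewrite ltrDl.
by exists (u, t) => //; split; rewrite /= in_itv.
Qed.

Lemma is_derive_Rintegral_itv (A D : R -> R -> R) (u0 u1 m M t : R) : m < t < M ->
  (forall u s, u0 <= u <= u1 -> m < s < M -> is_derive s 1 (A u) (D u s)) ->
  (forall u s, u0 <= u <= u1 -> m < s < M -> {for u, continuous (A ^~ s)}) ->
  (forall u s, u0 <= u <= u1 -> m < s < M ->
    {for (u, s), continuous (fun p => D p.1 p.2)}) ->
  is_derive t 1 (fun s => \int[mu]_(u in `[u0, u1]) A u s)
    (\int[mu]_(u in `[u0, u1]) D u t).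
Proof.
move=> /andP[mt tM] dA cA cD.
(* The midpoints give a compact interval [[m', M']] around [t] inside [(m, M)], over which the bound
   is taken. *)
pose m' := (m + t) / 2; pose M' := (t + M) / 2.
have [mm' m't] : m < m' /\ m' < t by rewrite /m'; split; lra.
have [tM' M'M] : t < M' /\ M' < M by rewrite /M'; split; lra.
have sub s : m' <= s <= M' -> m < s < M.
  by move=> /andP[a b]; apply/andP; split; lra.
have [K hK] := @bounded_on_rectangle D u0 u1 m' M'
  (fun u s uu ss => cD u s uu (sub s ss)).
have d1 s u : u0 <= u <= u1 -> m' <= s <= M' -> partial1of2 (fun s u => A u s) s u = D u s.
  move=> uu ss; rewrite /partial1of2 derive1E.
  by have [_ ->] := dA u s uu (sub s ss).
have intf s : `]m', M'[%classic s -> mu.-integrable `[u0, u1] (EFin \o (A ^~ s)).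
  rewrite /= in_itv /= => /andP[/ltW a /ltW b].
  by apply: integrable_continuous_itv => u uu; apply: cA => //; apply: sub; rewrite a.
have der s u : `]m', M'[%classic s -> `[u0, u1]%classic u -> derivable (fun s => A u s) s 1.
  rewrite /= !in_itv /= => /andP[/ltW a /ltW b] uu.
  by have [] // := dA u s uu (sub s _); rewrite a.
have intG : mu.-integrable `[u0, u1] (EFin \o (fun=> `|K|)).
  by apply: integrable_continuous_itv => u _; exact: cst_continuous.
have ub s u : `]m', M'[%classic s -> `[u0, u1]%classic u ->
    `|partial1of2 (fun s u => A u s) s u| <= `|K|.
  rewrite /= !in_itv /= => /andP[/ltW a /ltW b] uu.
  rewrite d1 ?a//; apply: le_trans (ler_norm K); apply: hK => //.
  by rewrite a.
have It : `]m', M'[%classic t by rewrite /= in_itv /= m't.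
split.
  exact: (@derivable_under_integral R _ _ mu (fun s u => A u s) `[u0, u1] _ t m' M' It
    intf der (fun=> `|K|) (fun=> normr_ge0 K) intG ub).
rewrite -derive1E.
rewrite (@differentiation_under_integral R _ _ mu (fun s u => A u s) `[u0, u1] _ t m' M' It
    intf der (fun=> `|K|) (fun=> normr_ge0 K) intG ub)//.
apply: eq_Rintegral => u; rewrite inE /= in_itv /= => uu.
by rewrite -d1// ?ltW.
Qed.

(** The function [s |-> int A(u, s) du] has derivative [b]; integrating [b] back over [[t0, t1]]
    gives Green's formula without a double integral. *)
Lemma green_rectangle (A D : R -> R -> R) (b : R -> R) (u0 u1 m M t0 t1 : R) :
  t0 <= t1 -> m < t0 -> t1 < M ->
  (forall u s, u0 <= u <= u1 -> m < s < M -> is_derive s 1 (A u) (D u s)) ->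
  (forall u s, u0 <= u <= u1 -> m < s < M -> {for u, continuous (A ^~ s)}) ->
  (forall u s, u0 <= u <= u1 -> m < s < M ->
    {for (u, s), continuous (fun p => D p.1 p.2)}) ->
  (forall s, m < s < M -> \int[mu]_(u in `[u0, u1]) D u s = b s) ->
  (forall s, m < s < M -> {for s, continuous b}) ->
  \int[mu]_(u in `[u0, u1]) A u t1 - \int[mu]_(u in `[u0, u1]) A u t0 =
  \int[mu]_(s in `[t0, t1]) b s.
Proof.
move=> t01 mt0 t1M dA cA cD Db cb.
have sub s : t0 <= s <= t1 -> m < s < M.
  by move=> /andP[a c]; apply/andP; split; lra.
apply/esym/(@Rintegral_FTC _ b (fun s => \int[mu]_(u in `[u0, u1]) A u s)) => // s /sub sM.
  by rewrite -Db//; exact: (is_derive_Rintegral_itv sM dA cA cD).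
exact: cb.
Qed.

End green.

(** * Holomorphic functions on a sector of the logarithm surface *)

Section polar_holomorphic.
Variable R : realType.
Variables m M : R.
Implicit Types (F Fd G Gd : R -> R -> R[i]).

(* [F u t] is the value of a holomorphic function at [s = u e^(i t)] on the
   sector [m < t < M], and [Fd] its radial derivative; the equation on the
   angular derivative is the Cauchy-Riemann equation in polar coordinates. *)
Definition polar_holo F Fd := forall u t, 0 < u -> m < t < M ->
  [/\ isd (F ^~ t) u (Fd u t), isd (F u) t ('i * u%:C * Fd u t),
      ccvg (nbhs (u, t)) (fun p => F p.1 p.2) (F u t) &
      ccvg (nbhs (u, t)) (fun p => Fd p.1 p.2) (Fd u t)].

Lemma polar_holo_cst (c : R[i]) : polar_holo (fun _ _ => c) (fun _ _ => 0).
Proof.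
move=> u t u0 tmM; split; rewrite ?mulr0; try exact: isd_cst; exact: ccvg_cst.
Qed.

(** This is [log s = ln u + i t]. Every power of [s] is the exponential of a multiple of it, so
    multivaluedness never arises. *)
Lemma polar_holo_log :
  polar_holo (fun u t => (ln u)%:C + 'i * t%:C) (fun u t => (u^-1)%:C).
Proof.
move=> u t u0 tmM; split.
- rewrite -[(u^-1)%:C]addr0; apply: isdD; last exact: isd_cst.
  by apply: isd_real; exact: is_derive1_ln.
- rewrite -mulrA -rmorphM divff ?gt_eqF// mulr1 -[X in isd _ _ X]add0r.
  apply: isdD; first exact: isd_cst.
  rewrite -[X in isd _ _ X]mulr1; apply: isdMl.
  by apply: isd_real; exact: is_derive_id.
- apply: ccvgD.
    apply: ccvg_real; apply: (@cvg_comp _ _ _ fst (@ln R) _ (nbhs u)).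
      exact: cvg_fst.
    exact: continuous_ln.
  apply: ccvgM; first exact: ccvg_cst.
  by apply: ccvg_real; exact: cvg_snd.
- by apply: ccvg_real; apply: cvgV; [rewrite gt_eqF|exact: cvg_fst].
Qed.

Lemma polar_holoD F Fd G Gd : polar_holo F Fd -> polar_holo G Gd ->
  polar_holo (fun u t => F u t + G u t) (fun u t => Fd u t + Gd u t).
Proof.
move=> hF hG u t u0 tmM.
have [f1 f2 f3 f4] := hF u t u0 tmM; have [g1 g2 g3 g4] := hG u t u0 tmM.
split; [exact: isdD|rewrite mulrDr; exact: isdD|exact: ccvgD|exact: ccvgD].
Qed.

Lemma polar_holoM F Fd G Gd : polar_holo F Fd -> polar_holo G Gd ->
  polar_holo (fun u t => F u t * G u t) (fun u t => Fd u t * G u t + F u t * Gd u t).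
Proof.
move=> hF hG u t u0 tmM.
have [f1 f2 f3 f4] := hF u t u0 tmM; have [g1 g2 g3 g4] := hG u t u0 tmM.
split; [exact: isdM| |exact: ccvgM|by apply: ccvgD; apply: ccvgM].
by apply: (isd_eq (isdM f2 g2)); ring.
Qed.

Lemma polar_holo_cexp F Fd : polar_holo F Fd ->
  polar_holo (fun u t => cexp (F u t)) (fun u t => Fd u t * cexp (F u t)).
Proof.
move=> hF u t u0 tmM; have [f1 f2 f3 f4] := hF u t u0 tmM.
split; [exact: isd_cexp| |exact: ccvg_cexp|].
  by rewrite mulrA; exact: isd_cexp.
by apply: ccvgM => //; exact: ccvg_cexp.
Qed.

Lemma polar_holoV F Fd : (forall u t, 0 < u -> m < t < M -> F u t != 0) ->
  polar_holo F Fd ->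
  polar_holo (fun u t => (F u t)^-1) (fun u t => - Fd u t / F u t ^+ 2).
Proof.
move=> F0 hF u t u0 tmM; have [f1 f2 f3 f4] := hF u t u0 tmM.
have Fut0 := F0 u t u0 tmM.
split; [exact: isdV| |exact: ccvgV|].
  by apply: (isd_eq (isdV Fut0 f2)); field.
apply: ccvgM; first exact: ccvgN.
apply: ccvgV; first by rewrite expf_eq0.
by under eq_fun do rewrite expr2; rewrite expr2; exact: ccvgM.
Qed.

Lemma ccvg_pair_l F u t : ccvg (nbhs (u, t)) (fun p => F p.1 p.2) (F u t) ->
  continuousC (F ^~ t) u.
Proof.
have h : (fun x : R => (x, t)) x @[x --> u] --> (u, t).
  by apply: (@cvg_pair _ _ _ _ (nbhs u) (nbhs t)); [exact: cvg_id|exact: cvg_cst].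
by move=> [f1 f2]; split; [exact: (cvg_comp _ _ h f1)|exact: (cvg_comp _ _ h f2)].
Qed.

Lemma ccvg_pair_r F u t : ccvg (nbhs (u, t)) (fun p => F p.1 p.2) (F u t) ->
  continuousC (F u) t.
Proof.
have h : (fun x : R => (u, x)) x @[x --> t] --> (u, t).
  by apply: (@cvg_pair _ _ _ _ (nbhs u) (nbhs t)); [exact: cvg_cst|exact: cvg_id].
by move=> [f1 f2]; split; [exact: (cvg_comp _ _ h f1)|exact: (cvg_comp _ _ h f2)].
Qed.

Lemma polar_holo_cont_l F Fd u t : polar_holo F Fd -> 0 < u -> m < t < M ->
  continuousC (F ^~ t) u.
Proof. by move=> hF u0 tmM; have [_ _ /ccvg_pair_l] := hF u t u0 tmM. Qed.

Lemma polar_holo_cont_r F Fd u t : polar_holo F Fd -> 0 < u -> m < t < M ->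
  continuousC (F u) t.
Proof. by move=> hF u0 tmM; have [_ _ /ccvg_pair_r] := hF u t u0 tmM. Qed.

End polar_holomorphic.

Section polar_cauchy.
Variable R : realType.
Notation mu := (@lebesgue_measure R).
Notation intC := (intC mu).

(* Cauchy's theorem for [F(s) ds / s], [s = u e^(i t)], on a polar rectangle. *)
Lemma polar_cauchy (m M : R) (F Fd : R -> R -> R[i]) (u0 u1 t0 t1 : R) :
  polar_holo m M F Fd -> 0 < u0 -> u0 <= u1 -> m < t0 -> t0 <= t1 -> t1 < M ->
  intC `[u0, u1] (fun u => (u^-1)%:C * (F u t1 - F u t0)) =
  'i * intC `[t0, t1] (fun t => F u1 t - F u0 t).
Proof.
move=> hF u00 u01 mt0 t01 t1M.
have up u : u0 <= u <= u1 -> 0 < u by move=> /andP[a _]; apply: lt_le_trans a.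
have inv0 u : u0 <= u <= u1 -> continuousC (fun u => (u^-1)%:C) u.
  move=> /up u0'; apply: ccvg_real; apply: cvgV; rewrite ?gt_eqF//.
(* By Cauchy-Riemann the angular derivative of [F / u] is [i] times the radial derivative of [F],
   whose integral in [u] is the increment [b] of [i F] between the two radii. *)
have dF u s : u0 <= u <= u1 -> m < s < M -> isd (fun t => (u^-1)%:C * F u t) s ('i * Fd u s).
  move=> /up u0' sM; have [_ h _ _] := hF u s u0' sM.
  apply: (isd_eq (isdMl (u^-1)%:C h)).
  by rewrite -!mulrA [X in X = _]mulrCA; congr (_ * _); rewrite mulrA -rmorphM mulVf ?gt_eqF// mul1r.
have cA u s : u0 <= u <= u1 -> m < s < M -> continuousC (fun u => (u^-1)%:C * F u s) u.
  move=> /[dup] /up u0' uu sM; apply: ccvgM; first exact: inv0.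
  exact: polar_holo_cont_l hF _ _.
have cD u s : u0 <= u <= u1 -> m < s < M -> ccvg (nbhs (u, s)) (fun p => 'i * Fd p.1 p.2) ('i * Fd u s).
  move=> /up u0' sM; have [_ _ _ h] := hF u s u0' sM.
  by apply: ccvgM => //; exact: ccvg_cst.
pose b s := 'i * (F u1 s - F u0 s).
have u1u : u0 <= u1 <= u1 by rewrite lexx andbT.
have cb s : m < s < M -> continuousC b s.
  move=> sM; apply: ccvgM; first exact: ccvg_cst.
  by apply: ccvgB; apply: polar_holo_cont_r hF _ _ => //; exact: up.
have Db s : m < s < M -> intC `[u0, u1] (fun u => 'i * Fd u s) = b s.
  move=> sM.
  rewrite (@intC_FTC _ _ (fun u => 'i * F u s))// ?/b ?mulrBr//.
  - by move=> u /up u0'; have [h _ _ _] := hF u s u0' sM; exact: isdMl.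
  - move=> u uu; exact: (@ccvg_pair_l R (fun u s => 'i * Fd u s) u s (cD u s uu sM)).
have sub s : t0 <= s <= t1 -> m < s < M.
  by move=> /andP[a c]; apply/andP; split; lra.
have t0s : m < t0 < M by apply: sub; rewrite lexx.
have t1s : m < t1 < M by apply: sub; rewrite lexx andbT.
rewrite -intCMl//; last first.
  apply: integrableC_itv => s /sub sM.
  by apply: ccvgB; apply: polar_holo_cont_r hF _ _ => //; exact: up.
transitivity (intC `[u0, u1] (fun u => (u^-1)%:C * F u t1) -
              intC `[u0, u1] (fun u => (u^-1)%:C * F u t0)).
  rewrite -intCB//; try by apply: integrableC_itv => u uu; exact: cA.
  by apply: eq_intC => u _; rewrite mulrBr.
apply: complex_eq; rewrite ?reimE /=.
  apply: (@green_rectangle R (fun u s => Re ((u^-1)%:C * F u s))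
    (fun u s => Re ('i * Fd u s)) (fun s => Re (b s)) u0 u1 m M t0 t1) => //.
  - by move=> u s uu sM; case: (dF u s uu sM).
  - by move=> u s uu sM; case: (cA u s uu sM).
  - by move=> u s uu sM; case: (cD u s uu sM).
  - by move=> s sM; rewrite -(Db s sM).
  - by move=> s sM; case: (cb s sM).
apply: (@green_rectangle R (fun u s => Im ((u^-1)%:C * F u s))
    (fun u s => Im ('i * Fd u s)) (fun s => Im (b s)) u0 u1 m M t0 t1) => //.
- by move=> u s uu sM; case: (dF u s uu sM).
- by move=> u s uu sM; case: (cA u s uu sM).
- by move=> u s uu sM; case: (cD u s uu sM).
- by move=> s sM; rewrite -(Db s sM).
- by move=> s sM; case: (cb s sM).
Qed.

End polar_cauchy.

(** * Integrability on a half-line *)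

Section real_tools.
Variable R : realType.
Notation mu := (@lebesgue_measure R).
Implicit Types (f F : R -> R).

Lemma cvgr_addV (r : R) : r + n.+1%:R^-1 @[n --> \oo] --> r.
Proof.
rewrite -[X in _ --> X]addr0; apply: cvgD; first exact: cvg_cst.
exact: cvg_harmonic.
Qed.

Lemma addV_gt (r : R) n : r < r + n.+1%:R^-1.
Proof. by rewrite ltrDl invr_gt0. Qed.

Lemma cvgry_nat (r : R) : r + n%:R @[n --> \oo] --> +oo.
Proof.
apply/cvgryPge => A; near=> n; rewrite -lerBlDl; near: n.
exact: nbhs_infty_ger.
Unshelve. all: by end_near. Qed.

(** Monotone convergence over the intervals [[r + 1/(n+1), r + n]]: on each the integral is an
    increment of [F], hence at most [2 K]. *)
Lemma integrable_primitive f F (r K : R) :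
  (forall x, r < x -> is_derive x 1 F (f x)) ->
  (forall x, r < x -> 0 <= f x) ->
  (forall x, r < x -> {for x, continuous f}) ->
  (forall x, r < x -> `|F x| <= K) ->
  mu.-integrable `]r, +oo[ (EFin \o f).
Proof.
move=> dF f0 cf FK.
have mf : measurable_fun `]r, +oo[ (EFin \o f).
  by apply/measurable_EFinP; exact: measurable_fun_continuous_ray.
apply/integrableP; split => //.
under eq_integral => x /[!inE] /= /[!in_itv] /= /[!andbT] rx.
  rewrite ger0_norm ?f0//; over.
pose A n : set R := `[r + n.+1%:R^-1, r + n%:R]%classic.
have AE : \bigcup_n A n = `]r, +oo[%classic.
  rewrite eqEsubset; split => x.
    move=> [n _]; rewrite /A /= !in_itv /= andbT => /andP[+ _].
    by apply: lt_le_trans; exact: addV_gt.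
  rewrite /= in_itv /= andbT => rx.
  have : \forall n \near \oo, A n x.
    near=> n; rewrite /A /= in_itv /=; apply/andP; split.
      by near: n; apply: (cvgr_le r) => //; exact: cvgr_addV.
    by near: n; move/cvgryPge : (cvgry_nat r); apply.
  by move=> [N _ /(_ N (leqnn _))]; exists N.
have mA n : measurable (A n) by exact: measurable_itv.
have ndA : nondecreasing_seq A.
  apply/nondecreasing_seqP => n; apply/subsetPset => x; rewrite /A /= !in_itv /=.
  move=> /andP[a b]; apply/andP; split.
    by apply: le_trans a; rewrite lerD2l lef_pV2 ?posrE// ler_nat.
  by apply: le_trans b _; rewrite lerD2l ler_nat.
have sub n x : A n x -> r < x.
  by rewrite /A /= in_itv /= => /andP[+ _]; apply: lt_le_trans; exact: addV_gt.
have cvgi : (\int[mu]_(x in A n) (f x)%:E)%E @[n --> \oo] -->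
    (\int[mu]_(x in \bigcup_i A i) (f x)%:E)%E.
  apply: ge0_nondecreasing_set_cvg_integral => //.
    by move=> n; apply: measurable_funS mf => //= x /sub rx /=; rewrite in_itv /= rx.
  by move=> n x /sub rx; rewrite lee_fin f0.
rewrite -AE.
have -> : (\int[mu]_(x in \bigcup_i A i) (f x)%:E)%E =
    limn (fun n => \int[mu]_(x in A n) (f x)%:E)%E.
  exact/esym/cvg_lim.
apply: (@le_lt_trans _ _ (K + K)%:E); last exact: ltry.
apply: lime_le.
  by apply/cvg_ex; eexists; exact: cvgi.
apply: nearW => n; rewrite /A.
have K0 : 0 <= K by apply: le_trans (FK (r + 1) _); rewrite ?ltrDl.
(* For [n = 0] the interval [[r + 1, r]] is empty. *)
have [ab|ba] := leP (r + n.+1%:R^-1) (r + n%:R); last first.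
  by rewrite set_itv_ge -?leNgt ?bnd_simp -?ltNge// integral_set0 lee_fin addr_ge0.
have rx x : r + n.+1%:R^-1 <= x <= r + n%:R -> r < x.
  by move=> /andP[+ _]; apply: lt_le_trans; exact: addV_gt.
have fi : mu.-integrable `[r + n.+1%:R^-1, r + n%:R] (EFin \o f).
  by apply: integrable_continuous_itv => x /rx; exact: cf.
rewrite -(fineK (integrable_fin_num _ fi))// lee_fin.
rewrite (_ : fine _ = F (r + n%:R) - F (r + n.+1%:R^-1)); last first.
  by apply: (Rintegral_FTC ab) => x /rx; [exact: dF|exact: cf].
rewrite lerD//.
  by apply: le_trans (ler_norm _) (FK _ _); apply: lt_le_trans ab; exact: addV_gt.
by have := FK _ (addV_gt r n); rewrite ler_norml => /andP[h _]; rewrite lerNl.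
Unshelve. all: by end_near. Qed.
End real_tools.

Section integrands.
Variable R : realType.
Notation mu := (@lebesgue_measure R).

(** One bounded primitive handles both ends of the ray: its derivative behaves like [u^c] at [0] and
    like [u^(-2)] at infinity. *)
Lemma integrable_powR_exp (c y : R) : -1 < c -> 0 < y ->
  mu.-integrable `]0, +oo[ (EFin \o (fun u => u `^ c * expR (- (y * u)))).
Proof.
move=> c1 y0.
have c0 : 0 < c + 1 by lra.
(* The majorant is the derivative of [(u / (1 + u))^(c + 1)]. *)
pose F u := expR ((c + 1) * (ln u - ln (1 + u))).
pose g u := ((c + 1) * (u^-1 - (1 + u)^-1)) * F u.
have dlnx (x : R) : 0 < x -> is_derive x 1 (fun u => ln u - ln (1 + u)) (x^-1 - (1 + x)^-1).
  move=> x0; apply: is_deriveB; first exact: is_derive1_ln.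
  have x1 : 0 < 1 + x by lra.
  have h : is_derive x 1 (fun u : R => 1 + u) 1.
    have h := is_deriveD (is_derive_cst (1 : R) x 1) (is_derive_id x 1).
    by apply: (is_derive_eq h); rewrite add0r.
  by apply: (is_derive_eq (is_derive1_comp (is_derive1_ln x1) h)); rewrite mulr1.
have dF (x : R) : 0 < x -> is_derive x 1 F (g x).
  move=> x0.
  have h : is_derive x 1 (fun u => (c + 1) * (ln u - ln (1 + u))) ((c + 1) * (x^-1 - (1 + x)^-1)).
    apply: (is_derive_eq (is_deriveM (is_derive_cst (c + 1) x 1) (dlnx x x0))).
    by rewrite /GRing.scale /= mulr0 addr0.
  by apply: (is_derive_eq (is_derive1_comp (is_derive_expR _) h)); rewrite mulrC.
have cF (x : R) : 0 < x -> {for x, continuous F}.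
  by move=> x0; apply: differentiable_continuous; apply/derivable1_diffP; case: (dF x x0).
have gi : mu.-integrable `]0, +oo[ (EFin \o g).
  apply: (@integrable_primitive _ g F 0 1) => //.
  - move=> x x0; rewrite mulr_ge0 ?expR_ge0// mulr_ge0 ?(ltW c0)// subr_ge0.
    by rewrite lef_pV2 ?posrE//; lra.
  - move=> x x0; apply: cvgM; last exact: cF.
    apply: cvgM; first exact: cvg_cst.
    apply: cvgB; first by apply: cvgV; rewrite ?gt_eqF.
    apply: cvgV; first by rewrite gt_eqF//; lra.
    by apply: cvgD; [exact: cvg_cst|exact: cvg_id].
  - move=> x x0; rewrite ger0_norm ?expR_ge0// -expR0 ler_expR.
    rewrite mulr_ge0_le0 ?(ltW c0)// subr_le0 ler_ln ?posrE//; lra.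
(* Since [g] is [(c + 1) u^c (1 + u)^(- p)], the constant [K] has to bound
   [(1 + u)^p e^(- y u) / (c + 1)]. This is [ln w <= w - 1] at [w = (1 + u) q], multiplied by
   [p]. *)
pose p := c + 2; pose q := y / p.
have p0 : 0 < p by rewrite /p; lra.
have q0 : 0 < q by rewrite divr_gt0.
pose K := expR (y - p - p * ln q) / (c + 1).
have mf : measurable_fun (`]0, +oo[%classic : set R) (fun u : R => u `^ c * expR (- (y * u))).
  apply: measurable_funTS; apply: measurable_funM; first exact: measurable_powR.
  apply: measurableT_comp => //; apply: measurableT_comp => //.
apply: (@integrable_domin _ _ _ mu _ _ (fun u => K * g u)) => //.
- exact: (integrableZl _ K gi).
move=> u /=; rewrite in_itv /= andbT => u0.
rewrite ger0_norm ?mulr_ge0 ?powR_ge0 ?expR_ge0//.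
have u1 : 0 < 1 + u by lra.
have -> : K * g u = expR (y - p - p * ln q + (c + 1) * (ln u - ln (1 + u)) - ln u - ln (1 + u)).
  rewrite /K /g /F; move: (y - p - p * ln q) ((c + 1) * (ln u - ln (1 + u))) => A B.
  rewrite !expRD !expRN !lnK ?posrE//.
  by field; rewrite !gt_eqF.
rewrite /powR gt_eqF// -expRD ler_expR.
have : ln (1 + ((1 + u) * q - 1)) <= (1 + u) * q - 1.
  by apply: le_ln1Dx; rewrite ltrBrDl subrr mulr_gt0.
rewrite addrC subrK lnM ?posrE// => h.
have := ler_wpM2l (ltW p0) h; rewrite mulrBr mulrCA [p * q]mulrC divfK ?gt_eqF//.
by rewrite /p; lra.
Qed.
End integrands.

Lemma in_ray (R : realType) (r t : R) : `]r, +oo[%classic t -> r < t.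
Proof. by rewrite /= in_itv /= andbT. Qed.

(** * Change of variables on the half-line *)

Section substitution.
Variable R : realType.
Notation mu := (@lebesgue_measure R).
Notation intC := (intC mu).
Notation integrableC := (integrableC mu).

Lemma Rintegral_subst (h phi dphi : R -> R) (a b : R) : a <= b ->
  (forall x : R, is_derive x 1 phi (dphi x)) -> continuous dphi ->
  {in `[a, b] &, {homo phi : x y / x < y}} ->
  (forall x, phi a <= x <= phi b -> {for x, continuous h}) ->
  \int[mu]_(x in `[phi a, phi b]) h x = \int[mu]_(x in `[a, b]) (dphi x * h (phi x)).
Proof.
move=> ab dp cdp hom ch.
have dE : derive1 phi = dphi by apply/funext => x; rewrite derive1E; case: (dp x).
have cphi : continuous phi.
  by move=> x; apply: differentiable_continuous; apply/derivable1_diffP; case: (dp x).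
rewrite /Rintegral integration_by_substitution_increasing//.
- congr fine; apply: eq_integral => x _; rewrite dE /= mulrC//.
- by move=> x _; rewrite dE; exact: cdp.
- apply/cvg_ex; exists (dphi a); rewrite dE; apply: cvg_at_right_filter; exact: cdp.
- apply/cvg_ex; exists (dphi b); rewrite dE; apply: cvg_at_left_filter; exact: cdp.
- split.
  + by move=> x _; case: (dp x).
  + by apply: cvg_at_right_filter; exact: cphi.
  + by apply: cvg_at_left_filter; exact: cphi.
- by apply: continuous_in_subspaceT => x; rewrite inE /= in_itv /=; exact: ch.
Qed.

(** The substitution is made on [[1/(n+1), n+1]]; integrability of both integrands identifies the
    limits of the two sides. *)
Lemma intC_subst_ray (f : R -> R[i]) (phi dphi : R -> R) :
  (forall x : R, is_derive x 1 phi (dphi x)) -> continuous dphi ->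
  (forall x y, 0 <= x -> x < y -> phi x < phi y) -> phi 0 = 0 ->
  phi n.+1%:R @[n --> \oo] --> +oo ->
  (forall x, 0 < x -> continuousC f x) ->
  integrableC `]0, +oo[ f ->
  integrableC `]0, +oo[ (fun u => (dphi u)%:C * f (phi u)) ->
  intC `]0, +oo[ f = intC `]0, +oo[ (fun u => (dphi u)%:C * f (phi u)).
Proof.
move=> dp cdp hom p0 py cf fi gi.
have pos x : 0 < x -> 0 < phi x by move=> x0; rewrite -p0 hom.
have cphi : continuous phi.
  by move=> x; apply: differentiable_continuous; apply/derivable1_diffP; case: (dp x).
pose a n : R := 0 + n.+1%:R^-1; pose b n : R := n.+1%:R.
have a0 n : 0 < a n by exact: addV_gt.
have acvg : a n @[n --> \oo] --> 0 by exact: cvgr_addV.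
have bcvg : b n @[n --> \oo] --> +oo.
  rewrite /b; under eq_fun do rewrite -addn1 natrD addrC; exact: cvgry_nat.
have pacvg : phi (a n) @[n --> \oo] --> 0.
  by rewrite -p0; apply: (cvg_comp _ _ acvg); exact: cphi.
have L := ccvg_intC_exhaust fi (fun n => pos _ (a0 n)) pacvg py.
have U := ccvg_intC_exhaust gi a0 acvg bcvg.
apply: (ccvg_unique L); apply: ccvg_near_eq U; apply: nearW => n.
have ab : a n <= b n.
  by rewrite /a /b add0r (@le_trans _ _ 1)// ?invf_le1// ler1n.
have homab : {in `[a n, b n] &, {homo phi : x y / x < y}}.
  move=> x y; rewrite !in_itv /= => /andP[ax _] _; apply: hom.
  by apply: le_trans ax; exact/ltW.
have cf' x : phi (a n) <= x <= phi (b n) -> continuousC f x.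
  by move=> /andP[ax _]; apply: cf; apply: lt_le_trans ax; exact: pos.
apply: complex_eq => /=.
  rewrite (Rintegral_subst ab dp cdp homab); last by move=> x /cf'[].
  by apply: eq_Rintegral => x _; rewrite cReMr.
rewrite (Rintegral_subst ab dp cdp homab); last by move=> x /cf'[].
by apply: eq_Rintegral => x _; rewrite cImMr.
Qed.

Lemma intC_scale (f : R -> R[i]) (c : R) : 0 < c ->
  (forall x, 0 < x -> continuousC f x) ->
  integrableC `]0, +oo[ f -> integrableC `]0, +oo[ (fun u => f (c * u)) ->
  intC `]0, +oo[ f = c%:C * intC `]0, +oo[ (fun u => f (c * u)).
Proof.
move=> c0 cf fi gi; rewrite -intCMl//.
apply: (@intC_subst_ray f (fun u => c * u) (fun=> c)) => //.
- move=> x; have h := is_deriveM (is_derive_cst c x 1) (is_derive_id x 1).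
  by apply: (is_derive_eq h); rewrite /GRing.scale /= mulr0 addr0 mulr1.
- by move=> x; exact: cst_continuous.
- by move=> x y _ xy; rewrite ltr_pM2l.
- by rewrite mulr0.
- apply/cvgryPge => A; near=> n; rewrite -ler_pdivrMl// -addn1 natrD.
  rewrite addrC -lerBlDl; near: n; exact: nbhs_infty_ger.
- exact: integrableCMl.
Unshelve. all: by end_near. Qed.

Lemma intC_square (f : R -> R[i]) :
  (forall x, 0 < x -> continuousC f x) ->
  integrableC `]0, +oo[ f ->
  integrableC `]0, +oo[ (fun u => (2 * u)%:C * f (u ^+ 2)) ->
  intC `]0, +oo[ f = intC `]0, +oo[ (fun u => (2 * u)%:C * f (u ^+ 2)).
Proof.
move=> cf fi gi.
apply: (@intC_subst_ray f (fun u => u ^+ 2) (fun u => 2 * u)) => //.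
- move=> x; have h := is_deriveM (is_derive_id x 1) (is_derive_id x 1).
  under eq_fun do rewrite expr2.
  by apply: (is_derive_eq h); rewrite /GRing.scale /= mulr1 mulrDl mul1r.
- by move=> x; apply: cvgM; [exact: cvg_cst|exact: cvg_id].
- by move=> x y x0 xy; rewrite ltr_pXn2r ?nnegrE// ltW// (le_lt_trans x0).
- by rewrite expr0n.
- apply/cvgryPge => A; near=> n; apply: (@le_trans _ _ n.+1%:R).
    rewrite -addn1 natrD addrC -lerBlDl; near: n; exact: nbhs_infty_ger.
  by rewrite expr2 ler_peMr// ler1n.
Unshelve. all: by end_near. Qed.

End substitution.

(** * The integrand [u^c e^(- y u)] *)

Section cpow_analysis.
Variable R : realType.
Notation mu := (@lebesgue_measure R).
Notation intC := (intC mu).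
Notation integrableC := (integrableC mu).
Implicit Types (c z : R[i]) (t u : R).

Lemma isd_cpow c t : 0 < t -> isd (fun u => cpow u c) t (c * (t^-1)%:C * cpow t c).
Proof.
move=> t0; apply: (@isd_cexp _ (fun u => c * (ln u)%:C)).
by apply: isdMl; apply: isd_real; exact: is_derive1_ln.
Qed.

Lemma isd_expR (y : R) t : isd (fun u => (expR (- (y * u)))%:C) t ((- y)%:C * (expR (- (y * t)))%:C).
Proof.
rewrite -rmorphM; apply: isd_real.
have h : is_derive t 1 (fun u : R => - (y * u)) (- y).
  have h := is_deriveN (is_deriveM (is_derive_cst y t 1) (is_derive_id t 1)).
  by apply: (is_derive_eq h); rewrite /GRing.scale /= mulr0 addr0 mulr1.
by apply: (is_derive_eq (is_derive1_comp (is_derive_expR _) h)); rewrite mulrC.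
Qed.

Definition laplace_pow (c : R[i]) (y : R) (u : R) := cpow u c * (expR (- (y * u)))%:C.

Lemma isd_laplace_pow c y t : 0 < t ->
  isd (laplace_pow c y) t (c * laplace_pow (c - 1) y t - y%:C * laplace_pow c y t).
Proof.
move=> t0; apply: (isd_eq (isdM (isd_cpow c t0) (isd_expR y t))).
rewrite /laplace_pow cpowD cpowN -[(1 : R[i])]/((1 : R)%:C) cpow_real// powRr1 ?ltW//.
by rewrite -fmorphV /= rmorphN; ring.
Qed.

Lemma continuousC_laplace_pow c y t : 0 < t -> continuousC (laplace_pow c y) t.
Proof. by move=> t0; exact: isd_ccvg (isd_laplace_pow c y t0). Qed.

Lemma normc_laplace_pow c y t : 0 < t ->
  normc (laplace_pow c y t) = t `^ (Re c) * expR (- (y * t)).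
Proof.
by move=> t0; rewrite normcM normc_cpow// normc_real ger0_norm ?expR_ge0.
Qed.

Lemma integrableC_laplace_pow c y : -1 < Re c -> 0 < y ->
  integrableC `]0, +oo[ (laplace_pow c y).
Proof.
move=> c1 y0; apply: (integrableC_domin _ _ (integrable_powR_exp c1 y0)) => //.
  by apply: measurableC_ray => t; exact: continuousC_laplace_pow.
by move=> t /in_ray t0; rewrite normc_laplace_pow.
Qed.

Lemma eulerGammaE z : eulerGamma z = intC `]0, +oo[ (laplace_pow (z - 1) 1).
Proof. by apply: eq_intC => t _; rewrite /laplace_pow mul1r. Qed.

Lemma laplace_powE z y : 0 < Re z -> 0 < y ->
  intC `]0, +oo[ (laplace_pow (z - 1) y) = cpow y (- z) * eulerGamma z.
Proof.
move=> z0 y0; rewrite eulerGammaE.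
have z1 : -1 < Re (z - 1) by rewrite !reimE; lra.
have E u : 0 < u -> laplace_pow (z - 1) 1 (y * u) =
    cpow y (z - 1) * laplace_pow (z - 1) y u.
  by move=> u0; rewrite /laplace_pow cpowM// mul1r mulrA.
have i1 : integrableC `]0, +oo[ (laplace_pow (z - 1) y).
  exact: integrableC_laplace_pow.
have i2 := integrableCMl (cpow y (z - 1)) _ i1.
rewrite (@intC_scale R (laplace_pow (z - 1) 1) y)//.
- have -> : intC `]0, +oo[ (fun u => laplace_pow (z - 1) 1 (y * u)) =
      cpow y (z - 1) * intC `]0, +oo[ (laplace_pow (z - 1) y).
    by rewrite -intCMl//; apply: eq_intC => u /in_ray; exact: E.
  have -> : y%:C = cpow y 1.
    by rewrite cpowr1.
  have h : cpow y (- z) * cpow y 1 * cpow y (z - 1) = 1.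
    by rewrite -!cpowD (_ : - z + 1 + (z - 1) = 0) ?cpow0//; ring.
  move: h (intC _ _) => h I.
  rewrite [RHS](_ : _ = cpow y (- z) * cpow y 1 * cpow y (z - 1) * I); last by ring.
  by rewrite h mul1r.
- by move=> x x0; exact: continuousC_laplace_pow.
- exact: integrableC_laplace_pow.
- apply: eq_integrableC (i2 _) => // u /in_ray u0.
  by rewrite E.
Qed.

End cpow_analysis.

(** * Euler's integral and the reflection formula *)

Section gamma.
Variable R : realType.
Notation mu := (@lebesgue_measure R).
Notation intC := (intC mu).
Notation integrableC := (integrableC mu).
Implicit Types (c z : R[i]) (t u : R).

(** The bound is the maximum [(p / (e y))^p], reached at [u = p / y]; it follows from
    [ln w <= w - 1] at [w = u y / p]. *)
Lemma powR_expR_bound (p y : R) : 0 < p -> 0 < y ->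
  exists K, forall u, 0 < u -> u `^ p * expR (- (y * u)) <= K.
Proof.
move=> p0 y0; pose q := y / p.
have q0 : 0 < q by rewrite divr_gt0.
exists (expR (- p - p * ln q)) => u u0.
rewrite /powR gt_eqF// -expRD ler_expR.
have : ln (1 + (u * q - 1)) <= u * q - 1.
  by apply: le_ln1Dx; rewrite ltrBrDl subrr mulr_gt0.
rewrite addrC subrK lnM ?posrE// => h.
have := ler_wpM2l (ltW p0) h; rewrite mulrBr mulrCA [p * q]mulrC divfK ?gt_eqF//.
by lra.
Qed.

Lemma powR_expR_cvg0 (c y : R) : 0 < y ->
  n.+1%:R `^ c * expR (- (y * n.+1%:R)) @[n --> \oo] --> 0.
Proof.
(* One power more than [|c|] leaves a factor [1 / (n + 1)], which produces the limit. *)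
move=> y0; pose p := `|c| + 1.
have [K hK] := @powR_expR_bound p y (ltr_wpDl (normr_ge0 c) ltr01) y0.
have hK0 : K * n.+1%:R^-1 @[n --> \oo] --> 0.
  rewrite -[X in _ --> X](mulr0 K); apply: cvgM; first exact: cvg_cst.
  exact: cvg_harmonic.
apply: squeeze_cvgr hK0; last exact: (cvg_cst (0 : R)).
apply: nearW => n; rewrite mulr_ge0 ?powR_ge0 ?expR_ge0//=.
rewrite ler_pdivlMr// mulrAC.
apply: le_trans (hK n.+1%:R _) => //.
rewrite ler_wpM2r ?expR_ge0// /p powRD; last by rewrite pnatr_eq0 implybT.
by rewrite powRr1// ler_wpM2r// ler_powR ?ler1n// ler_norm.
Qed.

Lemma powRr_cvg0 (u : nat -> R) (c : R) : 0 < c -> (forall n, 0 < u n) ->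
  u n @[n --> \oo] --> 0 -> u n `^ c @[n --> \oo] --> 0.
Proof.
move=> c0 u0 ucvg; apply/cvgr0Pnorm_lt => e e0.
have e'0 : 0 < e `^ c^-1 by rewrite powR_gt0.
move/cvgr0Pnorm_lt : ucvg => /(_ _ e'0); apply: filterS => n.
rewrite !gtr0_norm ?powR_gt0// => h.
have := @gt0_ltr_powR _ c c0 (u n) (e `^ c^-1); rewrite -powRrM mulVf ?gt_eqF// powRr1 ?ltW//.
by apply => //; rewrite nnegrE ltW.
Qed.

Lemma laplace_pow_cvg0 c y : 0 < Re c -> 0 < y ->
  ccvg \oo (fun n => laplace_pow c y n.+1%:R^-1) 0.
Proof.
move=> c0 y0; apply: (@ccvg_squeeze0 _ _ _ _ _ (fun n => n.+1%:R^-1 `^ (Re c))).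
  apply: nearW => n; rewrite normc_laplace_pow ?invr_gt0// ler_piMr ?powR_ge0//.
  by rewrite -expR0 ler_expR oppr_le0 mulr_ge0// ltW.
by apply: powRr_cvg0 => //; exact: cvg_harmonic.
Qed.

Lemma laplace_pow_cvgy c y : 0 < y ->
  ccvg \oo (fun n => laplace_pow c y n.+1%:R) 0.
Proof.
move=> y0; apply: (ccvg_squeeze0 _ (powR_expR_cvg0 (Re c) y0)).
by apply: nearW => n; rewrite normc_laplace_pow.
Qed.

Lemma cvgy_natS : (n.+1%:R : R) @[n --> \oo] --> +oo.
Proof. by under eq_fun do rewrite -addn1 natrD addrC; exact: cvgry_nat. Qed.

Lemma cvg_invnS : n.+1%:R^-1 @[n --> \oo] --> (0 : R).
Proof. exact: cvg_harmonic. Qed.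

Lemma intC_FTC_ray0 (f F : R -> R[i]) (l0 loo : R[i]) :
  integrableC `]0, +oo[ f ->
  (forall x, 0 < x -> isd F x (f x)) ->
  (forall x, 0 < x -> continuousC f x) ->
  ccvg \oo (fun n => F n.+1%:R^-1) l0 -> ccvg \oo (fun n => F n.+1%:R) loo ->
  intC `]0, +oo[ f = loo - l0.
Proof.
move=> fi dF cf Fl0 Floo.
apply: (@intC_FTC_ray R f F 0 l0 loo (fun n => n.+1%:R^-1) (fun n => n.+1%:R)) => //.
- exact: cvg_invnS.
- exact: cvgy_natS.
Qed.

(** Integration by parts: [u^z e^(- u)] has derivative [z u^(z-1) e^(- u) - u^z e^(- u)], and
    [Re z > 0] makes its boundary value at [0] vanish. *)
Lemma eulerGammaS z : 0 < Re z -> eulerGamma (z + 1) = z * eulerGamma z.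
Proof.
move=> z0; rewrite !eulerGammaE addrK.
have z1 : -1 < Re (z - 1) by rewrite !reimE; lra.
have z2 : -1 < Re z by lra.
have i1 := integrableC_laplace_pow z1 (@ltr01 R).
have i2 := integrableC_laplace_pow z2 (@ltr01 R).
have i1' : integrableC `]0, +oo[ (fun u => z * laplace_pow (z - 1) 1 u).
  exact: integrableCMl.
have h : intC `]0, +oo[ (fun u => z * laplace_pow (z - 1) 1 u - laplace_pow z 1 u) = 0 - 0.
  apply: (@intC_FTC_ray0 _ (laplace_pow z 1)).
  - exact: integrableCB.
  - move=> x x0; apply: (isd_eq (isd_laplace_pow z 1 x0)).
    by rewrite rmorph1 mul1r.
  - move=> x x0; apply: ccvgB; last exact: continuousC_laplace_pow.
    by apply: ccvgM; [exact: ccvg_cst|exact: continuousC_laplace_pow].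
  - exact: laplace_pow_cvg0.
  - exact: laplace_pow_cvgy.
move: h; rewrite intCB// intCMl// subr0 => /eqP; rewrite subr_eq0 => /eqP ->//.
Qed.

Lemma eulerGamma1 : eulerGamma 1 = 1 :> R[i].
Proof.
rewrite eulerGammaE subrr.
have c0 : -1 < Re (0 : R[i]) by rewrite reimE; lra.
rewrite (@intC_FTC_ray0 _ (fun u => - laplace_pow 0 1 u) (-1) 0) ?sub0r ?opprK//.
- exact: integrableC_laplace_pow.
- move=> x x0; apply: (isd_eq (isdN (isd_laplace_pow 0 1 x0))).
  by rewrite rmorph1 mul1r mul0r sub0r opprK.
- by move=> x x0; exact: continuousC_laplace_pow.
- apply: ccvgN; under eq_fun do rewrite /laplace_pow cpow0 mul1r.
  have e : expR (- (1 * n.+1%:R^-1)) @[n --> \oo] --> expR (0 : R).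
    apply: (@cvg_comp _ _ _ (fun n => - (1 * n.+1%:R^-1)) expR _ (nbhs (0 : R))).
      rewrite -oppr0; apply: cvgN; under eq_fun do rewrite mul1r; exact: cvg_invnS.
    exact: continuous_expR.
  by have := ccvg_real e; rewrite expR0 rmorph1; apply.
- by rewrite -oppr0; apply: ccvgN; exact: laplace_pow_cvgy.
Qed.

(** The larger exponent dominates for [t >= 1], the smaller one for [t <= 1]. The sum is a majorant
    uniform over a strip of exponents, as dominated convergence requires. *)
Lemma powR_le_sum t (s0 s s1 : R) : 0 < t -> s0 <= s -> s <= s1 ->
  t `^ s <= t `^ s0 + t `^ s1.
Proof.
move=> t0 s0s ss1; have [t1|/ltW t1] := leP 1 t.
  by rewrite (le_trans (ler_powR t1 ss1))// lerDr powR_ge0.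
by rewrite (le_trans (ger_powR _ s0s)) ?t0 ?t1// lerDl powR_ge0.
Qed.

Lemma ccvg_cpow (T : Type) (F : set_system T) {FF : Filter F} (zn : T -> R[i]) z t :
  ccvg F zn z -> ccvg F (fun n => cpow t (zn n)) (cpow t z).
Proof. by move=> zz; apply: ccvg_cexp; apply: ccvgM => //; exact: ccvg_cst. Qed.

Lemma eulerGamma_cvg (zn : nat -> R[i]) z (s0 s1 : R) : 0 < s0 ->
  (forall n, s0 <= Re (zn n) <= s1) -> ccvg \oo zn z ->
  ccvg \oo (fun n => eulerGamma (zn n)) (eulerGamma z).
Proof.
move=> s00 zs zz; under eq_fun do rewrite eulerGammaE; rewrite eulerGammaE.
have i0 := @integrable_powR_exp R (s0 - 1) 1 _ ltr01.
have i1 := @integrable_powR_exp R (s1 - 1) 1 _ ltr01.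
have s01 : s0 <= s1 by have /andP[] := zs 0%N; exact: le_trans.
have h0 : -1 < s0 - 1 by lra.
have h1 : -1 < s1 - 1 by lra.
apply: (@ccvg_intC _ _ _ mu _ _ _ (fun u => u `^ (s0 - 1) * expR (- (1 * u)) +
   u `^ (s1 - 1) * expR (- (1 * u)))) => //.
- by move=> n; apply: measurableC_ray => u u0; exact: continuousC_laplace_pow.
- move=> u /in_ray u0; apply: ccvgM; last exact: ccvg_cst.
  by apply: ccvg_cpow; apply: ccvgB => //; exact: ccvg_cst.
- exact: (integrableD _ (i0 h0) (i1 h1)).
- move=> n u /in_ray u0; rewrite normc_laplace_pow// -mulrDl ler_wpM2r ?expR_ge0//.
  have /andP[a b] := zs n.
  by apply: powR_le_sum => //; rewrite !reimE lerD2r.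
Qed.

End gamma.

(** * Exchange of integrals for the Beta integral *)

Section beta.
Variable R : realType.
Notation mu := (@lebesgue_measure R).
Notation intC := (intC mu).
Notation integrableC := (integrableC mu).
Implicit Types (c z : R[i]) (t u : R).
Let D : set R := `]0, +oo[%classic.

Let Dp t : D t <-> 0 < t.
Proof. by rewrite /D /= in_itv /= andbT. Qed.

Lemma Rintegral_laplace_powR (c v : R) : -1 < c -> 0 < v ->
  \int[mu]_(u in D) (u `^ c * expR (- (v * u))) =
  v `^ (- (c + 1)) * Re (eulerGamma (c + 1)%:C).
Proof.
move=> c1 v0; have z0 : 0 < Re (c + 1)%:C by rewrite /=; lra.
have := laplace_powE z0 v0; move/(congr1 (@complex.Re R)).
rewrite (_ : - (c + 1)%:C = (- (c + 1))%:C); last by rewrite rmorphN.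
have -> : (c + 1)%:C - 1 = c%:C :> R[i] by rewrite -(rmorph1 (real_complex R)) -rmorphB addrK.
rewrite cpow_real// cReMr => <-.
apply: eq_Rintegral => u; rewrite inE => /Dp u0.
by rewrite /laplace_pow cpow_real// -rmorphM.
Qed.

Lemma Rintegral_expR (w : R) : 0 < w -> \int[mu]_(v in D) expR (- (w * v)) = w^-1.
Proof.
move=> w0; have := @Rintegral_laplace_powR 0 w _ w0; rewrite add0r rmorph1 eulerGamma1.
rewrite powRN powRr1 ?ltW// mulr1 => <-; last by lra.
by apply: eq_Rintegral => u _; rewrite powRr0 mul1r.
Qed.

Let mD : measurable D. Proof. exact: measurable_itv. Qed.

(* [1 / (1 + u)] is written as the integral of [e^(- v (1 + u))] over [v > 0]. *)
Let kern (p : R -> R) (w : R * R) : \bar R :=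
  ((p \_ D) w.1 * (expR (- (w.2 * (1 + w.1))) * \1_D w.2))%:E.

Let measurable_kern (p : R -> R) : measurable_fun D p -> measurable_fun [set: R * R] (kern p).
Proof.
move=> mp.
have mP : measurable_fun [set: R] (p \_ D).
  by apply: (@measurable_restrict _ _ _ _ D setT p _ _).1 => //; rewrite setTI.
apply/measurable_EFinP; apply: measurable_funM.
  exact: (@measurableT_comp _ _ _ _ _ _ (p \_ D)).
apply: measurable_funM.
  apply: measurableT_comp => //; apply: measurableT_comp => //.
  by apply: measurable_funM => //; apply: measurable_funD.
by apply: measurableT_comp.
Qed.

Let kernE (p : R -> R) (u v : R) : 0 < u -> 0 < v ->
  kern p (u, v) = (expR (- v) * (p u * expR (- (v * u))))%:E.
Proof.
move=> /Dp u0 /Dp v0; rewrite /kern patchE mem_set// indicE mem_set// mulr1 /=.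
by rewrite mulrDr mulr1 opprD expRD; congr EFin; ring.
Qed.

Let kern0l (p : R -> R) u v : ~ D u -> kern p (u, v) = 0%E.
Proof. by move=> u0; rewrite /kern patchE memNset// mul0r. Qed.

Let kern0r (p : R -> R) u v : ~ D v -> kern p (u, v) = 0%E.
Proof. by move=> v0; rewrite /kern indicE memNset// !mulr0. Qed.

Let integrable_laplace (p : R -> R) (c v : R) : -1 < c -> 0 < v ->
  measurable_fun D p -> (forall u, 0 < u -> `|p u| <= u `^ c) ->
  mu.-integrable D (EFin \o (fun u => p u * expR (- (v * u)))).
Proof.
move=> c1 v0 mp pc.
have m : measurable_fun D (fun u => p u * expR (- (v * u))).
  apply: measurable_funM => //; apply: measurable_funTS.
  by apply: measurableT_comp => //; apply: measurableT_comp.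
apply: (@integrable_domin _ _ _ mu _ _ (fun u => u `^ c * expR (- (v * u)))) => //.
  exact: integrable_powR_exp.
move=> u /Dp u0; rewrite normrM [`|expR _|]ger0_norm ?expR_ge0//.
by rewrite ler_wpM2r ?expR_ge0// pc.
Qed.

Let kern_intl (p : R -> R) (c v : R) : -1 < c -> 0 < v ->
  measurable_fun D p -> (forall u, 0 < u -> `|p u| <= u `^ c) ->
  (\int[mu]_u kern p (u, v))%E =
   (expR (- v) * \int[mu]_(u in D) (p u * expR (- (v * u))))%:E.
Proof.
move=> c1 v0 mp pc.
have i := integrable_laplace c1 v0 mp pc.
transitivity (\int[mu]_(u in D) ((expR (- v))%R%:E * (p u * expR (- (v * u)))%R%:E))%E.
  rewrite [RHS]integral_mkcond; apply: eq_integral => u _; rewrite patchE.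
  case: ifPn => [/set_mem /Dp u0|]; first by rewrite kernE.
  by rewrite notin_setE => u0; rewrite kern0l.
by rewrite integralZl// /Rintegral EFinM fineK//; exact: integrable_fin_num.
Qed.

Let kern_intr (p : R -> R) u : 0 < u ->
  (\int[mu]_v kern p (u, v))%E = (p u / (1 + u))%:E.
Proof.
move=> u0; have u1 : 0 < 1 + u by lra.
have i := @integrable_powR_exp R 0 (1 + u) (ltrN10 R) u1.
have {}i : mu.-integrable D (EFin \o (fun v => expR (- ((1 + u) * v)))).
  by apply: eq_integrable i => // v _; rewrite /= powRr0 mul1r.
transitivity (\int[mu]_(v in D) ((p u)%:E * (expR (- ((1 + u) * v)))%R%:E))%E.
  rewrite [RHS]integral_mkcond; apply: eq_integral => v _; rewrite patchE.
  case: ifPn => [/set_mem /Dp v0|].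
    rewrite kernE// -EFinM; congr EFin; rewrite mulrCA -expRD; congr (_ * expR _).
    by ring.
  by rewrite notin_setE => v0; rewrite kern0r.
rewrite integralZl// EFinM; congr (_ * _)%E.
by rewrite -(Rintegral_expR u1) /Rintegral fineK//; exact: integrable_fin_num.
Qed.

Let integral_restr (F : R -> \bar R) : (forall u, ~ D u -> F u = 0%E) ->
  (\int[mu]_u F u = \int[mu]_(u in D) F u)%E.
Proof.
move=> F0; rewrite [RHS]integral_mkcond; apply: eq_integral => u _; rewrite patchE.
by case: ifPn => //; rewrite notin_setE => /F0.
Qed.

(** For [p = u^c] Tonelli's theorem applies: integrating over [u] leaves
    [Gamma(c + 1) v^(- (c + 1)) e^(- v)], integrable because [c < 0] means [- (c + 1) > -1]. A
    general [p] is dominated by this case. *)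
Let kern_integrable (p : R -> R) (c : R) : -1 < c -> c < 0 ->
  measurable_fun D p -> (forall u, 0 < u -> `|p u| <= u `^ c) ->
  (mu \x mu)%E.-integrable setT (kern p).
Proof.
move=> c1 c0 mp pc.
have mpow : measurable_fun D (fun u : R => u `^ c).
  by apply: measurable_funTS; exact: measurable_powR.
have powc u : 0 < u -> `|u `^ c| <= u `^ c by rewrite ger0_norm// powR_ge0.
have i : (mu \x mu)%E.-integrable setT (kern (fun u : R => u `^ c)).
  apply/integrable21ltyP; first exact: measurable_kern.
  rewrite integral_restr; last first.
    move=> v v0; apply: integral0_eq => u _; rewrite kern0r// abse0//.
  have j := @integrable_powR_exp R (- (c + 1)) 1 _ ltr01.
  have c' : -1 < - (c + 1) by lra.
  have j' : mu.-integrable D (EFin \o (fun v => Re (eulerGamma (c + 1)%:C) *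
      (v `^ (- (c + 1)) * expR (- (1 * v))))).
    exact: (integrableZl _ _ (j c')).
  have /integrableP[_] := j'; apply: le_lt_trans.
  rewrite le_eqVlt; apply/orP; left; apply/eqP.
  apply: eq_integral => v; rewrite inE => /Dp v0.
  have E : (\int[mu]_u `|kern (fun u : R => powR u c) (u, v)|)%E =
      (Re (eulerGamma (c + 1)%:C) * (v `^ (- (c + 1)) * expR (- (1 * v))))%:E.
    transitivity (\int[mu]_u kern (fun u : R => powR u c) (u, v))%E.
      apply: eq_integral => u _; rewrite gee0_abs//.
      rewrite /kern lee_fin mulr_ge0 ?mulr_ge0 ?expR_ge0//.
      by rewrite patchE; case: ifP => // _; rewrite powR_ge0.
    rewrite (kern_intl c1 v0 mpow powc) Rintegral_laplace_powR//.
    by rewrite mul1r; congr EFin; ring.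
  (* The right-hand side is nonnegative because it equals an integral of absolute values; positivity
     of [eulerGamma] is not established separately. *)
  rewrite E /= ger0_norm// -lee_fin -E; apply: integral_ge0 => u _.
  exact: abse_ge0.
apply: le_integrable i => //; first exact: measurable_kern.
move=> [u v] _; rewrite /kern lee_fin !normrM ler_wpM2r//.
rewrite !patchE; case: ifPn => [/set_mem /Dp u0|]; last by rewrite normr0.
by rewrite [leRHS]ger0_norm ?powR_ge0// pc.
Qed.

(** A real [p] bounded by a power covers both the real and the imaginary part of [u^(- z)]. *)
Lemma fubini_laplace (p : R -> R) (c : R) : -1 < c -> c < 0 ->
  measurable_fun D p -> (forall u, 0 < u -> `|p u| <= u `^ c) ->
  mu.-integrable D (EFin \o (fun u => p u / (1 + u))) /\
  \int[mu]_(u in D) (p u / (1 + u)) =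
  \int[mu]_(v in D) (expR (- v) * \int[mu]_(u in D) (p u * expR (- (v * u)))).
Proof.
move=> c1 c0 mp pc.
have ki := kern_integrable c1 c0 mp pc.
split.
  have h := integrable_fubini_F ki.
  have E : {in setT, fubini_F mu (kern p) =1 (EFin \o (fun u => p u / (1 + u))) \_ D}.
    move=> u _; rewrite patchE /fubini_F; case: ifPn => [/set_mem /Dp u0|].
      by rewrite kern_intr.
    by rewrite notin_setE => u0; apply: integral0_eq => v _; exact: kern0l.
  have {}h : mu.-integrable setT ((EFin \o (fun u => p u / (1 + u))) \_ D).
    by apply: eq_integrable h => // u _; rewrite E// inE.
  by have /integrable_restrict := h; rewrite setTI; apply.
have := Fubini ki.
rewrite integral_restr; last by move=> u u0; apply: integral0_eq => v _; exact: kern0l.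
rewrite [RHS]integral_restr; last by move=> u u0; apply: integral0_eq => v _; exact: kern0r.
move=> /(congr1 fine); rewrite /Rintegral => E.
transitivity (fine (\int[mu]_(x in D) \int[mu]_y kern p (x, y)))%E.
  by congr fine; apply: eq_integral => u; rewrite inE => /Dp u0; rewrite kern_intr.
rewrite E; congr fine; apply: eq_integral => v; rewrite inE => /Dp v0.
by rewrite (kern_intl c1 v0 mp pc).
Qed.
End beta.

(** * Turning rays and collapsing circles *)

Section contours.
Variable R : realType.
Notation mu := (@lebesgue_measure R).
Notation intC := (intC mu).
Notation integrableC := (integrableC mu).
Implicit Types (F Fd : R -> R -> R[i]) (f : R -> R[i]).

Lemma ccvg_intC_ray f (r : R) (a : nat -> R) : integrableC `]r, +oo[ f ->
  (forall n, r < a n) -> a n @[n --> \oo] --> r ->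
  ccvg \oo (fun n => intC `]a n, +oo[ f) (intC `]r, +oo[ f).
Proof.
have h (h : R -> R) : mu.-integrable `]r, +oo[ (EFin \o h) ->
    (forall n, r < a n) -> a n @[n --> \oo] --> r ->
    \int[mu]_(x in `]a n, +oo[) h x @[n --> \oo] --> \int[mu]_(x in `]r, +oo[) h x.
  move=> hi ra ar.
  rewrite (_ : (fun n => _) = fun n =>
      \int[mu]_(x in `]r, +oo[) (h \_ `]a n, +oo[) x); last first.
    apply/funext => n; rewrite -Rintegral_mkcondr; congr Rintegral.
    rewrite setIC; apply/esym/setIidl => x /=; rewrite !in_itv /= !andbT.
    exact: lt_trans.
  apply: (@Rintegral_dominated_cvg _ _ _ mu _ _ _ (fun x => `|h x|)) => //.
  - move=> n; apply/(measurable_restrict _ _ _) => //.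
    have /measurable_int/measurable_EFinP mh := hi.
    by apply: measurable_funS mh => // x [].
  - move=> x /in_ray rx; apply: cvg_near_cst.
    near=> n; rewrite patchE mem_set//= in_itv /= andbT.
    by near: n; exact: (cvgr_lt r).
  - exact: integrable_norm hi.
  - by move=> n x _; rewrite patchE; case: ifP => // _; rewrite normr0.
by move=> [f1 f2] ra ar; split; apply: h.
Unshelve. all: by end_near. Qed.

Section polar.
Variables (m M : R) (F Fd : R -> R -> R[i]) (t0 t1 : R).
Hypotheses (hF : polar_holo m M F Fd) (mt0 : m < t0) (t01 : t0 <= t1) (t1M : t1 < M).

Let sub s : t0 <= s <= t1 -> m < s < M.
Proof. by move=> /andP[a c]; rewrite (lt_le_trans mt0 a) (le_lt_trans c t1M). Qed.

Let cont_arc u s : 0 < u -> t0 <= s <= t1 -> continuousC (F u) s.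
Proof. by move=> u0 /sub sM; exact: polar_holo_cont_r hF u0 sM. Qed.

Let t0s : t0 <= t0 <= t1. Proof. by rewrite lexx. Qed.
Let t1s : t0 <= t1 <= t1. Proof. by rewrite lexx andbT. Qed.

Let cont_diff u : 0 < u -> continuousC (fun u => (u^-1)%:C * (F u t1 - F u t0)) u.
Proof.
move=> u0; apply: ccvgM.
  by apply: ccvg_real; apply: cvgV; rewrite ?gt_eqF.
by apply: ccvgB; apply: polar_holo_cont_l hF u0 _; exact: sub.
Qed.

Let normc_arc u v eu ev : 0 < u -> 0 < v ->
  (forall s, t0 <= s <= t1 -> normc (F u s) <= eu) ->
  (forall s, t0 <= s <= t1 -> normc (F v s) <= ev) ->
  normc ('i * intC `[t0, t1] (fun t => F u t - F v t)) <= 2 * ((eu + ev) * (t1 - t0)).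
Proof.
move=> u0 v0 hu hv; rewrite normcM normc_i mul1r; apply: normc_intC_itv => //.
  by move=> x xt; apply: ccvgB; exact: cont_arc.
by move=> x xt; rewrite (le_trans (normcB _ _))// lerD ?hu ?hv.
Qed.

(** The arcs joining the rays at radii [1/(n+1)] and [n+1] carry the measure [dt] of mass [t1 - t0],
    so they disappear as soon as the bound [eta] of [|F|] tends to [0] along these radii. *)
Lemma polar_cauchy_rays (eta : R -> R) :
  integrableC `]0, +oo[ (fun u => (u^-1)%:C * F u t0) ->
  integrableC `]0, +oo[ (fun u => (u^-1)%:C * F u t1) ->
  (forall u s, 0 < u -> t0 <= s <= t1 -> normc (F u s) <= eta u) ->
  eta n.+1%:R^-1 @[n --> \oo] --> 0 -> eta n.+1%:R @[n --> \oo] --> 0 ->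
  intC `]0, +oo[ (fun u => (u^-1)%:C * F u t0) =
  intC `]0, +oo[ (fun u => (u^-1)%:C * F u t1).
Proof.
move=> i0 i1 Feta eta0 etay; apply/eqP; rewrite eq_sym -subr_eq0 -intCB//.
under [X in intC _ X]eq_fun do rewrite -mulrBr.
have i : integrableC `]0, +oo[ (fun u => (u^-1)%:C * (F u t1 - F u t0)).
  by under [X in integrableC _ X]eq_fun do rewrite mulrBr; exact: integrableCB.
have L := ccvg_intC_exhaust i (fun n => _) (@cvg_invnS R) (@cvgy_natS R).
apply/eqP; apply: (ccvg_unique (L _)) => [n|]; first by rewrite invr_gt0.
have lim0 : 2 * ((eta n.+1%:R + eta n.+1%:R^-1) * (t1 - t0)) @[n --> \oo] --> 0.
  rewrite -(mulr0 2); apply: cvgM; first exact: cvg_cst.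
  rewrite -(mul0r (t1 - t0)); apply: cvgM; last exact: cvg_cst.
  by rewrite -(addr0 0); apply: cvgD.
apply: (ccvg_squeeze0 _ lim0); apply: nearW => n.
have n0 : 0 < n.+1%:R^-1 :> R by rewrite invr_gt0.
have n1 : n.+1%:R^-1 <= n.+1%:R :> R.
  by rewrite (@le_trans _ _ 1)// ?invf_le1// ler1n.
rewrite (polar_cauchy hF n0 n1 mt0 t01 t1M).
by apply: normc_arc => // s st; exact: Feta.
Qed.

Lemma polar_cauchy_shift (r s : R) : 0 < r -> r <= s ->
  integrableC `]r, +oo[ (fun u => (u^-1)%:C * (F u t1 - F u t0)) ->
  intC `]r, +oo[ (fun u => (u^-1)%:C * (F u t1 - F u t0)) + 'i * intC `[t0, t1] (F r) =
  intC `]s, +oo[ (fun u => (u^-1)%:C * (F u t1 - F u t0)) + 'i * intC `[t0, t1] (F s).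
Proof.
move=> r0 rs i; have s0 := lt_le_trans r0 rs.
rewrite (intC_setU_ray rs i); last first.
  by move=> x /andP[rx _]; apply: cont_diff; exact: lt_le_trans rx.
rewrite (polar_cauchy hF r0 rs mt0 t01 t1M) intCB//; last 2 first.
- by apply: integrableC_itv => t; exact: cont_arc.
- by apply: integrableC_itv => t; exact: cont_arc.
by ring.
Qed.

(** The contour is moved from radius [r] to [1/(n+1)]: there the circle vanishes with [eta], and
    integrability down to [0] gives the limit of the cut integrals. *)
Lemma polar_cauchy_collapse (eta : R -> R) (r : R) : 0 < r ->
  integrableC `]0, +oo[ (fun u => (u^-1)%:C * (F u t1 - F u t0)) ->
  (forall u s, 0 < u -> u <= r -> t0 <= s <= t1 -> normc (F u s) <= eta u) ->
  eta n.+1%:R^-1 @[n --> \oo] --> 0 ->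
  intC `]r, +oo[ (fun u => (u^-1)%:C * (F u t1 - F u t0)) + 'i * intC `[t0, t1] (F r) =
  intC `]0, +oo[ (fun u => (u^-1)%:C * (F u t1 - F u t0)).
Proof.
move=> r0 i Feta eta0.
have n0 n : 0 < n.+1%:R^-1 :> R by rewrite invr_gt0.
have L := ccvg_intC_ray i n0 (@cvg_invnS R).
have A : ccvg \oo (fun n => 'i * intC `[t0, t1] (F n.+1%:R^-1)) 0.
  have lim0 : 2 * (eta n.+1%:R^-1 * (t1 - t0)) @[n --> \oo] --> 0.
    rewrite -(mulr0 2); apply: cvgM; first exact: cvg_cst.
    by rewrite -(mul0r (t1 - t0)); apply: cvgM => //; exact: cvg_cst.
  apply: (ccvg_squeeze0 _ lim0); near=> n.
  rewrite normcM normc_i mul1r; apply: normc_intC_itv => //.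
    by move=> t; exact: cont_arc.
  move=> t tt; apply: Feta => //.
  by near: n; apply: (cvgr_le 0) => //; exact: cvg_invnS.
have LA : ccvg \oo _ _ := ccvgD L A; rewrite addr0 in LA.
refine (ccvg_unique _ (LA _)); apply: ccvg_near_eq (ccvg_cst _).
near=> n.
have nr : n.+1%:R^-1 <= r by near: n; apply: (cvgr_le 0) => //; exact: cvg_invnS.
rewrite -(polar_cauchy_shift (n0 n) nr)//.
apply: integrableCS i => // x /in_ray nx; rewrite /= in_itv /= andbT.
exact: lt_trans nx.
Unshelve. all: by end_near. Qed.

End polar.
End contours.

(** * Powers of [s] and the size of [1 + s] *)

Section polar_power.
Variable R : realType.
Implicit Types (c d z : R[i]) (u t : R).

(* The branch of [s^c] at [s = u e^(i t)], on the Riemann surface of the logarithm. *)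
Definition spow c u t : R[i] := cexp (c * ((ln u)%:C + 'i * t%:C)).

Lemma spowE c u t : spow c u t = cpow u c * cexp ('i * t%:C * c).
Proof. by rewrite /spow mulrDr cexpD [_ * c]mulrC. Qed.

Lemma spowD c d u t : spow (c + d) u t = spow c u t * spow d u t.
Proof. by rewrite /spow mulrDl cexpD. Qed.

Lemma normc_spow c u t : 0 < u -> normc (spow c u t) = u `^ (Re c) * expR (- (Im c * t)).
Proof.
move=> u0; rewrite spowE normcM normc_cpow// normc_cexp; congr (_ * expR _).
by rewrite !reimE; ring.
Qed.

Lemma normc_spow_le c u t : 0 < u -> `|t| <= pi ->
  normc (spow c u t) <= u `^ (Re c) * expR (pi * `|Im c|).
Proof.
move=> u0 tpi; rewrite normc_spow// ler_wpM2l ?powR_ge0// ler_expR.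
rewrite (le_trans (ler_norm _))// normrN normrM mulrC ler_wpM2r//.
Qed.

Lemma Re_spow1 u t : 0 < u -> Re (spow 1 u t) = u * cos t.
Proof.
move=> u0; rewrite spowE cpowr1// cReMr mulr1 Re_cexp; congr (_ * _).
by rewrite !reimE !(mul0r, mul1r, mulr0, subr0, addr0, add0r) expR0 mul1r.
Qed.

Lemma Im_spow1 u t : 0 < u -> Im (spow 1 u t) = u * sin t.
Proof.
move=> u0; rewrite spowE cpowr1// cImMr mulr1 Im_cexp; congr (_ * _).
by rewrite !reimE !(mul0r, mul1r, mulr0, subr0, addr0, add0r) expR0 mul1r.
Qed.

Lemma polar_holo_eq m M (F Fd F' Fd' : R -> R -> R[i]) :
  polar_holo m M F Fd -> F = F' -> Fd = Fd' -> polar_holo m M F' Fd'.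
Proof. by move=> h <- <-. Qed.

Lemma polar_holo_spow m M c :
  polar_holo m M (spow c) (fun u t => c * (u^-1)%:C * spow c u t).
Proof.
have h := polar_holo_cexp (polar_holoM (@polar_holo_cst R m M c) (@polar_holo_log R m M)).
apply: (polar_holo_eq h) => //.
by apply/funext => u; apply/funext => t; rewrite mul0r add0r.
Qed.

(** For [|t| < pi] a vanishing imaginary part forces [t = 0], and there [1 + u > 0]. *)
Lemma onePspow1_neq0 u t : 0 < u -> - pi < t < pi -> 1 + spow 1 u t != 0.
Proof.
move=> u0 /andP[t1 t2]; apply/eqP => h.
have hr : 1 + u * cos t = 0.
  by have := congr1 (@complex.Re R) h; rewrite cReD Re1 Re0 Re_spow1.
have hi : u * sin t = 0.
  by have := congr1 (@complex.Im R) h; rewrite cImD Im1 Im0 Im_spow1// add0r.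
have st : sin t = 0 by apply/eqP; move/eqP : hi; rewrite mulf_eq0 gt_eqF.
have [t0|t0|t0] := ltgtP t 0.
- have : 0 < sin (- t) by rewrite sin_gt0_pi// oppr_gt0 t0 ltrNl.
  by rewrite sinN st oppr0 ltxx.
- have : 0 < sin t by rewrite sin_gt0_pi// t0 t2.
  by rewrite st ltxx.
- by move: hr; rewrite t0 cos0 mulr1 => /eqP; rewrite gt_eqF// addr_gt0.
Qed.

Lemma le_normc (x : R) z : 0 <= x -> x ^+ 2 <= Re z ^+ 2 + Im z ^+ 2 -> x <= normc z.
Proof.
move=> x0 h; rewrite normcE -(ger0_norm x0) -sqrtr_sqr ler_sqrt//.
by rewrite addr_ge0 ?sqr_ge0.
Qed.

(** In the right half-plane [|1 + s|^2 >= 1 + u^2], which is at least [((1 + u) / 2)^2]. *)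
Lemma normc_onePspow1 u t : 0 < u -> 0 <= cos t -> (1 + u) / 2 <= normc (1 + spow 1 u t).
Proof.
move=> u0 ct; apply: le_normc; first by rewrite divr_ge0// addr_ge0// ltW.
rewrite cReD cImD Re1 Im1 Re_spow1// Im_spow1// add0r.
have := cos2Dsin2 t; move: (cos t) (sin t) ct => c s c0 cs.
have := mulr_ge0 (ltW u0) c0 => uc0.
have := sqr_ge0 (1 - u) => sq.
have -> : (1 + u * c) ^+ 2 + (u * s) ^+ 2 = 1 + 2 * (u * c) + u ^+ 2 * (c ^+ 2 + s ^+ 2).
  by ring.
by rewrite cs; nra.
Qed.

End polar_power.

(** * The Beta integral as [Gamma(z) Gamma(1 - z)] *)

Section beta_gamma.
Variable R : realType.
Notation mu := (@lebesgue_measure R).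
Notation intC := (intC mu).
Notation integrableC := (integrableC mu).
Implicit Types (z : R[i]).

Definition beta_integrand z (u : R) : R[i] := ((1 + u)^-1)%:C * cpow u (- z).

Lemma continuousC_cpow (c : R[i]) (u : R) : 0 < u -> continuousC (fun u => cpow u c) u.
Proof. by move=> u0; exact: isd_ccvg (isd_cpow c u0). Qed.

Lemma continuousC_beta z (u : R) : 0 < u -> continuousC (beta_integrand z) u.
Proof.
move=> u0; apply: ccvgM; last exact: continuousC_cpow.
apply: ccvg_real; apply: cvgV; first by rewrite gt_eqF// addr_gt0.
by apply: cvgD; [exact: cvg_cst|exact: cvg_id].
Qed.

(** The Laplace transform of [u^(- z)] at [v] is [Gamma(1 - z) v^(z - 1)]. Integrating it against
    [e^(- v)] yields the product of Gammas, and in the other order the Beta integral. *)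
Lemma beta_gamma z : 0 < Re z -> Re z < 1 ->
  integrableC `]0, +oo[ (beta_integrand z) /\
  intC `]0, +oo[ (beta_integrand z) = eulerGamma z * eulerGamma (1 - z).
Proof.
move=> z0 z1; pose c := - Re z.
have c1 : -1 < c by rewrite /c; lra.
have c0 : c < 0 by rewrite /c; lra.
have [mr mi] : measurableC (`]0, +oo[%classic : set R) (fun u : R => cpow u (- z)).
  by apply: measurableC_ray => u; exact: continuousC_cpow.
have br (u : R) : 0 < u -> `|Re (cpow u (- z))| <= u `^ c.
  by move=> u0; rewrite (le_trans (normc_Re _))// normc_cpow// cReN.
have bi (u : R) : 0 < u -> `|Im (cpow u (- z))| <= u `^ c.
  by move=> u0; rewrite (le_trans (normc_Im _))// normc_cpow// cReN.
have [ir er] := fubini_laplace c1 c0 mr br.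
have [ii ei] := fubini_laplace c1 c0 mi bi.
split.
  split.
    apply: eq_integrable ir => [|u _]; first exact: measurable_itv.
    by apply: (congr1 EFin); rewrite [RHS]cReMr mulrC.
  apply: eq_integrable ii => [|u _]; first exact: measurable_itv.
  by apply: (congr1 EFin); rewrite [RHS]cImMr mulrC.
have z'0 : 0 < Re (1 - z) by rewrite !reimE; lra.
have z1' : -1 < Re (z - 1) by rewrite !reimE; lra.
have inner (v : R) : 0 < v -> intC `]0, +oo[ (laplace_pow (- z) v) =
    cpow v (z - 1) * eulerGamma (1 - z).
  by move=> v0; have := laplace_powE z'0 v0; rewrite opprB (_ : 1 - z - 1 = - z)//; ring.
have innerR (v : R) : 0 < v ->
    \int[mu]_(u in `]0, +oo[) (Re (cpow u (- z)) * expR (- (v * u))) =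
    Re (intC `]0, +oo[ (laplace_pow (- z) v)).
  move=> v0; apply: eq_Rintegral => u _; rewrite /laplace_pow [in RHS]mulrC [RHS]cReMr mulrC//.
have innerI (v : R) : 0 < v ->
    \int[mu]_(u in `]0, +oo[) (Im (cpow u (- z)) * expR (- (v * u))) =
    Im (intC `]0, +oo[ (laplace_pow (- z) v)).
  move=> v0; apply: eq_Rintegral => u _; rewrite /laplace_pow [in RHS]mulrC [RHS]cImMr mulrC//.
rewrite mulrC (eulerGammaE z) -intCMl//; last exact: integrableC_laplace_pow.
apply: complex_eq.
  transitivity (\int[mu]_(u in `]0, +oo[) (Re (cpow u (- z)) / (1 + u))).
    by apply: eq_Rintegral => u _; rewrite [LHS]cReMr mulrC.
  rewrite er; apply: eq_Rintegral => v; rewrite inE => /in_ray v0.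
  rewrite innerR// inner// -[LHS]cReMr /laplace_pow mul1r; congr (complex.Re _).
  by move: (cpow _ _) (eulerGamma _) (_%:C) => p q r; ring.
transitivity (\int[mu]_(u in `]0, +oo[) (Im (cpow u (- z)) / (1 + u))).
  by apply: eq_Rintegral => u _; rewrite [LHS]cImMr mulrC.
rewrite ei; apply: eq_Rintegral => v; rewrite inE => /in_ray v0.
rewrite innerI// inner// -[LHS]cImMr /laplace_pow mul1r; congr (complex.Im _).
by move: (cpow _ _) (eulerGamma _) (_%:C) => p q r; ring.
Qed.

End beta_gamma.

(** * From [z] to [z / 2] by rotation of the ray *)

Section duplication.
Variable R : realType.
Notation mu := (@lebesgue_measure R).
Notation intC := (intC mu).
Notation integrableC := (integrableC mu).
Variable z : R[i].
Hypotheses (z0 : 0 < Re z) (z1 : Re z < 1).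

(** [F ds / s] is [s^(- z) ds / (1 + s)], the Beta integrand continued off the real ray. It is used
    for [|t| <= pi / 2], away from the pole [-1]. *)
Let Q (u t : R) : R[i] := (1 + spow 1 u t)^-1.
Let F (u t : R) : R[i] := spow (1 - z) u t * Q u t.
Let K : R := expR (pi * `|Im z|).

Let polar_holo_F : exists Fd, polar_holo (- pi) pi F Fd.
Proof.
eexists; apply: polar_holoM; first exact: polar_holo_spow.
apply: polar_holoV; first exact: onePspow1_neq0.
by apply: polar_holoD; [exact: polar_holo_cst|exact: polar_holo_spow].
Qed.

Let pi2 : 0 < pi / 2 :> R. Proof. by rewrite divr_gt0 ?pi_gt0. Qed.

Let cosge0 (t : R) : - (pi / 2) <= t <= pi / 2 -> 0 <= cos t.
Proof. by move=> h; apply: cos_ge0_pihalf. Qed.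

Let abspi (t : R) : - (pi / 2) <= t <= pi / 2 -> `|t| <= pi.
Proof. by have := pi2; move=> p /andP[a b]; rewrite ler_norml; apply/andP; split; lra. Qed.

Let Q_le u t : 0 < u -> - (pi / 2) <= t <= pi / 2 -> normc (Q u t) <= 2 / (1 + u).
Proof.
move=> u0 tp; rewrite /Q normcV.
have h := normc_onePspow1 u0 (cosge0 tp).
have u1 : 0 < (1 + u) / 2 by rewrite divr_gt0// addr_gt0.
rewrite -[2 / (1 + u)]invf_div lef_pV2 ?posrE//; exact: lt_le_trans h.
Qed.

(** It behaves like [u^(1 - Re z)] at [0] and like [u^(- Re z)] at infinity, so [0 < Re z < 1] makes
    it vanish at both ends. *)
Let eta (u : R) := 2 * K * (u `^ (1 - Re z) / (1 + u)).

Let F_le u t : 0 < u -> - (pi / 2) <= t <= pi / 2 -> normc (F u t) <= eta u.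
Proof.
move=> u0 tp; rewrite /F normcM.
have h1 := normc_spow_le (1 - z) u0 (abspi tp).
rewrite cReD cImD cReN cImN Re1 Im1 sub0r normrN in h1.
have h2 := Q_le u0 tp.
apply: le_trans (ler_pM (normc_ge0 _) (normc_ge0 _) h1 h2) _.
by rewrite /eta /K le_eqVlt; apply/orP; left; apply/eqP; ring.
Qed.

Let sliceE u t : 0 < u ->
  (u^-1)%:C * F u t = cexp ('i * t%:C * (1 - z)) * (cpow u (- z) * Q u t).
Proof.
move=> u0; rewrite /F spowE cpowD cpowr1// fmorphV /=.
have uC : u%:C != 0 :> R[i] by rewrite eq_complex /= gt_eqF.
by field.
Qed.

Let slice_integrable t : - (pi / 2) <= t <= pi / 2 ->
  integrableC `]0, +oo[ (fun u => cpow u (- z) * Q u t).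
Proof.
move=> tp; have [c1 c0] : -1 < - Re z /\ - Re z < 0 by move: z0 z1 => a b; split; lra.
have mp : measurable_fun (`]0, +oo[%classic : set R) (fun u : R => u `^ (- Re z)).
  by apply: measurable_funTS; exact: measurable_powR.
have powc (u : R) : 0 < u -> `|u `^ (- Re z)| <= u `^ (- Re z).
  by rewrite ger0_norm// powR_ge0.
have [i _] := fubini_laplace c1 c0 mp powc.
have j : mu.-integrable `]0, +oo[ (EFin \o (fun u => 2 * (u `^ (- Re z) / (1 + u)))).
  exact: (integrableZl _ 2 i).
apply: (integrableC_domin _ _ j) => //.
  apply: measurableC_ray => u u0; apply: ccvgM; first exact: continuousC_cpow.
  have [Fd h] : exists Fd, polar_holo (- pi) pi (fun u t : R => 1 + spow 1 u t) Fd.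
    by eexists; apply: polar_holoD; [exact: polar_holo_cst|exact: polar_holo_spow].
  have tpi : - pi < t < pi.
    by have := pi2; move: tp => /andP[a b] p; apply/andP; split; lra.
  apply: ccvgV; first exact: onePspow1_neq0.
  exact: polar_holo_cont_l h u0 tpi.
move=> u /in_ray u0; rewrite normcM normc_cpow// cReN.
rewrite [leRHS]mulrCA; apply: ler_wpM2l; first exact: powR_ge0.
exact: Q_le.
Qed.

Let eta0 : eta n.+1%:R^-1 @[n --> \oo] --> 0.
Proof.
have p : 0 < 1 - Re z by rewrite subr_gt0.
have h := powRr_cvg0 p (fun n => _) (@cvg_invnS R).
have h' : 2 * K * n.+1%:R^-1 `^ (1 - Re z) @[n --> \oo] --> 0.
  rewrite -[X in _ --> X](mulr0 (2 * K)); apply: cvgM; first exact: cvg_cst.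
  by apply: h => n; rewrite invr_gt0.
apply: squeeze_cvgr h'; last exact: (cvg_cst (0 : R)).
apply: nearW => n; rewrite /eta.
have K0 : 0 <= 2 * K by rewrite mulr_ge0// expR_ge0.
apply/andP; split; first by rewrite mulr_ge0// divr_ge0 ?powR_ge0// addr_ge0// ltW.
rewrite ler_wpM2l// ler_piMr ?powR_ge0// invf_le1 ?lerDl ?ltW// addr_gt0//.
Qed.

Let etay : eta n.+1%:R @[n --> \oo] --> 0.
Proof.
have h := powRr_cvg0 z0 (fun n => _) (@cvg_invnS R).
have h' : 2 * K * n.+1%:R^-1 `^ (Re z) @[n --> \oo] --> 0.
  rewrite -[X in _ --> X](mulr0 (2 * K)); apply: cvgM; first exact: cvg_cst.
  by apply: h => n; rewrite invr_gt0.
apply: squeeze_cvgr h'; last exact: (cvg_cst (0 : R)).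
apply: nearW => n; rewrite /eta.
have K0 : 0 <= 2 * K by rewrite mulr_ge0// expR_ge0.
apply/andP; split; first by rewrite mulr_ge0// divr_ge0 ?powR_ge0// addr_ge0// ltW.
rewrite ler_wpM2l// ler_pdivrMr ?addr_gt0//.
have -> : n.+1%:R^-1 `^ Re z = (n.+1%:R `^ Re z)^-1.
  by rewrite -[n.+1%:R^-1]powR_inv1// -powRrM mulN1r powRN.
rewrite powRB ?pnatr_eq0 ?implybT// powRr1// mulrC.
by rewrite ler_wpM2l ?invr_ge0 ?powR_ge0// lerDr.
Qed.

Let B := intC `]0, +oo[ (fun u => cpow u (- z) * Q u 0).

Let rotate t : - (pi / 2) <= t <= pi / 2 ->
  B = cexp ('i * t%:C * (1 - z)) * intC `]0, +oo[ (fun u => cpow u (- z) * Q u t).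
Proof.
move=> tp; have [Fd hF] := polar_holo_F.
have z_t : - (pi / 2) <= (0 : R) <= pi / 2 by have := pi2; move=> p; apply/andP; split; lra.
have slice s : - (pi / 2) <= s <= pi / 2 ->
  intC `]0, +oo[ (fun u => (u^-1)%:C * F u s) =
  cexp ('i * s%:C * (1 - z)) * intC `]0, +oo[ (fun u => cpow u (- z) * Q u s).
  move=> sp; rewrite -intCMl//; last exact: slice_integrable.
  by apply: eq_intC => u /in_ray u0; rewrite sliceE.
have islice s : - (pi / 2) <= s <= pi / 2 ->
  integrableC `]0, +oo[ (fun u => (u^-1)%:C * F u s).
  move=> sp; have i := slice_integrable sp.
  have {}i : integrableC `]0, +oo[ (fun u =>
      cexp ('i * s%:C * (1 - z)) * (cpow u (- z) * Q u s)) by exact: integrableCMl.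
  by apply: eq_integrableC i => // u /in_ray u0; rewrite sliceE.
have p : (- pi : R) < - (pi / 2) /\ (pi / 2 : R) < pi by have := pi2; move=> p; split; lra.
case: p => p1 p2; move: (tp) => /andP[ta tb].
rewrite -slice//; have -> : B = intC `]0, +oo[ (fun u => (u^-1)%:C * F u 0).
  by rewrite slice// mulr0 mul0r cexp0 mul1r.
(* [polar_cauchy_rays] takes its two angles in increasing order, hence the two cases. *)
have [t0|/ltW t0] := leP 0 t.
  apply: (@polar_cauchy_rays _ (- pi) pi F Fd 0 t hF _ t0 _ eta) => //; try exact: islice.
  - by rewrite oppr_lt0 pi_gt0.
  - exact: le_lt_trans p2.
  - move=> u s u0 /andP[s0 st]; apply: F_le => //; apply/andP; split; lra.
apply/esym; apply: (@polar_cauchy_rays _ (- pi) pi F Fd t 0 hF _ t0 _ eta) => //; try exact: islice.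
- exact: lt_le_trans ta.
- by rewrite pi_gt0.
- move=> u s u0 /andP[s0 st]; apply: F_le => //; apply/andP; split; lra.
Qed.

Let Qpi2 u : 0 < u -> Q u (pi / 2) = (1 + 'i * u%:C)^-1.
Proof.
move=> u0; congr (_^-1); congr (_ + _); apply: complex_eq.
  by rewrite Re_spow1// cos_pihalf mulr0 !reimE; ring.
by rewrite Im_spow1// sin_pihalf mulr1 !reimE; ring.
Qed.

Let QNpi2 u : 0 < u -> Q u (- (pi / 2)) = (1 - 'i * u%:C)^-1.
Proof.
move=> u0; congr (_^-1); congr (_ + _); apply: complex_eq.
  by rewrite Re_spow1// cosN cos_pihalf mulr0 !reimE; ring.
by rewrite Im_spow1// sinN sin_pihalf !reimE; ring.
Qed.

Let Q0 u : 0 < u -> Q u 0 = ((1 + u)^-1)%:C.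
Proof.
move=> u0; rewrite fmorphV rmorphD rmorph1; congr (_^-1); congr (_ + _); apply: complex_eq.
  by rewrite Re_spow1// cos0 mulr1.
by rewrite Im_spow1// sin0 mulr0.
Qed.

(* Rotating the ray of [beta_gamma] to the two halves of the imaginary axis and
   subtracting leaves [u^(-z) u / (1 + u^2)], that is [beta_integrand (z / 2)]
   after [u^2 = v]. *)
Lemma beta_duplication :
  eulerGamma (z / 2) * eulerGamma (1 - z / 2) =
  (cexp ('i * (pi / 2)%:C * z) + cexp (- ('i * (pi / 2)%:C * z))) *
  (eulerGamma z * eulerGamma (1 - z)).
Proof.
have BE : B = eulerGamma z * eulerGamma (1 - z).
  have [_ <-] := beta_gamma z0 z1; apply: eq_intC => u /in_ray u0.
  by rewrite Q0// mulrC.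
have [p m] : - (pi / 2) <= (pi / 2 : R) <= pi / 2 /\ - (pi / 2) <= (- (pi / 2) : R) <= pi / 2.
  by have := pi2; move=> p; split; apply/andP; split; lra.
have Re2 : Re (z / 2) = Re z / 2.
  rewrite (_ : z / 2 = (2^-1)%:C * z) ?cReMr; first by rewrite mulrC.
  by rewrite fmorphV rmorph_nat mulrC.
have [h1 h2] : 0 < Re (z / 2) /\ Re (z / 2) < 1 by rewrite Re2; move: z0 z1 => a b; split; lra.
have [i2 E2] := beta_gamma h1 h2.
have rp := rotate p; have rm := rotate m.
set E := cexp ('i * (pi / 2)%:C * (1 - z)) in rp.
have E0 : E != 0 by exact: cexp_neq0.
have Em : cexp ('i * (- (pi / 2))%:C * (1 - z)) = E^-1.
  by rewrite -cexpN rmorphN mulrN mulNr.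
rewrite Em in rm.
set Ip := intC _ _ in rp; set Im' := intC _ _ in rm.
(* [1/(1 + i u) - 1/(1 - i u) = - 2 i u / (1 + u^2)], and [2 u du] is the differential of
   [v = u^2]. *)
have sq u : 0 < u -> cpow u (- z) * Q u (pi / 2) - cpow u (- z) * Q u (- (pi / 2)) =
   - 'i * ((2 * u)%:C * beta_integrand (z / 2) (u ^+ 2)).
  move=> u0; rewrite Qpi2// QNpi2// /beta_integrand.
  have -> : cpow (u ^+ 2) (- (z / 2)) = cpow u (- z).
    rewrite expr2 cpowM// -cpowD; congr cpow.
    by rewrite -opprD -splitr.
  have n1 : 1 + 'i * u%:C != 0.
    by rewrite eq_complex !reimE !(mul0r, mul1r, mulr0, subr0, addr0, add0r) oner_eq0.
  have n2 : 1 - 'i * u%:C != 0.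
    by rewrite eq_complex !reimE !(mul0r, mul1r, mulr0, subr0, addr0, add0r, oppr0) oner_eq0.
  have -> : ((1 + u ^+ 2)^-1)%:C = ((1 + 'i * u%:C) * (1 - 'i * u%:C))^-1.
    rewrite fmorphV; congr (_^-1); rewrite rmorphD rmorph1 rmorphXn /=.
    rewrite -[RHS]/((1 + 'i * u%:C) * (1 - 'i * u%:C)).
    have -> : (1 + 'i * u%:C) * (1 - 'i * u%:C) = 1 - ('i * 'i) * u%:C ^+ 2 by ring.
    by rewrite ii mulN1r opprK.
  rewrite rmorphM rmorph_nat; move: (cpow u (- z)) => w.
  by field; rewrite n1 n2.
have ii' : 'i * 'i = -1 :> R[i] by exact: ii.
have diff : Ip - Im' = - 'i * (eulerGamma (z / 2) * eulerGamma (1 - z / 2)).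
  have iq : integrableC `]0, +oo[ (fun u => (2 * u)%:C * beta_integrand (z / 2) (u ^+ 2)).
    have d1 : integrableC `]0, +oo[ (fun u =>
        cpow u (- z) * Q u (pi / 2) - cpow u (- z) * Q u (- (pi / 2))).
      by apply: integrableCB => //; exact: slice_integrable.
    have d2 : integrableC `]0, +oo[ (fun u =>
        'i * (cpow u (- z) * Q u (pi / 2) - cpow u (- z) * Q u (- (pi / 2)))).
      exact: integrableCMl.
    apply: eq_integrableC d2 => // u /in_ray u0; rewrite sq//.
    by rewrite mulrA mulrN ii' opprK mul1r.
  rewrite -E2 (intC_square _ i2 iq); last by move=> u; exact: continuousC_beta.
  rewrite -intCMl// -intCB//; try exact: slice_integrable.
  by apply: eq_intC => u /in_ray u0; rewrite sq.
(* With [w = e^(- i pi z / 2)] the rotation factors are [i w] and its inverse [- i / w]; subtracting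
   the two rotated integrals leaves [w + 1/w], which is [2 cos (pi z / 2)]. *)
have Ew : E = 'i * cexp (- ('i * (pi / 2)%:C * z)).
  rewrite /E mulrBr mulr1 cexpD; congr (_ * _).
  apply: complex_eq; rewrite ?Re_cexp ?Im_cexp !reimE
    !(mul0r, mul1r, mulr0, subr0, addr0, add0r) expR0 ?cos_pihalf ?sin_pihalf ?mulr1 ?mulr0//.
set w := cexp (- _) in Ew *.
have -> : cexp ('i * (pi / 2)%:C * z) = w^-1 by rewrite /w cexpN invrK.
rewrite -BE.
have -> : eulerGamma (z / 2) * eulerGamma (1 - z / 2) = 'i * (Ip - Im').
  by rewrite diff mulrA mulrN ii' opprK mul1r.
have -> : Ip = B / E by rewrite rp mulrC mulKf.
have -> : Im' = B * E by rewrite rm mulrAC mulVf// mul1r.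
rewrite Ew; have := ii'; move: i_neq0 => /(_ R); move: ('i : R[i]) => j j0 jj.
have -> : (j * w)^-1 = - j * w^-1.
  by rewrite invfM; congr (_ * _); apply: (mulfI j0); rewrite mulfV// mulrN jj opprK.
have -> : j * (B * (- j * w^-1) - B * (j * w)) = - (j * j) * ((w^-1 + w) * B) by ring.
by rewrite jj opprK mul1r.
Qed.

End duplication.

(** * Euler's reflection formula *)

Section reflection_formula.
Variable R : realType.
Implicit Types (z : R[i]).

Lemma isd_cvg_seq (f : R -> R[i]) (x : R) (d : R[i]) (tau : nat -> R) :
  isd f x d -> (forall n, tau n != 0) -> tau n @[n --> \oo] --> 0 ->
  ccvg \oo (fun n => ((tau n)^-1)%:C * (f (tau n + x) - f x)) d.
Proof.
have h (g : R -> R) (e : R) : is_derive x 1 g e -> (forall n, tau n != 0) ->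
    tau n @[n --> \oo] --> 0 ->
    (tau n)^-1 * (g (tau n + x) - g x) @[n --> \oo] --> e.
  move=> [ex <-] t0 tcvg.
  have /cvgr_dnbhsP := ex; move=> /(_ tau (conj t0 tcvg)).
  rewrite /derive; under [X in X @ _ --> _ -> _]eq_fun do rewrite /= /GRing.scale /= mulr1.
  by [].
move=> [d1 d2] t0 tcvg; split.
  under eq_fun do rewrite cReMr cReD cReN; exact: (h (fun t => Re (f t))).
under eq_fun do rewrite cImMr cImD cImN; exact: (h (fun t => Im (f t))).
Qed.

Lemma csinE z : csin z = (cexp ('i * z) - cexp (- ('i * z))) / (2 * 'i).
Proof. by []. Qed.

(** The factor [2 cos (pi z / 2)] is kept as a sum of exponentials, the form in which
    [beta_duplication] produces it. *)
Lemma csin_double z : csin (pi%:C * z) =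
  (cexp ('i * (pi / 2)%:C * z) + cexp (- ('i * (pi / 2)%:C * z))) * csin (pi%:C * (z / 2)).
Proof.
rewrite !csinE.
have -> : 'i * (pi%:C * (z / 2)) = 'i * (pi / 2)%:C * z.
  by rewrite rmorphM fmorphV rmorph_nat; ring.
have -> : 'i * (pi%:C * z) = ('i * (pi / 2)%:C * z) *+ 2.
  by rewrite rmorphM fmorphV rmorph_nat; field.
rewrite -mulNrn !cexpMn; move: (cexp _) (cexp _) ((2 * 'i)^-1) => p q r; ring.
Qed.

Let refl z := csin (pi%:C * z) * (eulerGamma z * eulerGamma (1 - z)).

Let refl_half z : 0 < Re z -> Re z < 1 -> refl (z / 2) = refl z.
Proof.
move=> z0 z1; rewrite /refl beta_duplication// (csin_double z).
by move: (cexp _ + _) (csin _) (eulerGamma _ * _) => p q r; ring.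
Qed.

Let wn z n : R[i] := (2^-1 ^+ n)%:C * z.

Let Re_wn z n : 0 < Re z -> 0 < Re (wn z n) /\ Re (wn z n) <= Re z.
Proof.
move=> z0; rewrite cReMr; split; first by rewrite mulr_gt0// exprn_gt0.
by rewrite ler_piMl ?(ltW z0)// exprn_ile1//; lra.
Qed.

Let refl_wn z n : 0 < Re z -> Re z < 1 -> refl (wn z n) = refl z.
Proof.
move=> z0 z1; elim: n => [|n IH]; first by rewrite /wn expr0 mul1r.
have [w0 w1] := Re_wn n z0.
rewrite -IH -(refl_half w0) ?(le_lt_trans w1)//; congr refl.
by rewrite /wn exprSr rmorphM fmorphV rmorph_nat; ring.
Qed.

Let half_cvg : (2^-1 ^+ n : R) @[n --> \oo] --> 0.
Proof. by apply: cvg_expr; rewrite ger0_norm; lra. Qed.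

Let wn_cvg z : ccvg \oo (wn z) 0.
Proof.
rewrite -(mul0r z); apply: ccvgM; last exact: ccvg_cst.
by rewrite -(rmorph0 (real_complex R)); apply: ccvg_real; exact: half_cvg.
Qed.

(** These are the difference quotients at [t = 0] of [sin (pi z t)] along [t = 2^(- n)]. *)
Let csin_cvg z : ccvg \oo (fun n => csin (pi%:C * wn z n) / (2^-1 ^+ n)%:C) (pi%:C * z).
Proof.
have e (c : R[i]) : isd (fun t : R => cexp (c * t%:C)) 0 c.
  have h : isd (fun t => c * t%:C) 0 (c * 1%:C).
    by apply: isdMl; apply: isd_real; exact: is_derive_id.
  by apply: (isd_eq (isd_cexp h)); rewrite rmorph1 rmorph0 mulr0 cexp0 !mulr1.
have n0 n : 2^-1 ^+ n != 0 :> R by rewrite expf_neq0// invr_eq0.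
have d := isdD (e ('i * (pi%:C * z))) (isdN (e (- ('i * (pi%:C * z))))).
have := isd_cvg_seq d n0 half_cvg => L.
have {}L := ccvgM L (ccvg_cst (2 * 'i)^-1).
have E : ('i * (pi%:C * z) + - - ('i * (pi%:C * z))) * (2 * 'i)^-1 = pi%:C * z.
  by have := @i_neq0 R; move: ('i) => j j0; field.
rewrite -E; apply: ccvg_near_eq (L _ _); apply: nearW => n.
have -> : csin (pi%:C * wn z n) = (cexp ('i * (pi%:C * z) * (2^-1 ^+ n)%:C) -
    cexp (- ('i * (pi%:C * z)) * (2^-1 ^+ n)%:C)) / (2 * 'i).
  rewrite csinE /wn; move: ((2^-1 ^+ n)%:C) (pi%:C : R[i]) (2 * 'i : R[i]) => t p q.
  by congr ((cexp _ - cexp _) / _); ring.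
rewrite addr0 rmorph0 !mulr0 cexp0 subrr subr0 fmorphV.
by move: (cexp _) (cexp _) ((2 * 'i)^-1) ((_%:C)^-1) => p q r s; ring.
Qed.

(* [sin (pi z) Gamma(z) Gamma(1 - z)] is invariant under [z -> z / 2], and tends
   to [pi] along the halvings. *)
Lemma eulerGamma_reflection z : 0 < Re z -> Re z < 1 ->
  csin (pi%:C * z) * (eulerGamma z * eulerGamma (1 - z)) = pi%:C.
Proof.
move=> z0 z1; rewrite -/(refl z).
have zn0 : z != 0 by apply/eqP => h; move: z0; rewrite h ltxx.
have n0 n : (2^-1 ^+ n)%:C != 0 :> R[i].
  by rewrite eq_complex /= negb_and expf_neq0// invr_eq0.
(* [Gamma(w)] is unbounded as [w] tends to [0]. The limit is therefore taken of [sin (pi w) / w] and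
   of [Gamma(w + 1) = w Gamma(w)], each of which has one. *)
have c1 : ccvg \oo (fun n => eulerGamma (wn z n + 1)) (eulerGamma (0 + 1)).
  apply: (@eulerGamma_cvg R _ _ 1 2) => //.
    move=> n; have [w0 w1] := Re_wn n z0; rewrite cReD Re1; apply/andP; split; lra.
  by apply: ccvgD (wn_cvg z) _; exact: ccvg_cst.
have c2 : ccvg \oo (fun n => eulerGamma (1 - wn z n)) (eulerGamma (1 - 0)).
  apply: (@eulerGamma_cvg R _ _ (1 - Re z) 1); first by rewrite subr_gt0.
    move=> n; have [w0 w1] := Re_wn n z0; rewrite cReD cReN Re1; apply/andP; split; lra.
  by apply: ccvgB _ (wn_cvg z); exact: ccvg_cst.
rewrite add0r in c1; rewrite subr0 in c2; rewrite eulerGamma1 in c1 c2.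
have L := ccvgM (ccvgM (csin_cvg z) (ccvgM c1 c2)) (ccvg_cst z^-1).
have {}L : ccvg \oo (fun=> refl z) pi%:C.
  rewrite (_ : pi%:C = pi%:C * z * (1 * 1) * z^-1); last by field.
  apply: ccvg_near_eq (L _ _ _ _); apply: nearW => n.
  rewrite -(refl_wn n z0 z1) /refl.
  have -> : eulerGamma (wn z n + 1) = (2^-1 ^+ n)%:C * z * eulerGamma (wn z n).
    by rewrite eulerGammaS//; case: (Re_wn n z0).
  move: (n0 n); move: (csin _) (eulerGamma _) (eulerGamma _) ((2^-1 ^+ n)%:C).
  by move=> p q r s s0; field; rewrite zn0.
exact: (ccvg_unique (ccvg_cst _) L).
Qed.

End reflection_formula.

(** * Hankel's integral for 1 / Gamma *)

Section hankel.
Variable R : realType.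
Notation mu := (@lebesgue_measure R).
Notation intC := (intC mu).
Notation integrableC := (integrableC mu).
Implicit Types (z c : R[i]) (u t : R) (F : R -> R -> R[i]).

(* The integral of [F(s) ds / s], [s = u e^(i t)], along the lower side of the
   cut from [- oo] to [- r], once around the circle of radius [r], and back
   along the upper side. *)
Definition hankel (r : R) F : R[i] :=
  intC `]r, +oo[ (fun u => (u^-1)%:C * (F u pi - F u (- pi))) +
  'i * intC `[- pi, pi] (F r).

(* [e^s s^c] at [s = u e^(i t)]. *)
Definition esp c u t : R[i] := cexp (spow 1 u t) * spow c u t.

Lemma spow1_pi u : 0 < u -> spow 1 u pi = (- u)%:C.
Proof.
move=> u0; apply: complex_eq.
  by rewrite Re_spow1// cospi mulrN1.
by rewrite Im_spow1// sinpi mulr0.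
Qed.

Lemma spow1_Npi u : 0 < u -> spow 1 u (- pi) = (- u)%:C.
Proof.
move=> u0; apply: complex_eq.
  by rewrite Re_spow1// cosN cospi mulrN1.
by rewrite Im_spow1// sinN sinpi oppr0 mulr0.
Qed.

Lemma esp_pi c u : 0 < u -> esp c u pi = laplace_pow c 1 u * cexp ('i * pi%:C * c).
Proof.
move=> u0; rewrite /esp spow1_pi// spowE cexp_real /laplace_pow mul1r.
by rewrite mulrA; congr (_ * _); rewrite mulrC.
Qed.

Lemma esp_Npi c u : 0 < u -> esp c u (- pi) = laplace_pow c 1 u * cexp (- ('i * pi%:C * c)).
Proof.
move=> u0; rewrite /esp spow1_Npi// spowE cexp_real /laplace_pow mul1r.
rewrite mulrA [X in X * _ = _]mulrC; congr (_ * cexp _).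
by rewrite rmorphN mulrN mulNr.
Qed.

Lemma normc_esp c u t : 0 < u -> `|t| <= pi ->
  normc (esp c u t) <= expR u * (u `^ (Re c) * expR (pi * `|Im c|)).
Proof.
move=> u0 tpi; rewrite normcM normc_cexp; apply: ler_pM.
- exact: expR_ge0.
- exact: normc_ge0.
- by rewrite Re_spow1// ler_expR ler_piMr ?(ltW u0)// cos_le1.
- exact: normc_spow_le.
Qed.

Lemma laplace_powMinv c u : 0 < u -> (u^-1)%:C * laplace_pow c 1 u = laplace_pow (c - 1) 1 u.
Proof.
by move=> u0; rewrite /laplace_pow cpowD cpowN cpowr1// fmorphV mulrA [X in X * _ = _]mulrC.
Qed.

Lemma polar_holo_esp m M c : polar_holo m M (esp c)
  (fun u t => (u^-1)%:C * (esp (c + 1) u t + c * esp c u t)).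
Proof.
have h := polar_holoM (polar_holo_cexp (@polar_holo_spow R m M 1)) (@polar_holo_spow R m M c).
apply: (polar_holo_eq h) => //; apply/funext => u; apply/funext => t.
rewrite /esp spowD mul1r.
by move: (cexp (spow 1 u t)) (spow c u t) (spow 1 u t) (_%:C) => p q r s; ring.
Qed.

(** Away from [0] every exponent is allowed: [u^(Re c)] is at most a constant plus [u^|Re c|]. *)
Lemma integrableC_laplace_ray c (r y : R) : 0 < r -> 0 < y ->
  integrableC `]r, +oo[ (laplace_pow c y).
Proof.
move=> r0 y0; pose a := `|Re c|.
have a1 : -1 < a by rewrite (lt_le_trans (ltrN10 R))// normr_ge0.
have i0 := @integrable_powR_exp R 0 y (ltrN10 R) y0.
have i1 := integrable_powR_exp a1 y0.
have sub : `]r, +oo[%classic `<=` (`]0, +oo[%classic : set R).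
  by move=> x; rewrite /= !in_itv /= !andbT; exact: lt_trans.
have i2 : mu.-integrable `]r, +oo[ (EFin \o (fun u =>
    r `^ (- a) * (u `^ 0 * expR (- (y * u))) + u `^ a * expR (- (y * u)))).
  apply: (@integrableS _ _ _ mu _ _ _ _ _ sub) => //.
  exact: (integrableD _ (integrableZl _ (r `^ (- a)) i0) i1).
apply: (integrableC_domin _ _ i2) => //.
  by apply: measurableC_ray => u ru; apply: continuousC_laplace_pow; exact: lt_trans ru.
move=> u /in_ray ru; have u0 := lt_trans r0 ru.
rewrite normc_laplace_pow// powRr0 mul1r -mulrDl ler_wpM2r ?expR_ge0//.
apply: le_trans (@powR_le_sum _ u (- a) (Re c) a u0 _ _) _.
- by rewrite lerNl /a -normrN ler_norm.
- exact: ler_norm.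
rewrite lerD2r !powRN lef_pV2 ?posrE ?powR_gt0//.
by apply: ge0_ler_powR; rewrite ?nnegrE ?normr_ge0 ?ltW.
Qed.

(** This is [2 i sin (pi c)], the jump of [s^c] across the cut at modulus [1]. *)
Definition kappa c : R[i] := cexp ('i * pi%:C * c) - cexp (- ('i * pi%:C * c)).

Lemma esp_cutE c u : 0 < u ->
  (u^-1)%:C * (esp c u pi - esp c u (- pi)) = kappa c * laplace_pow (c - 1) 1 u.
Proof.
move=> u0; rewrite esp_pi// esp_Npi// -laplace_powMinv// /kappa.
by move: (cexp _) (cexp _) (laplace_pow _ _ _) (_%:C) => p q r s; ring.
Qed.

Lemma integrableC_esp_cut c r : 0 < r ->
  integrableC `]r, +oo[ (fun u => (u^-1)%:C * (esp c u pi - esp c u (- pi))).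
Proof.
move=> r0; have i := integrableC_laplace_ray (c - 1) r0 (@ltr01 R).
have j : integrableC `]r, +oo[ (fun u => kappa c * laplace_pow (c - 1) 1 u).
  exact: integrableCMl.
by apply: eq_integrableC j => // u /in_ray ru; rewrite esp_cutE//; exact: lt_trans ru.
Qed.

Lemma hankel_esp c r : 0 < r -> hankel r (esp c) =
  kappa c * intC `]r, +oo[ (laplace_pow (c - 1) 1) + 'i * intC `[- pi, pi] (esp c r).
Proof.
move=> r0; congr (_ + _); rewrite -intCMl//; last exact: integrableC_laplace_ray.
by apply: eq_intC => u /in_ray ru; rewrite esp_cutE//; exact: lt_trans ru.
Qed.

(* Hankel's integral for [1 / Gamma(z)]; see [rGammaE]. *)
Definition recip z : R[i] := hankel 1 (esp (1 - z)) / (2 * 'i * pi%:C).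

Let pipos : 0 < pi :> R := @pi_gt0 R.
Let Npipi : - pi <= pi :> R. Proof. by rewrite ge0_cp ?pi_ge0. Qed.
(** Cauchy's theorem asks for a sector strictly larger than [|t| <= pi]. Since [esp] is holomorphic
    at every angle, [|t| < 2 pi] serves. *)
Let mNpi : - (2 * pi) < - pi :> R. Proof. by rewrite ltrN2 ltr_pMl// ltr1n. Qed.
Let piM : pi < 2 * pi :> R. Proof. by rewrite ltr_pMl// ltr1n. Qed.

Lemma hankel_esp_indep c r : 1 <= r -> hankel r (esp c) = hankel 1 (esp c).
Proof.
move=> r1; apply/esym.
have h := polar_cauchy_shift (@polar_holo_esp (- (2 * pi)) (2 * pi) c) mNpi Npipi piM
  ltr01 r1 (integrableC_esp_cut c ltr01).
exact: h.
Qed.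

Lemma continuousC_esp c u t : 0 < u -> continuousC (esp c u) t.
Proof.
move=> u0; pose M := `|t| + 1.
have tM : - M < t < M by rewrite -ltr_norml ltrDl.
exact: polar_holo_cont_r (@polar_holo_esp (- M) M c) u0 tM.
Qed.

Lemma recip_collapse z : Re z < 1 ->
  recip z = csin (pi%:C * z) / pi%:C * eulerGamma (1 - z).
Proof.
move=> z1; rewrite /recip.
pose c := 1 - z.
have c0 : 0 < Re c by rewrite cReD cReN Re1 subr_gt0.
have c1 : -1 < Re (c - 1) by rewrite cReD cReN Re1; lra.
have i : integrableC `]0, +oo[ (fun u => (u^-1)%:C * (esp c u pi - esp c u (- pi))).
  have j : integrableC `]0, +oo[ (fun u => kappa c * laplace_pow (c - 1) 1 u).
    by apply: integrableCMl => //; exact: integrableC_laplace_pow.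
  by apply: eq_integrableC j => // u /in_ray ru; rewrite esp_cutE.
pose K := expR (1 : R) * expR (pi * `|Im c|).
pose eta (u : R) := K * u `^ (Re c).
have etaP u s : 0 < u -> u <= 1 -> - pi <= s <= pi -> normc (esp c u s) <= eta u.
  move=> u0 u1; rewrite -ler_norml => sp; apply: le_trans (normc_esp c u0 sp) _.
  rewrite /eta /K mulrCA [leRHS]mulrC ler_wpM2l ?powR_ge0//.
  by rewrite ler_wpM2r ?expR_ge0// ler_expR.
have eta0 : eta n.+1%:R^-1 @[n --> \oo] --> 0.
  rewrite -(mulr0 K); apply: cvgM; first exact: cvg_cst.
  apply: powRr_cvg0 => //; last exact: cvg_invnS.
have h : hankel 1 (esp c) = intC `]0, +oo[ (fun u => (u^-1)%:C * (esp c u pi - esp c u (- pi))).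
  exact: (polar_cauchy_collapse (@polar_holo_esp (- (2 * pi)) (2 * pi) c) mNpi Npipi piM
  ltr01 i etaP eta0).
rewrite h (_ : intC _ _ = kappa c * eulerGamma c); last first.
  rewrite eulerGammaE -intCMl//; last exact: integrableC_laplace_pow.
  by apply: eq_intC => u /in_ray u0; rewrite esp_cutE.
(* [e^(i pi) = -1] turns the jump of [s^(1 - z)] into [2 i sin (pi z)]. *)
have -> : kappa c = 2 * 'i * csin (pi%:C * z).
  rewrite csinE ['i * (_ * z)]mulrA /kappa.
  have k1 : cexp ('i * pi%:C * c) = - (cexp ('i * pi%:C * z))^-1.
    by rewrite /c mulrBr mulr1 cexpD cexp_ipi mulN1r cexpN.
  rewrite [cexp (- ('i * pi%:C * c))]cexpN k1 [cexp (- _)]cexpN invrN invrK opprK.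
  have := cexp_neq0 ('i * pi%:C * z); move: (cexp _) => p p0.
  have := @i_neq0 R; move: ('i : R[i]) => j j0.
  by field; rewrite p0 j0.
have p0 : pi%:C != 0 :> R[i] by rewrite eq_complex /= negb_and gt_eqF.
have := @i_neq0 R.
move: (pi%:C : R[i]) p0 => p' p0.
by move: ('i : R[i]) (csin _) (eulerGamma _) => j p q j0; field; rewrite j0 p0.
Qed.

End hankel.

(** * Hankel's integral equals the entire function [1 / Gamma] *)

Section reciprocal_gamma.
Variable R : realType.
Notation mu := (@lebesgue_measure R).
Notation intC := (intC mu).
Notation integrableC := (integrableC mu).
Implicit Types (z c d : R[i]) (u t : R).

Let Npipi : - pi <= pi :> R. Proof. by rewrite ge0_cp ?pi_ge0. Qed.

Lemma continuousC_cvg (f : R -> R[i]) (x : R) (v : nat -> R) :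
  continuousC f x -> v n @[n --> \oo] --> x -> ccvg \oo (fun n => f (v n)) (f x).
Proof.
move=> [f1 f2] vx; split.
  exact: (@cvg_comp _ _ _ v (fun t => Re (f t)) \oo (nbhs x) _ vx f1).
exact: (@cvg_comp _ _ _ v (fun t => Im (f t)) \oo (nbhs x) _ vx f2).
Qed.

Lemma kappaD1 d : kappa (d + 1) = - kappa d.
Proof.
rewrite /kappa [in X in _ - X]cexpN [in X in _ = - (_ - X)]cexpN.
have -> : cexp ('i * pi%:C * (d + 1)) = - cexp ('i * pi%:C * d).
  by rewrite mulrDr mulr1 cexpD cexp_ipi mulrN1.
by rewrite invrN opprB opprK addrC.
Qed.

(** The form [(e^s s^(d+1) + d e^s s^d) ds / s] is the differential of [e^s s^d], which tends to [0]
    at the far ends of the contour. The boundary values where the rays meet the circle cancel. *)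
Lemma hankel_espD1 d : hankel 1 (esp (d + 1)) + d * hankel 1 (esp d) = 0.
Proof.
rewrite !hankel_esp// kappaD1 addrK.
have i1 := integrableC_laplace_ray d (@ltr01 R) (@ltr01 R).
have i2 := integrableC_laplace_ray (d - 1) (@ltr01 R) (@ltr01 R).
have i3 : integrableC `]1, +oo[ (fun u => d * laplace_pow (d - 1) 1 u) by exact: integrableCMl.
have cesp c t : continuousC (esp c 1) t by exact: continuousC_esp.
have j1 : integrableC `[- pi, pi] (esp (d + 1) 1) by apply: integrableC_itv => t _.
have j2 : integrableC `[- pi, pi] (esp d 1) by apply: integrableC_itv => t _.
have j3 : integrableC `[- pi, pi] (fun t => d * esp d 1 t) by exact: integrableCMl.
have ray : d * intC `]1, +oo[ (laplace_pow (d - 1) 1) - intC `]1, +oo[ (laplace_pow d 1) =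
    - laplace_pow d 1 1.
  rewrite -intCMl// -intCB//.
  rewrite (@intC_FTC_ray R _ (laplace_pow d 1) 1 (laplace_pow d 1 1) 0
    (fun n => 1 + n.+1%:R^-1) (fun n => n.+1%:R)) ?sub0r//.
  - exact: integrableCB.
  - move=> x x1; have x0 := lt_trans ltr01 x1.
    apply: (isd_eq (isd_laplace_pow d 1 x0)).
    by rewrite rmorph1 mul1r.
  - move=> x x1; have x0 := lt_trans ltr01 x1.
    apply: ccvgB; last exact: continuousC_laplace_pow.
    by apply: ccvgM; [exact: ccvg_cst|exact: continuousC_laplace_pow].
  - by move=> n; exact: addV_gt.
  - exact: cvgr_addV.
  - exact: cvgy_natS.
  - by apply: continuousC_cvg; [exact: continuousC_laplace_pow|exact: cvgr_addV].
  - exact: laplace_pow_cvgy.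
have circle : 'i * (intC `[- pi, pi] (esp (d + 1) 1) + d * intC `[- pi, pi] (esp d 1)) =
    kappa d * laplace_pow d 1 1.
  rewrite -intCMl// -intCD// -intCMl//; last exact: integrableCD.
  have -> : intC `[- pi, pi] (fun t => 'i * (esp (d + 1) 1 t + d * esp d 1 t)) =
      esp d 1 pi - esp d 1 (- pi).
    apply: intC_FTC; first exact: Npipi.
      move=> t _; pose M := `|t| + 1.
      have tM : - M < t < M by rewrite -ltr_norml ltrDl.
      have [_ h _ _] := @polar_holo_esp R (- M) M d 1 t ltr01 tM.
      by apply: (isd_eq h); rewrite invr1 rmorph1 mul1r mulr1.
    move=> t _; apply: ccvgM; first exact: ccvg_cst.
    apply: ccvgD; first exact: cesp.
    by apply: ccvgM; [exact: ccvg_cst|exact: cesp].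
  rewrite esp_pi// esp_Npi// /kappa.
  by move: (laplace_pow d 1 1) (cexp _) (cexp _) => p q r; ring.
move: ray circle; move: (intC _ _) (intC _ _) (intC _ _) (intC _ _) => A B P Q.
move: (kappa d) (laplace_pow d 1 1) => k L ray circle.
have -> : - k * P + 'i * B + d * (k * Q + 'i * A) = k * (d * Q - P) + 'i * (B + d * A) by ring.
by rewrite ray circle mulrN addNr.
Qed.

Lemma recipS z : recip z = z * recip (z + 1).
Proof.
rewrite /recip (_ : 1 - z = - z + 1); last by ring.
rewrite (_ : 1 - (z + 1) = - z); last by ring.
have := hankel_espD1 (- z); move=> /eqP; rewrite addr_eq0 => /eqP ->.
by rewrite -mulNr opprK mulrA.
Qed.

Lemma esp_cvg (cn : nat -> R[i]) c u t : ccvg \oo cn c ->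
  ccvg \oo (fun n => esp (cn n) u t) (esp c u t).
Proof.
move=> cc; apply: ccvgM; first exact: ccvg_cst.
by apply: ccvg_cexp; apply: ccvgM => //; exact: ccvg_cst.
Qed.

(** For [Re z >= 0] and [u >= 1], [u^(- Re z) e^(- u)] is at most [e^(- u)]; the bound on [Im z]
    controls the unit circle. Both majorants are uniform in [n]. *)
Lemma recip_cvg (zn : nat -> R[i]) z (Y : R) :
  (forall n, 0 <= Re (zn n)) -> (forall n, `|Im (zn n)| <= Y) -> ccvg \oo zn z ->
  ccvg \oo (fun n => recip (zn n)) (recip z).
Proof.
move=> z0 zY zz; apply: ccvgM; last exact: ccvg_cst.
under eq_fun do rewrite hankel_esp//.
rewrite hankel_esp//.
have cc : ccvg \oo (fun n => 1 - zn n) (1 - z) by apply: ccvgB => //; exact: ccvg_cst.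
apply: ccvgD; apply: ccvgM.
- apply: ccvgB; apply: ccvg_cexp; last apply: ccvgN.
    by apply: ccvgM => //; exact: ccvg_cst.
  by apply: ccvgM => //; exact: ccvg_cst.
- have i0 : mu.-integrable `]1, +oo[ (EFin \o (fun u => u `^ 0 * expR (- (1 * u)))).
    have i := @integrable_powR_exp R 0 1 (ltrN10 R) ltr01.
    apply: (@integrableS _ _ _ mu _ _ _ _ _ _ i) => // x.
    by rewrite /= !in_itv /= !andbT; exact: lt_trans.
  apply: (ccvg_intC _ _ _ i0) => //.
  + move=> n; apply: measurableC_ray => x x1; apply: continuousC_laplace_pow.
    exact: lt_trans x1.
  + move=> x /in_ray x1; apply: ccvgM; last exact: ccvg_cst.
    apply: ccvg_cpow; apply: ccvgB => //; exact: ccvg_cst.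
  + move=> n x /in_ray x1; have x0 := lt_trans ltr01 x1.
    rewrite normc_laplace_pow// ler_wpM2r ?expR_ge0// ler_powR ?(ltW x1)//.
    by rewrite (_ : 1 - zn n - 1 = - zn n) ?cReN ?oppr_le0//; ring.
- exact: ccvg_cst.
- pose K := expR (1 : R) * expR (pi * Y).
  have i0 : mu.-integrable `[- pi, pi] (EFin \o (fun=> K)).
    by apply: integrable_continuous_itv => t _; exact: cst_continuous.
  apply: (ccvg_intC _ _ _ i0) => //.
  + move=> n; apply: measurableC_integrableC => //; apply: integrableC_itv => t _.
    exact: continuousC_esp.
  + by move=> t _; exact: esp_cvg.
  + move=> n t; rewrite /= in_itv /= -ler_norml => tp.
    apply: le_trans (normc_esp _ ltr01 tp) _.
    rewrite powR1 mul1r ler_wpM2l ?expR_ge0// ler_expR ler_wpM2l ?pi_ge0//.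
    by rewrite cImD cImN Im1 sub0r normrN.
Qed.

(** The reflection formula settles [0 < Re z < 1], and the recurrence propagates this, but never
    onto the lines where [Re z] is an integer. The line [Re z = 1] is reached by continuity. *)
Lemma gamma_recip z : 0 < Re z -> eulerGamma z * recip z = 1.
Proof.
have strip (w : R[i]) : 0 < Re w -> Re w < 1 -> eulerGamma w * recip w = 1.
  move=> w0 w1; rewrite recip_collapse//.
  have alg (p s g g' : R[i]) : p != 0 -> s * (g * g') = p -> g * (s / p * g') = 1.
    move=> p0 h; have -> : g * (s / p * g') = (s * (g * g')) / p by field.
    by rewrite h divff.
  have p0 : pi%:C != 0 :> R[i] by rewrite eq_complex /= negb_and gt_eqF ?pi_gt0.
  exact: (alg _ _ _ _ p0 (eulerGamma_reflection w0 w1)).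
(* The shift [1/(n + 2)] keeps [Re (wn n)] in [[1/2, 1)]: inside the open strip and away from
   [0]. *)
have line (w : R[i]) : Re w = 1 -> eulerGamma w * recip w = 1.
  move=> w1; pose wn n := w - (n.+2%:R^-1)%:C.
  have n2 n : 0 < (n.+2%:R^-1 : R) <= 2^-1.
    by rewrite invr_gt0 ltr0n /= lef_pV2 ?posrE// ler_nat.
  have Rw n : Re (wn n) = 1 - n.+2%:R^-1 by rewrite cReD cReN w1.
  have wcvg : ccvg \oo wn w.
    rewrite -[X in ccvg _ _ X]subr0; apply: ccvgB; first exact: ccvg_cst.
    rewrite -(rmorph0 (real_complex R)); apply: ccvg_real.
    rewrite (_ : (fun n => n.+2%:R^-1) = (fun n => (n + 1).+1%:R^-1)); last first.
      by apply/funext => n; rewrite addn1.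
    by rewrite (cvg_shiftn 1 (fun n => n.+1%:R^-1 : R)); exact: cvg_invnS.
  have c1 : ccvg \oo (fun n => eulerGamma (wn n)) (eulerGamma w).
    apply: (@eulerGamma_cvg R _ _ 2^-1 1) => // n.
    rewrite Rw; move: (n.+2%:R^-1) (n2 n) => x /andP[a b].
    by apply/andP; split; lra.
  have c2 : ccvg \oo (fun n => recip (wn n)) (recip w).
    apply: (@recip_cvg _ _ `|Im w|) => // n.
      by rewrite Rw; move: (n.+2%:R^-1) (n2 n) => x /andP[a b]; lra.
    by rewrite cImD cImN /= oppr0 addr0.
  have L := ccvgM c1 c2.
  apply: (ccvg_unique (L _)); apply: ccvg_near_eq (ccvg_cst 1).
  apply: nearW => n; apply: strip.
    by rewrite Rw; move: (n.+2%:R^-1) (n2 n) => x /andP[a b]; lra.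
  by rewrite Rw; move: (n.+2%:R^-1) (n2 n) => x /andP[a b]; lra.
have step N (w : R[i]) : 0 < Re w -> Re w <= N.+1%:R -> eulerGamma w * recip w = 1.
  elim: N w => [|N IH] w w0 wN.
    by move: wN; rewrite le_eqVlt => /predU1P[/line//|]; exact: strip.
  have [w1|w1] := leP (Re w) 1.
    by move: w1; rewrite le_eqVlt => /predU1P[/line//|]; exact: strip.
  have v0 : 0 < Re (w - 1) by rewrite cReD cReN Re1 subr_gt0.
  have vN : Re (w - 1) <= N.+1%:R.
    by rewrite cReD cReN Re1 lerBlDr -natr1 in wN *.
  have := IH _ v0 vN; rewrite recipS subrK => h.
  have -> : eulerGamma w = (w - 1) * eulerGamma (w - 1) by rewrite -eulerGammaS// subrK.
  by rewrite -[RHS]h mulrA [(w - 1) * _]mulrC -mulrA.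
move=> z0; apply: (step (Num.truncn (Re z))) => //.
exact/ltW/truncnS_gt.
Qed.

Lemma recip_prod z n : recip z = (\prod_(k < n) (z + k%:R)) * recip (z + n%:R).
Proof.
elim: n => [|n IH]; first by rewrite big_ord0 mul1r addr0.
rewrite big_ord_recr /= {1}IH recipS -mulrA; congr (_ * (_ * recip _)).
by rewrite -addrA natr1.
Qed.

(** The shift in [rGamma] reaches the half-plane where [gamma_recip] holds; that identity also shows
    that the divisor [eulerGamma] is nonzero there. *)
Lemma rGammaE z : rGamma z = recip z.
Proof.
rewrite /rGamma; set n := _.+1; rewrite (recip_prod z n); congr (_ * _).
have z0 : 0 < Re (z + n%:R).
  by rewrite cReD Re_nat -[Re z]opprK addrC subr_gt0; exact: truncnS_gt.
have h := gamma_recip z0.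
have g0 : eulerGamma (z + n%:R) != 0.
  by apply/eqP => g0; move: h => /eqP; rewrite g0 mul0r eq_sym oner_eq0.
by apply: (mulfI g0); rewrite h mulfV.
Qed.

End reciprocal_gamma.

(** * The Mittag-Leffler function as a Hankel integral *)

Section hankel_limits.
Variable R : realType.
Notation mu := (@lebesgue_measure R).
Notation intC := (intC mu).
Notation integrableC := (integrableC mu).
Implicit Types (z c d : R[i]) (u t : R) (F G : R -> R -> R[i]).

Let Npipi : (- pi : R) <= pi. Proof. by rewrite ge0_cp ?pi_ge0. Qed.
Let pi_pi : `|(pi : R)| <= pi. Proof. by rewrite ger0_norm// pi_ge0. Qed.
Let Npi_pi : `|(- pi : R)| <= pi. Proof. by rewrite normrN. Qed.

(** One triple [r], [g], [K] serves a whole sequence of integrands, as dominated convergence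
    requires. The bound [g] concerns the two sides of the cut only, where [e^s] decays. *)
Record hankel_dom (r : R) (g : R -> R) (K : R) F : Prop := HankelDom {
  hankel_cont_ray : forall u t, r < u -> `|t| <= pi -> continuousC (F ^~ t) u;
  hankel_cont_arc : forall t, `|t| <= pi -> continuousC (F r) t;
  hankel_bound_ray : forall u t, r < u -> (t = pi \/ t = - pi) -> normc (F u t) <= g u;
  hankel_bound_arc : forall t, `|t| <= pi -> normc (F r t) <= K }.

Section fixed.
Variables (r : R) (r1 : 1 <= r) (g : R -> R) (K : R).
Hypothesis ig : mu.-integrable `]r, +oo[ (EFin \o g).

Let ray F (u : R) : R[i] := (u^-1)%:C * (F u pi - F u (- pi)).

Let upos u : r < u -> 0 < u.
Proof. by move=> ru; exact: lt_trans (lt_le_trans ltr01 r1) ru. Qed.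

Let ray_cont F u : hankel_dom r g K F -> r < u -> continuousC (ray F) u.
Proof.
move=> [h1 _ _ _] ru; apply: ccvgM.
  by apply: ccvg_real; apply: cvgV; rewrite ?gt_eqF ?upos.
by apply: ccvgB; [exact: (h1 u pi)|exact: (h1 u (- pi))].
Qed.

Let ray_bound F u : hankel_dom r g K F -> r < u -> normc (ray F u) <= 2 * g u.
Proof.
move=> [_ _ h _] ru; have u0 := upos ru; rewrite normcM normc_real.
rewrite ger0_norm ?invr_ge0 ?(ltW u0)// -[leRHS]mul1r.
apply: ler_pM; rewrite ?normc_ge0 ?invr_ge0 ?(ltW u0)//.
  by rewrite invf_le1//; apply: le_trans r1 _; exact: ltW.
rewrite mulrDl mul1r (le_trans (normcB _ _))// lerD//; apply: h => //; [by left|by right].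
Qed.

Let ig2 : mu.-integrable `]r, +oo[ (EFin \o (fun u => 2 * g u)).
Proof. exact: (integrableZl _ 2 ig). Qed.

Lemma integrableC_hankel_ray F : hankel_dom r g K F ->
  integrableC `]r, +oo[ (fun u => (u^-1)%:C * (F u pi - F u (- pi))).
Proof.
move=> hF; apply: (integrableC_domin _ _ ig2) => //.
  by apply: measurableC_ray => u ru; exact: ray_cont hF ru.
by move=> u /in_ray ru; exact: ray_bound.
Qed.

Lemma integrableC_hankel_arc F : hankel_dom r g K F -> integrableC `[- pi, pi] (F r).
Proof.
by move=> [_ h _ _]; apply: integrableC_itv => t; rewrite -ler_norml; exact: h.
Qed.

Lemma hankel_cvg (Fn : nat -> R -> R -> R[i]) F :
  (forall n, hankel_dom r g K (Fn n)) ->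
  (forall u t, r <= u -> `|t| <= pi -> ccvg \oo (fun n => Fn n u t) (F u t)) ->
  ccvg \oo (fun n => hankel r (Fn n)) (hankel r F).
Proof.
move=> hn FnF; apply: ccvgD.
  apply: (ccvg_intC _ _ _ ig2) => //.
  - by move=> n; apply: measurableC_ray => u ru; exact: ray_cont (hn n) ru.
  - move=> u /in_ray /ltW ru; apply: ccvgM; first exact: ccvg_cst.
    by apply: ccvgB; exact: FnF.
  - by move=> n u /in_ray ru; exact: ray_bound.
apply: ccvgM; first exact: ccvg_cst.
have i0 : mu.-integrable `[- pi, pi] (EFin \o (fun=> K)).
  by apply: integrable_continuous_itv => t _; exact: cst_continuous.
apply: (ccvg_intC _ _ _ i0) => //.
- by move=> n; apply: measurableC_integrableC => //; exact: integrableC_hankel_arc.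
- by move=> t; rewrite /= in_itv /= -ler_norml => tp; exact: FnF.
- by move=> n t; rewrite /= in_itv /= -ler_norml => tp; case: (hn n) => _ _ _; exact.
Qed.

End fixed.

Lemma hankelD r g1 g2 K1 K2 F G : 1 <= r ->
  mu.-integrable `]r, +oo[ (EFin \o g1) -> mu.-integrable `]r, +oo[ (EFin \o g2) ->
  hankel_dom r g1 K1 F -> hankel_dom r g2 K2 G ->
  hankel r (fun u t => F u t + G u t) = hankel r F + hankel r G.
Proof.
move=> r1 i1 i2 hF hG; rewrite /hankel.
have rF := integrableC_hankel_ray r1 i1 hF; have rG := integrableC_hankel_ray r1 i2 hG.
have aF := integrableC_hankel_arc hF; have aG := integrableC_hankel_arc hG.
rewrite (intCD _ aF aG)// mulrDr addrACA; congr (_ + _).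
rewrite -(intCD _ rF rG)//; apply: eq_intC => u _.
by move: (F u pi) (F u (- pi)) (G u pi) (G u (- pi)) (_%:C) => p q s w v; ring.
Qed.

Lemma hankelMl r g K c F : 1 <= r -> mu.-integrable `]r, +oo[ (EFin \o g) ->
  hankel_dom r g K F -> hankel r (fun u t => c * F u t) = c * hankel r F.
Proof.
move=> r1 i1 hF; rewrite /hankel.
have rF := integrableC_hankel_ray r1 i1 hF.
have aF := integrableC_hankel_arc hF.
rewrite (intCMl _ _ aF)// mulrDr mulrCA; congr (_ + _).
rewrite -(intCMl _ _ rF)//; apply: eq_intC => u _.
by rewrite -mulrBr mulrCA.
Qed.

Definition esp_majorant c (u : R) := u `^ (Re c) * expR (- (1 * u)) * expR (pi * `|Im c|).

Lemma integrable_esp_majorant c r : 0 < r ->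
  mu.-integrable `]r, +oo[ (EFin \o esp_majorant c).
Proof.
move=> r0; have [i _] := integrableC_laplace_ray (Re c)%:C r0 (@ltr01 R).
have j : mu.-integrable `]r, +oo[ (EFin \o (fun u => u `^ (Re c) * expR (- (1 * u)))).
  apply: eq_integrable i => // u; rewrite inE => /in_ray ru; apply: (congr1 EFin).
  rewrite /laplace_pow [LHS](_ : _ = Re ((expR (- (1 * u)))%:C * (u `^ Re c)%:C)).
    by rewrite cReMr mulrC.
  by rewrite cpow_real ?(lt_trans r0 ru)// mulrC.
have k : mu.-integrable `]r, +oo[ (EFin \o (fun u =>
    expR (pi * `|Im c|) * (u `^ (Re c) * expR (- (1 * u))))).
  exact: (integrableZl _ _ j).
by apply: eq_integrable k => // u _; apply: (congr1 EFin); rewrite /esp_majorant mulrC.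
Qed.

Lemma hankel_dom_esp c r : 0 < r -> hankel_dom r (esp_majorant c)
  (expR r * (r `^ (Re c) * expR (pi * `|Im c|))) (esp c).
Proof.
move=> r0; split.
- move=> u t ru tp; pose M := `|t| + 1.
  have tM : - M < t < M by rewrite -ltr_norml ltrDl.
  exact: polar_holo_cont_l (@polar_holo_esp R (- M) M c) (lt_trans r0 ru) tM.
- by move=> t _; exact: continuousC_esp.
- move=> u t ru tp; have u0 := lt_trans r0 ru.
  have [sE tpi] : spow 1 u t = (- u)%:C /\ `|t| <= pi.
    by case: tp => ->; rewrite ?spow1_pi ?spow1_Npi.
  rewrite /esp normcM normc_cexp sE Re_real /esp_majorant mul1r.
  rewrite mulrAC [leRHS]mulrC ler_wpM2l ?expR_ge0//.
  exact: normc_spow_le.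
- by move=> t; exact: normc_esp.
Qed.

(** For [|q| <= 1/2], both [1 / (1 - q)] and the partial sums of its geometric series have modulus
    at most [2], which is the factor here. *)
Lemma hankel_dom_le (r : R) (g g' : R -> R) (K K' : R) F F' :
  hankel_dom r g K F ->
  (forall u t, r < u -> `|t| <= pi -> continuousC (F' ^~ t) u) ->
  (forall t, `|t| <= pi -> continuousC (F' r) t) ->
  (forall u, r < u -> 2 * g u <= g' u) -> 2 * K <= K' ->
  (forall u t, r <= u -> normc (F' u t) <= 2 * normc (F u t)) ->
  hankel_dom r g' K' F'.
Proof.
move=> [_ _ h1 h2] c1 c2 gg KK FF; split => //.
- move=> u t ru tp; apply: le_trans (FF u t (ltW ru)) _.
  by apply: le_trans (gg u ru); rewrite ler_wpM2l// h1.
- move=> t tp; apply: le_trans (FF r t (lexx _)) _.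
  by apply: le_trans KK; rewrite ler_wpM2l// h2.
Qed.

Lemma hankel_dom_Ml (r : R) (g : R -> R) (K : R) d F : hankel_dom r g K F ->
  hankel_dom r (fun u => normc d * g u) (normc d * K) (fun u t => d * F u t).
Proof.
move=> [h1 h2 h3 h4]; split.
- by move=> u t ru tp; apply: ccvgM; [exact: ccvg_cst|exact: h1].
- by move=> t tp; apply: ccvgM; [exact: ccvg_cst|exact: h2].
- by move=> u t ru tp; rewrite normcM ler_wpM2l ?normc_ge0// h3.
- by move=> t tp; rewrite normcM ler_wpM2l ?normc_ge0// h4.
Qed.

Lemma continuousC_spow_l c u t : 0 < u -> continuousC (spow c ^~ t) u.
Proof.
move=> u0; pose M := `|t| + 1.
have tM : - M < t < M by rewrite -ltr_norml ltrDl.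
exact: polar_holo_cont_l (@polar_holo_spow R (- M) M c) u0 tM.
Qed.

Lemma continuousC_spow_r c u t : 0 < u -> continuousC (spow c u) t.
Proof.
move=> u0; pose M := `|t| + 1.
have tM : - M < t < M by rewrite -ltr_norml ltrDl.
exact: polar_holo_cont_r (@polar_holo_spow R (- M) M c) u0 tM.
Qed.

(** * Termwise integration of the Mittag-Leffler series *)

Section mittag_leffler.
Variables (a x : R) (b : R[i]) (r : R).
Hypotheses (a0 : 0 < a) (x0 : 0 < x) (r1 : 1 <= r) (xr : 2 * x <= r `^ a).

(* [ml_kernel] is [e^s s^(1-b) / (1 + x s^(-a))] at [s = u e^(i t)], and
   [ml_partial n] its truncated expansion in powers of [- x s^(-a)]. *)
Definition ml_ratio (u t : R) : R[i] := - (x%:C * spow (- a%:C) u t).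
Definition ml_kernel u t : R[i] := esp (1 - b) u t / (1 - ml_ratio u t).
Definition ml_partial n u t : R[i] := esp (1 - b) u t * \sum_(k < n) ml_ratio u t ^+ k.

Let r0 : 0 < r. Proof. exact: lt_le_trans ltr01 r1. Qed.

Lemma normc_ml_ratio u t : r <= u -> normc (ml_ratio u t) <= 2^-1.
Proof.
move=> ru; have u0 := lt_le_trans r0 ru.
rewrite normcN normcM normc_real ger0_norm ?(ltW x0)// normc_spow//.
rewrite cReN cImN Re_real Im_real oppr0 mul0r oppr0 expR0 mulr1 powRN.
rewrite ler_pdivrMr ?powR_gt0// mulrC ler_pdivlMr// mulrC.
apply: le_trans xr _; apply: ge0_ler_powR; rewrite ?nnegrE ?(ltW a0) ?(ltW u0) ?(ltW r0)//.
Qed.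

Lemma ml_ratio_lb u t : r <= u -> 2^-1 <= normc (1 - ml_ratio u t).
Proof.
move=> ru; have := normc_geB 1 (- ml_ratio u t); rewrite normc1 normcN.
have := normc_ml_ratio t ru; move: (normc _) (normc _) => p q; lra.
Qed.

Lemma ml_ratio_neq1 u t : r <= u -> 1 - ml_ratio u t != 0.
Proof.
move=> ru; apply/eqP => h; have := ml_ratio_lb t ru.
by rewrite h normc0 leNgt invr_gt0 ltr0n.
Qed.

Let K0 := expR r * (r `^ (Re (1 - b)) * expR (pi * `|Im (1 - b)|)).
Let g2 u := 2 * esp_majorant (1 - b) u.

Let dom0 : hankel_dom r (esp_majorant (1 - b)) K0 (esp (1 - b)).
Proof. exact: hankel_dom_esp. Qed.

Let cont_ratio_l u t : 0 < u -> continuousC (ml_ratio ^~ t) u.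
Proof.
by move=> u0; apply: ccvgN; apply: ccvgM; [exact: ccvg_cst|exact: continuousC_spow_l].
Qed.

Let cont_ratio_r u t : 0 < u -> continuousC (ml_ratio u) t.
Proof.
by move=> u0; apply: ccvgN; apply: ccvgM; [exact: ccvg_cst|exact: continuousC_spow_r].
Qed.

Lemma hankel_dom_kernel : hankel_dom r g2 (2 * K0) ml_kernel.
Proof.
have [c1 c2 _ _] := dom0.
apply: (hankel_dom_le dom0) => //.
- move=> u t ru tp; apply: ccvgM; first exact: c1.
  apply: ccvgV; first by apply: ml_ratio_neq1; exact: ltW.
  by apply: ccvgB; [exact: ccvg_cst|apply: cont_ratio_l; exact: lt_trans ru].
- move=> t tp; apply: ccvgM; first exact: c2.
  apply: ccvgV; first exact: ml_ratio_neq1.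
  by apply: ccvgB; [exact: ccvg_cst|exact: cont_ratio_r].
- move=> u t ru; rewrite normcM normcV mulrC ler_wpM2r ?normc_ge0//.
  rewrite -[leRHS]invrK lef_pV2 ?posrE ?normc_gt0 ?ml_ratio_neq1//.
  exact: ml_ratio_lb.
Qed.

Let ccvg_sum (T : Type) (F : set_system T) {FF : Filter F} (f : T -> R[i]) l n :
  ccvg F f l -> ccvg F (fun s => \sum_(k < n) f s ^+ k) (\sum_(k < n) l ^+ k).
Proof.
move=> fl.
have X k : ccvg F (fun s => f s ^+ k) (l ^+ k).
  elim: k => [|k IH]; first exact: ccvg_cst.
  by under eq_fun do rewrite exprS; rewrite exprS; exact: ccvgM.
elim: n => [|n IH].
  by under eq_fun do rewrite big_ord0; rewrite big_ord0; exact: ccvg_cst.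
by under eq_fun do rewrite big_ord_recr; rewrite big_ord_recr; exact: ccvgD.
Qed.

Let sum_bound (q : R[i]) n : normc q <= 2^-1 -> normc (\sum_(k < n) q ^+ k) <= 2 - 2 * 2^-1 ^+ n.
Proof.
move=> qh; elim: n => [|n IH]; first by rewrite big_ord0 normc0 expr0 mulr1 subrr.
rewrite big_ord_recr /= (le_trans (normcD _ _))//.
have : normc (q ^+ n) <= 2^-1 ^+ n by rewrite normcX lerXn2r ?nnegrE ?normc_ge0// invr_ge0.
rewrite exprSr; move: (normc _) (normc _) (2^-1 ^+ n) IH => p s w; lra.
Qed.

Lemma hankel_dom_partial n : hankel_dom r g2 (2 * K0) (ml_partial n).
Proof.
have [c1 c2 _ _] := dom0.
apply: (hankel_dom_le dom0) => //.
- move=> u t ru tp; apply: ccvgM; first exact: c1.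
  by apply: ccvg_sum; apply: cont_ratio_l; exact: lt_trans ru.
- move=> t tp; apply: ccvgM; first exact: c2.
  by apply: ccvg_sum; exact: cont_ratio_r.
- move=> u t ru; rewrite normcM mulrC ler_wpM2r ?normc_ge0//.
  apply: le_trans (sum_bound _ (normc_ml_ratio t ru)) _.
  by rewrite gerBl mulr_ge0// exprn_ge0// invr_ge0.
Qed.

Let ig2 : mu.-integrable `]r, +oo[ (EFin \o g2).
Proof. exact: (integrableZl _ 2 (integrable_esp_majorant (1 - b) r0)). Qed.

Lemma ml_partial_cvg u t : r <= u -> ccvg \oo (fun n => ml_partial n u t) (ml_kernel u t).
Proof.
move=> ru; apply: ccvgM; first exact: ccvg_cst.
have q1 := ml_ratio_neq1 t ru; have qh := normc_ml_ratio t ru.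
move: (ml_ratio u t) q1 qh => q q1 qh.
have E n : \sum_(k < n) q ^+ k = (1 - q)^-1 - q ^+ n / (1 - q).
  have : 1 - q ^+ n = (1 - q) * \sum_(k < n) q ^+ k.
    by rewrite -opprB subrX1 -mulNr opprB.
  move: (q ^+ n) (\sum_(k < n) _) => w s h.
  by apply: (mulfI q1); rewrite -h; field.
under eq_fun do rewrite E.
rewrite -[X in ccvg _ _ X]subr0; apply: ccvgB; first exact: ccvg_cst.
rewrite -(mul0r (1 - q)^-1); apply: ccvgM; last exact: ccvg_cst.
have h : (2^-1 ^+ n : R) @[n --> \oo] --> 0 by apply: cvg_expr; rewrite ger0_norm; lra.
apply: (ccvg_squeeze0 _ h); apply: nearW => n.
by rewrite normcX lerXn2r ?nnegrE ?normc_ge0// invr_ge0.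
Qed.

(** The added term has exponent [1 - (b + a n)], the one whose Hankel integral is
    [2 i pi / Gamma(b + a n)]. *)
Let term_E n u t : ml_partial n.+1 u t = ml_partial n u t +
  (- x%:C) ^+ n * esp (1 - b - a%:C * n%:R) u t.
Proof.
rewrite /ml_partial big_ord_recr /= mulrDr; congr (_ + _).
rewrite /ml_ratio -mulNr exprMn mulrCA; congr (_ * _).
rewrite /esp (spowD (1 - b)) -mulrA; congr (_ * (_ * _)).
by rewrite /spow -cexpMn; congr cexp; rewrite -mulr_natr; ring.
Qed.

Lemma hankel_partial n : hankel r (ml_partial n) / (2 * 'i * pi%:C) =
  \sum_(k < n) (- x%:C) ^+ k * rGamma (b + a%:C * k%:R).
Proof.
elim: n => [|n IH].
  rewrite big_ord0 (_ : ml_partial 0 = fun _ _ => 0 * 0); last first.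
    by apply/funext => u; apply/funext => t; rewrite /ml_partial big_ord0 mulr0 mul0r.
  have d0 : hankel_dom r g2 (2 * K0) (fun _ _ => 0).
    rewrite (_ : (fun _ _ => 0) = ml_partial 0); first exact: hankel_dom_partial.
    by apply/funext => u; apply/funext => t; rewrite /ml_partial big_ord0 mulr0.
  by rewrite (hankelMl 0 r1 ig2 d0) !mul0r.
pose c := 1 - b - a%:C * n%:R.
have dn := hankel_dom_Ml ((- x%:C) ^+ n) (hankel_dom_esp c r0).
have ic := integrable_esp_majorant c r0.
have icn : mu.-integrable `]r, +oo[ (EFin \o (fun u => normc ((- x%:C) ^+ n) * esp_majorant c u)).
  exact: (integrableZl _ _ ic).
rewrite big_ord_recr /= -IH.
have -> : ml_partial n.+1 = fun u t => ml_partial n u t + (- x%:C) ^+ n * esp c u t.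
  by apply/funext => u; apply/funext => t; exact: term_E.
rewrite (hankelD r1 ig2 icn (hankel_dom_partial n) dn) mulrDl; congr (_ + _).
rewrite (hankelMl _ r1 ic (hankel_dom_esp c r0)) -mulrA; congr (_ * _).
(* The contour of radius [r] is moved to radius [1], the one in the definition of [recip]. *)
rewrite rGammaE /recip hankel_esp_indep//; congr (hankel 1 (esp _) / _).
by rewrite /c opprD addrA.
Qed.

(** The partial sums of the series are Hankel integrals of geometric sums with a common majorant.
    Convergence of the series comes out of dominated convergence, with no growth estimate on
    [1 / Gamma]. *)
Theorem mittagLeffler_hankel :
  mittagLeffler a%:C b (- x%:C) = hankel r ml_kernel / (2 * 'i * pi%:C).
Proof.
rewrite /mittagLeffler; apply: (@cvg_lim (R[i]^o)); first exact: norm_hausdorff.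
have L := hankel_cvg r1 ig2 hankel_dom_partial (fun u t ru _ => ml_partial_cvg t ru).
have {}L := ccvgM L (ccvg_cst (2 * 'i * pi%:C)^-1).
have E : series (fun k : nat => (- x%:C) ^+ k * rGamma (b + a%:C * k%:R) : R[i]^o) =
    fun n => hankel r (ml_partial n) / (2 * 'i * pi%:C).
  by apply/funext => n; rewrite /series /= hankel_partial big_mkord.
by rewrite E; exact: ccvg_cvg (L _ _).
Qed.

End mittag_leffler.

End hankel_limits.

(** * Collapse of the contour *)

Lemma cexp_i (R : realType) (t : R) : cexp ('i * t%:C) = Complex (cos t) (sin t) :> R[i].
Proof.
by apply: complex_eq; rewrite ?Re_cexp ?Im_cexp !reimE
  !(mul0r, mul1r, mulr0, subr0, addr0, add0r) expR0 !mul1r.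
Qed.

Section collapse.
Variable R : realType.
Notation mu := (@lebesgue_measure R).
Notation intC := (intC mu).
Notation integrableC := (integrableC mu).
Variable a : R.
Hypotheses (a0 : 0 < a) (a1 : a < 1).
Implicit Types (c b : R[i]) (u t x xi y : R).

Let S : R := sin (pi * a).

Let pia0 : 0 < pi * a. Proof. by rewrite mulr_gt0 ?pi_gt0. Qed.
Let pia1 : pi * a < pi. Proof. by rewrite gtr_pMr ?pi_gt0. Qed.

Let S0 : 0 < S. Proof. by rewrite sin_gt0_pi// pia0. Qed.

(* The jump of the kernel across the cut is a combination of two of these at
   [(xi, y) = (x, 1)]; at [(1, x^(1/a))] they are the integrands of the theorem. *)
Definition ml_cut c xi y u : R[i] :=
  laplace_pow c y u / (xi ^+ 2 + 2 * xi * u `^ a * cos (pi * a) + u `^ (2 * a))%:C.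

(** This is [|xi + u^a e^(i pi a)|^2]. *)
Let den xi u : R := xi ^+ 2 + 2 * xi * u `^ a * cos (pi * a) + u `^ (2 * a).

Let powR2 u : u `^ (2 * a) = (u `^ a) ^+ 2.
Proof. by rewrite mulrC powRrM powR_mulrn// powR_ge0. Qed.

(** Completing the square, [den = (u^a + xi cos (pi a))^2 + xi^2 S^2]. With [a < 1], hence [S > 0],
    this keeps the denominator away from [0]. *)
Let den_ge xi u : xi ^+ 2 * S ^+ 2 <= den xi u.
Proof.
rewrite /den powR2 /S; have := cos2Dsin2 (pi * a).
move: (cos _) (sin _) (u `^ a) => c s w cs.
have -> : xi ^+ 2 + 2 * xi * w * c + w ^+ 2 =
    xi ^+ 2 * (c ^+ 2 + s ^+ 2) + 2 * xi * w * c + w ^+ 2 by rewrite cs mulr1.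
rewrite -subr_ge0.
rewrite (_ : _ - _ = (w + xi * c) ^+ 2); last by ring.
exact: sqr_ge0.
Qed.

Let den_gt0 xi u : 0 < xi -> 0 < den xi u.
Proof. by move=> xi0; apply: lt_le_trans (den_ge xi u); rewrite mulr_gt0// exprn_gt0. Qed.

Lemma integrableC_ml_cut c xi y : -1 < Re c -> 0 < xi -> 0 < y ->
  integrableC `]0, +oo[ (ml_cut c xi y).
Proof.
move=> c1 xi0 y0; pose k := (xi ^+ 2 * S ^+ 2)^-1.
have k0 : 0 < xi ^+ 2 * S ^+ 2 by rewrite mulr_gt0// exprn_gt0.
have i := integrable_powR_exp c1 y0.
have j : mu.-integrable `]0, +oo[ (EFin \o (fun u => k * (u `^ (Re c) * expR (- (y * u))))).
  exact: (integrableZl _ k i).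
apply: (integrableC_domin _ _ j) => //.
  apply: measurableC_ray => u u0; apply: ccvgM; first exact: continuousC_laplace_pow.
  have d0 := den_gt0 u xi0.
  apply: ccvgV; first by rewrite eq_complex /= negb_and gt_eqF.
  apply: ccvg_real.
  have ca (e : R) : {for u, continuous (fun v => v `^ e)}.
    apply: differentiable_continuous; apply/derivable1_diffP.
    by have [] := @is_derive1_powR R e u u0.
  apply: cvgD; last exact: ca.
  apply: cvgD; first exact: cvg_cst.
  by apply: cvgM; [apply: cvgM; [exact: cvg_cst|exact: ca]|exact: cvg_cst].
move=> u /in_ray u0; have d0 := den_gt0 u xi0.
rewrite /ml_cut normcM normc_laplace_pow// normcV normc_real gtr0_norm//.
rewrite mulrC ler_wpM2r ?mulr_ge0 ?powR_ge0 ?expR_ge0//.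
by rewrite /k lef_pV2 ?posrE//; exact: den_ge.
Qed.

Lemma continuousC_ml_cut c xi y u : 0 < xi -> 0 < u -> continuousC (ml_cut c xi y) u.
Proof.
move=> xi0 u0; apply: ccvgM; first exact: continuousC_laplace_pow.
have d0 := den_gt0 u xi0.
apply: ccvgV; first by rewrite eq_complex /= negb_and gt_eqF.
apply: ccvg_real.
have ca (e : R) : {for u, continuous (fun v => v `^ e)}.
  apply: differentiable_continuous; apply/derivable1_diffP.
  by have [] := @is_derive1_powR R e u u0.
apply: cvgD; last exact: ca.
apply: cvgD; first exact: cvg_cst.
by apply: cvgM; [apply: cvgM; [exact: cvg_cst|exact: ca]|exact: cvg_cst].
Qed.

Lemma mlIntegrandE x c : mlIntegrand a x c = ml_cut c 1 (x `^ a^-1).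
Proof.
apply/funext => u; rewrite /mlIntegrand /ml_cut /laplace_pow expr1n mulr1.
by move: (cpow u c) => p; rewrite mulrAC.
Qed.

Section kernel.
Variables (x : R) (b : R[i]).
Hypotheses (x0 : 0 < x) (ba : Re b < a + 1).

Let rho u : R := x * u `^ (- a).

Let rho_gt0 u : 0 < u -> 0 < rho u.
Proof. by move=> u0; rewrite mulr_gt0// powR_gt0. Qed.

(** [x s^(- a)] is the point of modulus [rho u] and angle [- a t], so the results on [1 + s] apply
    to the denominator of the kernel. *)
Let onemE u t : 0 < u -> 1 - ml_ratio a x u t = 1 + spow 1 (rho u) (- (a * t)).
Proof.
move=> u0; rewrite /ml_ratio opprK; congr (_ + _).
rewrite !spowE cpowr1 ?rho_gt0// -rmorphN cpow_real// mulrA -rmorphM; congr (_ * cexp _).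
by rewrite mulr1 rmorphN rmorphN rmorphM mulrN mulrN; ring.
Qed.

Let at_pi t : `|t| <= pi -> - (pi * a) <= - (a * t) <= pi * a.
Proof.
by move=> tp; rewrite -ler_norml normrN normrM (gtr0_norm a0) mulrC ler_wpM2r// ltW.
Qed.

Let cos_lb s : - (pi * a) <= s <= pi * a -> cos (pi * a) <= cos s.
Proof.
rewrite -ler_norml => sp.
have -> : cos s = cos `|s| by have [_|_] := ger0P s; rewrite ?cosN.
rewrite leNgt ltr_cos ?in_itv /= ?normr_ge0 ?(le_trans sp (ltW pia1)) ?(ltW pia0) ?(ltW pia1)//.
by rewrite -leNgt.
Qed.

(** For [|t| <= pi] the cosine of [a t] is at least that of [pi a]; completing the square then
    leaves [(rho u)^2 S^2]. The growth of [rho u = x u^(- a)] at [0] is what admits [Re b] up to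
    [a + 1] in the collapse. *)
Let onem_lb u t : 0 < u -> `|t| <= pi ->
  rho u * S <= normc (1 - ml_ratio a x u t).
Proof.
move=> u0 tp; rewrite onemE//; have r0 := rho_gt0 u0; have h := cos_lb (at_pi tp).
apply: le_normc; first by rewrite mulr_ge0// ltW.
rewrite cReD cImD Re1 Im1 Re_spow1// Im_spow1// add0r /S.
have := cos2Dsin2 (pi * a); have := cos2Dsin2 (- (a * t)).
move: (cos (- (a * t))) (sin (- (a * t))) (cos (pi * a)) (sin (pi * a)) h.
move=> c s d w hc e1 e2; move: (rho u) r0 => r r0.
have -> : (1 + r * c) ^+ 2 + (r * s) ^+ 2 = 1 + 2 * (r * c) + r ^+ 2 * (c ^+ 2 + s ^+ 2) by ring.
rewrite e1 mulr1.
have h2 : r * d <= r * c by rewrite ler_wpM2l// ltW.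
apply: (@le_trans _ _ (1 + 2 * (r * d) + r ^+ 2)); last by lra.
rewrite -subr_ge0.
have -> : 1 + 2 * (r * d) + r ^+ 2 - (r * w) ^+ 2 =
  (1 + r * d) ^+ 2 + r ^+ 2 * (1 - (d ^+ 2 + w ^+ 2)) by ring.
by rewrite e2 subrr mulr0 addr0 sqr_ge0.
Qed.

(** In terms of [u^a], [e^(i pi a)] and [e^(i pi b)] the jump of the kernel is a rational function,
    within reach of [field]. *)
Let T u : R[i] := (u `^ a)%:C.
Let W : R[i] := cexp ('i * pi%:C * a%:C).
Let beta : R[i] := cexp ('i * pi%:C * b).

Let W_cos : W + W^-1 = (2 * cos (pi * a))%:C.
Proof.
rewrite /W -cexpN.
have -> : 'i * pi%:C * a%:C = 'i * (pi * a)%:C :> R[i] by rewrite rmorphM mulrA.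
rewrite -mulrN -rmorphN.
rewrite !cexp_i; apply: complex_eq; first by rewrite cReD /= cosN; ring.
by rewrite cImD /= sinN subrr.
Qed.

Let csinb : csin (pi%:C * b) = (beta - beta^-1) / (2 * 'i).
Proof. by rewrite csinE mulrA -/beta cexpN. Qed.

Let csinab : csin (pi%:C * (a%:C - b)) = (W / beta - beta / W) / (2 * 'i).
Proof.
rewrite csinE mulrA cexpN mulrBr cexpD cexpN -/W -/beta.
by rewrite [(W / beta)^-1]invf_div.
Qed.

Let delta u : R[i] := (u^-1)%:C * (ml_kernel a x b u pi - ml_kernel a x b u (- pi)).

(** On the two sides of the cut [s^(- a)] has the conjugate directions [e^(- i pi a)] and
    [e^(i pi a)]. Over the common denominator [den x u] the numerator separates into
    [u^a sin (pi b)] and [- x sin (pi (a - b))], up to a common factor. *)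
Let deltaE u : 0 < u -> delta u = 2 * 'i *
  (csin (pi%:C * b) * ml_cut ((2 * a)%:C - b) x 1 u -
   x%:C * csin (pi%:C * (a%:C - b)) * ml_cut (a%:C - b) x 1 u).
Proof.
move=> u0.
have T0 : T u != 0 by rewrite eq_complex /= negb_and gt_eqF// powR_gt0.
have W0 : W != 0 by exact: cexp_neq0.
have b0 : beta != 0 by exact: cexp_neq0.
have e1 : spow (- a%:C) u pi = (T u)^-1 / W.
  rewrite spowE -rmorphN cpow_real// powRN fmorphV; congr (_ * _).
  by rewrite rmorphN mulrN cexpN.
have e2 : spow (- a%:C) u (- pi) = (T u)^-1 * W.
  rewrite spowE -rmorphN cpow_real// powRN fmorphV; congr (_ * cexp _).
  by rewrite !rmorphN; ring.
have f1 : cexp ('i * pi%:C * (1 - b)) = - beta^-1.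
  by rewrite mulrBr mulr1 cexpD cexp_ipi mulN1r cexpN.
have pp : `|(pi : R)| <= pi by rewrite ger0_norm// pi_ge0.
have nzS t : `|t| <= pi -> 1 - ml_ratio a x u t != 0.
  move=> tp; apply/eqP => h; have := onem_lb u0 tp; rewrite h normc0 leNgt.
  by rewrite mulr_gt0 ?rho_gt0.
have n1 := nzS _ pp; have n2 := nzS (- pi) _; rewrite normrN in n2; have {}n2 := n2 pp.
rewrite /ml_ratio opprK e1 in n1; rewrite /ml_ratio opprK e2 in n2.
have D0 : (den x u)%:C != 0 :> R[i] by rewrite eq_complex /= negb_and gt_eqF// den_gt0.
have DE : (den x u)%:C = x%:C ^+ 2 + x%:C * T u * (W + W^-1) + T u ^+ 2.
  rewrite W_cos /T /den powR2 -!rmorphXn -!rmorphM -!rmorphD; congr (_%:C); ring.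
have L1 (c : R) : laplace_pow (c%:C - b) 1 u = (u `^ c)%:C * laplace_pow (- b) 1 u.
  by rewrite /laplace_pow cpowD cpow_real// mulrA.
rewrite /delta /ml_kernel esp_pi// esp_Npi// cexpN f1 /ml_ratio !opprK e1 e2.
have T2 : (u `^ (2 * a))%:C = T u ^+ 2 by rewrite powR2 rmorphXn.
rewrite csinb csinab /ml_cut -/(den x u) (L1 (2 * a)) (L1 a) T2 -/(T u).
have L2 : (u^-1)%:C * laplace_pow (1 - b) 1 u = laplace_pow (- b) 1 u.
  by rewrite laplace_powMinv// (_ : 1 - b - 1 = - b)//; ring.
rewrite DE; rewrite DE in D0.
move: n1 n2 D0 L2; move: (laplace_pow (1 - b) 1 u) (laplace_pow (- b) 1 u) (u^-1)%:C => L' L U.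
move: (T u) T0 (x%:C : R[i]) => t t0 X; move: W W0 beta b0 => w w0 B B0 n1 n2 D0 <-.
have := @i_neq0 R; move: ('i : R[i]) => j j0.
have m1 : t * w + X != 0.
  have -> : t * w + X = t * w * (1 + X * (t^-1 / w)) by field; rewrite t0 w0.
  by rewrite !mulf_neq0.
have m2 : t + X * w != 0.
  have -> : t + X * w = t * (1 + X * (t^-1 * w)) by field.
  by rewrite !mulf_neq0.
have -> : U * (L' * - B^-1 / (1 + X * (t^-1 / w)) - L' / - B^-1 / (1 + X * (t^-1 * w))) =
    U * L' * t * (- B^-1 * w / (t * w + X) + B / (t + X * w)).
  by field; rewrite B0 m1 m2 t0 w0.
(* With [t = u^a], [X = x] and [w = e^(i pi a)], the two denominators multiply to [w] times
   [den x u]. *)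
have D1 : (t * w + X) * (t + X * w) = w * (X ^+ 2 + X * t * (w + w^-1) + t ^+ 2) by field.
have -> : - B^-1 * w / (t * w + X) + B / (t + X * w) =
   (- B^-1 * (t + X * w) + B * (t + X / w)) / (X ^+ 2 + X * t * (w + w^-1) + t ^+ 2).
  have -> : (X ^+ 2 + X * t * (w + w^-1) + t ^+ 2) = (t * w + X) * (t + X * w) / w.
    by rewrite D1 [RHS]mulrC mulKf.
  by field; rewrite ?B0 ?m1 ?m2 ?w0.
move: D0; move: (X ^+ 2 + X * t * (w + w^-1) + t ^+ 2) => D D0.
by field; rewrite ?D0 ?j0 ?B0 ?w0.
Qed.

Let Rea1 : -1 < Re ((2 * a)%:C - b).
Proof. by rewrite cReD cReN Re_real; move: a0 ba => h1 h2; lra. Qed.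

Let Rea2 : -1 < Re (a%:C - b).
Proof. by rewrite cReD cReN Re_real; move: a0 ba => h1 h2; lra. Qed.

Let c1 := integrableC_ml_cut Rea1 x0 (@ltr01 R).
Let c2 := integrableC_ml_cut Rea2 x0 (@ltr01 R).

Let integrable_comb : integrableC `]0, +oo[ (fun u =>
  csin (pi%:C * b) * ml_cut ((2 * a)%:C - b) x 1 u -
  x%:C * csin (pi%:C * (a%:C - b)) * ml_cut (a%:C - b) x 1 u).
Proof.
by apply: integrableCB => //; apply: integrableCMl.
Qed.

Let integrable_delta : integrableC `]0, +oo[ delta.
Proof.
have i : integrableC `]0, +oo[ (fun u => 2 * 'i * (
  csin (pi%:C * b) * ml_cut ((2 * a)%:C - b) x 1 u -
  x%:C * csin (pi%:C * (a%:C - b)) * ml_cut (a%:C - b) x 1 u)).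
  exact: integrableCMl.
by apply: eq_integrableC i => // u /in_ray u0; rewrite deltaE.
Qed.

Let intC_delta : intC `]0, +oo[ delta = 2 * 'i *
  (csin (pi%:C * b) * intC `]0, +oo[ (ml_cut ((2 * a)%:C - b) x 1) -
   x%:C * csin (pi%:C * (a%:C - b)) * intC `]0, +oo[ (ml_cut (a%:C - b) x 1)).
Proof.
rewrite -(intCMl _ _ c1)// -(intCMl _ _ c2)// -intCB//; try exact: integrableCMl.
rewrite -[RHS]intCMl//.
by apply: eq_intC => u /in_ray u0; rewrite deltaE.
Qed.

Let y := x `^ a^-1.
Let y0 : 0 < y. Proof. by rewrite powR_gt0. Qed.
Let ya : y `^ a = x.
Proof. by rewrite -powRrM mulVf ?gt_eqF// powRr1// ltW. Qed.

(** Under [u -> y u] with [y^a = x] the denominator factors as [x^2] times the one with [xi = 1],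
    while [e^(- u)] becomes [e^(- y u)]. *)
Lemma intC_ml_cut_scale c : -1 < Re c ->
  intC `]0, +oo[ (ml_cut c x 1) =
  cpow y (c + 1) / x%:C ^+ 2 * intC `]0, +oo[ (ml_cut c 1 y).
Proof.
move=> cr.
have E u : 0 < u -> ml_cut c x 1 (y * u) = cpow y c / x%:C ^+ 2 * ml_cut c 1 y u.
  move=> u0; rewrite /ml_cut /laplace_pow cpowM// mul1r expr1n mulr1.
  rewrite powRM ?(ltW y0) ?(ltW u0)// [(y * u) `^ (2 * a)]powRM ?(ltW y0) ?(ltW u0)//.
  rewrite !powR2 ya.
  rewrite (_ : x ^+ 2 + 2 * x * (x * u `^ a) * cos (pi * a) + x ^+ 2 * u `^ a ^+ 2 =
    x ^+ 2 * (1 + 2 * u `^ a * cos (pi * a) + u `^ a ^+ 2)); last by ring.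
  rewrite rmorphM rmorphXn invfM.
  by move: (cpow y c) (cpow u c) (_%:C) (_^-1) (_^-1) => p q r s v; ring.
have i1 := integrableC_ml_cut cr (@ltr01 R) y0.
have i2 : integrableC `]0, +oo[ (fun u => cpow y c / x%:C ^+ 2 * ml_cut c 1 y u).
  exact: integrableCMl.
have sc := @intC_scale R (ml_cut c x 1) y y0.
rewrite sc.
- have -> : intC `]0, +oo[ (fun u => ml_cut c x 1 (y * u)) =
      cpow y c / x%:C ^+ 2 * intC `]0, +oo[ (ml_cut c 1 y).
    by rewrite -intCMl//; apply: eq_intC => u /in_ray u0; rewrite E.
  rewrite cpowD cpowr1//; move: (cpow y c) (intC _ _) => p I.
  by move: (y%:C) ((x%:C ^+ 2)^-1) => q w; ring.
- by move=> u u0; exact: continuousC_ml_cut.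
- exact: integrableC_ml_cut.
- by apply: eq_integrableC i2 => // u /in_ray u0; rewrite E.
Qed.

Lemma cintegrable_mlIntegrand c : -1 < Re c -> cintegrable (mlIntegrand a x c).
Proof. by move=> cr; rewrite mlIntegrandE; exact: integrableC_ml_cut. Qed.

Let Minv : pi < pi / a.
Proof. by rewrite ltr_pdivlMr// gtr_pMr ?pi_gt0. Qed.

(** On the logarithm surface [1 + x s^(- a)] has no zero with [a |t| < pi]. As [a < 1], the sector
    [|t| < pi / a] contains both sides of the cut in its interior. *)
Let polar_holo_kernel : exists Fd, polar_holo (- (pi / a)) (pi / a) (ml_kernel a x b) Fd.
Proof.
have nz u t : 0 < u -> - (pi / a) < t < pi / a -> 1 + x%:C * spow (- a%:C) u t != 0.
  move=> u0 tM; have := onemE t u0; rewrite /ml_ratio opprK => ->.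
  apply: onePspow1_neq0; first exact: rho_gt0.
  rewrite -ltr_norml normrN normrM (gtr0_norm a0) mulrC -ltr_pdivlMr//.
  by rewrite ltr_norml.
have [Fd h] : exists Fd, polar_holo (- (pi / a)) (pi / a)
    (fun u t => esp (1 - b) u t * (1 + x%:C * spow (- a%:C) u t)^-1) Fd.
  eexists; apply: polar_holoM; first exact: polar_holo_esp.
  apply: (polar_holoV nz); apply: polar_holoD; first exact: polar_holo_cst.
  by apply: polar_holoM; [exact: polar_holo_cst|exact: polar_holo_spow].
exists Fd; apply: (polar_holo_eq h) => //.
by apply/funext => u; apply/funext => t; rewrite /ml_kernel /ml_ratio opprK.
Qed.

Lemma hankel_kernel_collapse (r : R) : 0 < r ->
  hankel r (ml_kernel a x b) / (2 * 'i * pi%:C) = mlIntegralRep a b x.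
Proof.
move=> r0; have [Fd hF] := polar_holo_kernel.
(* Inside the circle the numerator is at most [e^r e^(pi |Im b|) u^(1 - Re b)] and the denominator
   at least [x u^(- a) S]; the resulting exponent [1 - Re b + a] is positive. *)
pose K := expR r * expR (pi * `|Im (1 - b)|) / (x * S).
pose eta (u : R) := K * u `^ (Re (1 - b) + a).
have xS : 0 < x * S by rewrite mulr_gt0.
have etaP u s : 0 < u -> u <= r -> - pi <= s <= pi -> normc (ml_kernel a x b u s) <= eta u.
  move=> u0 ur; rewrite -ler_norml => sp; rewrite normcM normcV.
  have h1 := normc_esp (1 - b) u0 sp.
  have h2 := onem_lb u0 sp.
  have rS : 0 < rho u * S by rewrite mulr_gt0// rho_gt0.
  have h3 : (normc (1 - ml_ratio a x u s))^-1 <= (rho u * S)^-1.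
    by rewrite lef_pV2 ?posrE//; exact: lt_le_trans h2.
  have h4 : 0 <= (normc (1 - ml_ratio a x u s))^-1 by rewrite invr_ge0 normc_ge0.
  apply: le_trans (ler_pM (normc_ge0 _) h4 h1 h3) _.
  have ua : u `^ a != 0 by rewrite gt_eqF// powR_gt0.
  rewrite /eta /K /rho powRN powRD ?(gt_eqF u0) ?implybT//.
  rewrite (_ : (x * (u `^ a)^-1 * S)^-1 = u `^ a / (x * S)); last first.
    by field; rewrite ua !gt_eqF.
  have e : expR u <= expR r by rewrite ler_expR.
  move: (u `^ Re (1 - b)) (u `^ a) (expR (pi * _)) (powR_ge0 u (Re (1 - b))) (powR_ge0 u a)
    (expR_ge0 (pi * `|Im (1 - b)|)) => p q w p0 q0 w0.
  rewrite (_ : expR r * w / (x * S) * (p * q) = expR r * (p * w * (q / (x * S)))); last by ring.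
  by rewrite -[leLHS]mulrA ler_wpM2r ?mulr_ge0 ?invr_ge0 ?(ltW xS).
have eta0 : eta n.+1%:R^-1 @[n --> \oo] --> 0.
  rewrite -(mulr0 K); apply: cvgM; first exact: cvg_cst.
  apply: powRr_cvg0 => //; last exact: cvg_invnS.
  by rewrite cReD cReN Re1; move: ba => h; lra.
have NM : - (pi / a) < - pi by rewrite ltrN2.
have Npipi : (- pi : R) <= pi by rewrite ge0_cp ?pi_ge0.
have h := polar_cauchy_collapse hF NM Npipi Minv r0 integrable_delta etaP eta0.
have -> : hankel r (ml_kernel a x b) = intC `]0, +oo[ delta by exact: h.
rewrite intC_delta (intC_ml_cut_scale Rea1) (intC_ml_cut_scale Rea2).
rewrite /mlIntegralRep !mlIntegrandE -/y.
rewrite -[cintegral (ml_cut ((2 * a)%:C - b) 1 y)]/(intC `]0, +oo[ (ml_cut ((2 * a)%:C - b) 1 y)).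
rewrite -[cintegral (ml_cut (a%:C - b) 1 y)]/(intC `]0, +oo[ (ml_cut (a%:C - b) 1 y)).
have xC : x%:C != 0 :> R[i] by rewrite eq_complex /= negb_and gt_eqF.
have piC : pi%:C != 0 :> R[i] by rewrite eq_complex /= negb_and gt_eqF// pi_gt0.
have ypow : cpow y a%:C = x%:C by rewrite cpow_real// ya.
have Ex : cpow x ((1 - b) / a%:C) = cpow y (1 - b).
  rewrite /cpow /y ln_powR; congr cexp.
  by rewrite rmorphM fmorphV; ring.
have E1 : cpow y ((2 * a)%:C - b + 1) = x%:C ^+ 2 * cpow y (1 - b).
  rewrite (_ : (2 * a)%:C - b + 1 = a%:C + a%:C + (1 - b)); last first.
    by rewrite rmorphM rmorph_nat; ring.
  by rewrite 2!cpowD ypow expr2.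
have E2 : cpow y (a%:C - b + 1) = x%:C * cpow y (1 - b).
  rewrite (_ : a%:C - b + 1 = a%:C + (1 - b)); last by ring.
  by rewrite cpowD ypow.
rewrite Ex E1 E2; move: (cpow y (1 - b)) (csin _) (csin _) (intC _ _) (intC _ _).
move: (x%:C : R[i]) xC (pi%:C : R[i]) piC => X X0 p p0.
have := @i_neq0 R; move: ('i : R[i]) => j j0 Y s1 s2 I1 I2.
by field; rewrite ?X0 ?p0 ?j0.
Qed.
End kernel.
End collapse.

(** * The representation for [a < 1] and its limit at [a = 1] *)

Section representation.
Variable R : realType.
Notation mu := (@lebesgue_measure R).
Implicit Types (a x r : R) (b : R[i]).

Lemma mlIntegralRepE a b x r : 0 < a -> a < 1 -> Re b < a + 1 -> 0 < x ->
  1 <= r -> 2 * x <= r `^ a ->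
  mlIntegralRep a b x = hankel r (ml_kernel a x b) / (2 * 'i * pi%:C).
Proof.
move=> a0 a1 ba x0 r1 xr.
by rewrite (hankel_kernel_collapse a0 a1 x0 ba)// (lt_le_trans ltr01 r1).
Qed.

(** A radius at least [1] and at least [(2 x)^(1 / a0)] suits every [a >= a0] at once, as the
    passage to the limit in [a] requires. *)
Lemma le_powR_radius a x a0 : 0 < a0 -> a0 <= a -> 0 < x ->
  2 * x <= Num.max 1 ((2 * x) `^ a0^-1) `^ a.
Proof.
move=> a00 aa x0; set r := Num.max _ _.
have r1 : 1 <= r by rewrite le_max lexx.
apply: (@le_trans _ _ (r `^ a0)); last exact: ler_powR.
have y0 : 0 <= 2 * x by rewrite mulr_ge0// ltW.
have -> : 2 * x = ((2 * x) `^ a0^-1) `^ a0 by rewrite -powRrM mulVf ?gt_eqF// powRr1.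
apply: ge0_ler_powR; rewrite ?nnegrE ?powR_ge0 ?(ltW a00) ?(le_trans ler01 r1)//.
by rewrite le_max lexx orbT.
Qed.

Lemma mlIntegralRep_mittagLeffler a b x : 0 < a -> a < 1 -> Re b < a + 1 -> 0 < x ->
  mittagLeffler a%:C b (- x%:C) = mlIntegralRep a b x.
Proof.
move=> a0 a1 ba x0.
have xr := le_powR_radius a0 (lexx a) x0.
have r1 : 1 <= Num.max 1 ((2 * x) `^ a^-1) by rewrite le_max lexx.
by rewrite (mittagLeffler_hankel b a0 x0 r1 xr) (mlIntegralRepE a0 a1 ba x0 r1 xr).
Qed.

Lemma ml_kernel_cvg x b r (v : nat -> R) a u t :
  0 < a -> 0 < x -> 1 <= r -> 2 * x <= r `^ a -> r <= u ->
  v n @[n --> \oo] --> a ->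
  ccvg \oo (fun n => ml_kernel (v n) x b u t) (ml_kernel a x b u t).
Proof.
move=> a0 x0 r1 xr ru va; apply: ccvgM; first exact: ccvg_cst.
apply: ccvgV; first exact: (ml_ratio_neq1 a0 x0 r1 xr).
apply: ccvgB; first exact: ccvg_cst.
apply: ccvgN; apply: ccvgM; first exact: ccvg_cst.
apply: ccvg_cexp; apply: ccvgM; last exact: ccvg_cst.
by apply: ccvgN; exact: ccvg_real.
Qed.

(** The integrals themselves have no common majorant as [a] tends to [1], since their denominator
    degenerates at [u = 1]. The Hankel integrals that they equal do, on a contour of fixed
    radius. *)
Lemma mlIntegralRep_cvg1 b x : Re b < 2 -> 0 < x ->
  ccvg ((1 : R)^'-) (fun a => mlIntegralRep a b x) (mittagLeffler 1%:C b (- x%:C)).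
Proof.
move=> b2 x0.
have h0 : (0 : R) < 2^-1 by rewrite invr_gt0.
have h1 : 2^-1 <= 1 :> R by rewrite invf_le1// ler1n.
pose r := Num.max 1 ((2 * x) `^ (2^-1)^-1).
have r1 : 1 <= r by rewrite le_max lexx.
have xr a : 2^-1 <= a -> 2 * x <= r `^ a by move=> ha; exact: le_powR_radius.
have seqP (u : nat -> R) : (forall n, u n < 1) -> u n @[n --> \oo] --> (1 : R) ->
    ccvg \oo (fun n => mlIntegralRep (u n) b x) (mittagLeffler 1%:C b (- x%:C)).
  move=> u1 ucvg.
  (* Early terms of [u] may be small or negative; truncating them at [1/2] makes the radius [r]
     valid for every [n]. *)
  pose v n := Num.max (2^-1) (u n).
  have v2 n : 2^-1 <= v n by rewrite le_max lexx.
  have v0 n : 0 < v n by exact: lt_le_trans h0 _.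
  (* As [u] tends to [1] and [Re b < 2], eventually the truncation is inactive and the condition on
     [b] holds at [u n]. *)
  have uv : \forall n \near \oo, v n = u n /\ Re b < u n + 1.
    have [k1 k2] : 2^-1 < 1 :> R /\ Re b - 1 < 1 by split; lra.
    have e1 := cvgr_gt 1 ucvg _ k1; have e2 := cvgr_gt 1 ucvg _ k2.
    near=> n; split.
      by apply/max_idPr; apply: ltW; near: n; exact: e1.
    by rewrite -ltrBlDr; near: n; exact: e2.
  have vcvg : v n @[n --> \oo] --> (1 : R).
    apply: cvg_trans ucvg; apply: near_eq_cvg.
    by apply: filterS uv => n [->].
  have L : ccvg \oo (fun n => hankel r (ml_kernel (v n) x b) / (2 * 'i * pi%:C))
      (hankel r (ml_kernel 1 x b) / (2 * 'i * pi%:C)).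
    apply: ccvgM; last exact: ccvg_cst.
    have ig := integrable_esp_majorant (1 - b) (lt_le_trans ltr01 r1).
    have ig2 : mu.-integrable `]r, +oo[ (EFin \o (fun u => 2 * esp_majorant (1 - b) u)).
      exact: (integrableZl _ 2 ig).
    apply: (hankel_cvg r1 ig2 (fun n => hankel_dom_kernel b (v0 n) x0 r1 (xr _ (v2 n)))).
    by move=> w t rw _; apply: (ml_kernel_cvg b t ltr01 x0 r1 _ rw vcvg); exact: xr.
  rewrite (mittagLeffler_hankel b ltr01 x0 r1 (xr _ h1)).
  apply: ccvg_near_eq L; apply: filterS uv => n [e bn].
  have vn1 : v n < 1 by rewrite e.
  have bv : Re b < v n + 1 by rewrite e.
  by rewrite -(mlIntegralRepE (v0 n) vn1 bv x0 r1 (xr _ (v2 n))) e.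
(* Dominated convergence is sequential, so the left limit is tested on sequences. *)
split; apply/cvg_at_leftP => u [u1 ucvg]; by case: (seqP u u1 ucvg).
Unshelve. all: end_near. Qed.

End representation.

(* At a = 1 the denominator of the integrands is (1 - u)^2 and the integrals
   diverge; the right-hand side is then its limit as the parameter tends to 1
   from below. *)
Theorem mainTheorem14 (R : realType) (a : R) (b : R[i]) (x : R)
    (a_gt0 : 0 < a) (a_le1 : a <= 1) (b_lt : complex.Re b < a + 1)
    (x_gt0 : 0 < x) :
  (a < 1 ->
    [/\ cintegrable (mlIntegrand a x (a%:C - b)),
        cintegrable (mlIntegrand a x ((2 * a)%:C - b)) &
        mittagLeffler a%:C b (- x%:C) = mlIntegralRep a b x]) /\
  (a = 1 ->
    (mlIntegralRep a' b x : R[i]^o) @[a' --> a^'-]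
      --> (mittagLeffler a%:C b (- x%:C) : R[i]^o)).
Proof.
split=> [a1|a1].
  split; last exact: mlIntegralRep_mittagLeffler.
  - by apply: cintegrable_mlIntegrand => //; rewrite cReD cReN Re_real; lra.
  - by apply: cintegrable_mlIntegrand => //; rewrite cReD cReN Re_real; lra.
subst a; apply: ccvg_cvg; exact: mlIntegralRep_cvg1.
Qed.
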